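(* Let $l\ge1$, $d\ge1$, and let $Q_1,\dots,Q_l$ be nondegenerate symmetric bilinear forms on $\mathbb R^d$. Suppose $E_1,\dots,E_{2l}\subset\mathbb R^d$ are compact sets with $\dim_{\mathcal H}(E_i)>\frac d2+\frac1{2l}$ for all $1\le i\le 2l$. Then the set $$\Sigma_{\vec Q}(E_1,\dots,E_{2l}):=\left\{\sum_{j=1}^l Q_j\left(x^{2j-1},x^{2j}\right) : x^i\in E_i,\ 1\le i\le 2l\right\}\subset\mathbb R$$ has nonempty interior. In particular, under the same conditions on the $\dim_{\mathcal H}(E_i)$, the set $$\left\{(x^1\cdot x^2)+(x^3\cdot x^4)+\cdots+(x^{2l-1}\cdot x^{2l}) : x^i\in E_i,\ 1\le i\le 2l\right\}$$ has nonempty interior.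
   Context: $\dim_{\mathcal H}$ denotes Hausdorff dimension and $x\cdot y$ the Euclidean inner product on $\mathbb R^d$. *)

(* Defs.v *)
From HB Require Import structures.
From mathcomp Require Import all_boot all_order all_algebra.
From mathcomp Require Import all_classical all_reals all_analysis.
Set Implicit Arguments. Unset Strict Implicit. Unset Printing Implicit Defensive.
Import Order.TTheory GRing.Theory Num.Theory.
Import numFieldNormedType.Exports.
Local Open Scope classical_set_scope.
Local Open Scope ring_scope.

Section Hausdorff.
Variables (R : realType) (d : nat).
Local Notation V := 'rV[R]_d.

Definition dotv (x y : V) : R := \sum_(k < d) x ord0 k * y ord0 k.
Definition edist (x y : V) : R := Num.sqrt (dotv (x - y) (x - y)).

(* Euclidean diameter (-oo for the empty set) *)
Definition ediam (U : set V) : \bar R :=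
  ereal_sup [set (edist x y)%:E | x in U & y in U].

Definition cover_cost (s : R) (U : set V) : R :=
  if `[< U = set0 >] then 0 else (fine (ediam U)) `^ s.

Definition hausdorff_delta (s delta : R) (E : set V) : \bar R :=
  ereal_inf [set (\sum_(0 <= i <oo) (cover_cost s (U i))%:E)%E
            | U in [set U : nat -> set V |
                     E `<=` \bigcup_i U i /\ forall i, (ediam (U i) <= delta%:E)%E]].

Definition hausdorff_measure (s : R) (E : set V) : \bar R :=
  ereal_sup [set hausdorff_delta s delta E | delta in [set delta : R | 0 < delta]].

Definition hausdorff_dim (E : set V) : \bar R :=
  ereal_inf [set s%:E | s in [set s : R | 0 <= s /\ hausdorff_measure s E = 0%E]].

Definition nondeg_sym_bilinear (Q : V -> V -> R) : Prop :=
  [/\ (forall a x y z, Q (a *: x + y) z = a * Q x z + Q y z),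
      (forall a x y z, Q x (a *: y + z) = a * Q x y + Q x z),
      (forall x y, Q x y = Q y x) &
      (forall x, (forall y, Q x y = 0) -> x = 0)].
End Hausdorff.

(* Main.v *)
Require Import Defs.
From HB Require Import structures.
From mathcomp Require Import all_boot all_order all_algebra.
From mathcomp Require Import all_classical all_reals all_analysis.
From mathcomp Require Import complex ring lra zify.
Set Implicit Arguments. Unset Strict Implicit. Unset Printing Implicit Defensive.
Import Order.TTheory GRing.Theory Num.Theory.
Import numFieldNormedType.Exports.
Local Open Scope classical_set_scope.
Local Open Scope ring_scope.

(* Put the points x^{2j-1}, pushed through the forms Q_j, into one vector X and the
   points x^{2j} into one vector Y, both with D = ld coordinates: the sum is X.Y, and
   the products of Frostman measures on the E_i charge balls of radius rho with mass
   O(rho^S), where 2S > D + 1.  On a chart |X_c| >= eta the equation X.Y = r becomes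
   omega.Y = r/X_c with omega = X/X_c.

   All measures are finite, discretised at scale 2^-n.  Let N_K(r) be the average of
   the Fejer kernel of order K at a multiple of omega.Y - r/X_c.  A block of frequencies
   K <= k < 2K contributes O(K^-eps |r|^{-1/2}) to N_K(r), uniformly in n as long as
   K = O(2^n): by Cauchy-Schwarz in Y, whose measure is dominated on cells of side about
   1/K by a multiple of a uniform grid, this reduces to an exponential sum over pairs
   (X, X'), where omega_c = 1 makes distinct frequencies orthogonal, and the ball
   condition bounds the mass of the pairs with close omega.  Hence N_K(r) is close to
   N_{K_0}(r) for a fixed K_0.  The latter is Lipschitz in r and bounded below on average
   over r, so it is bounded below on an interval around a point r of a finite list
   independent of n, and for K of order 2^n this forces a value X.Y very close to each
   point of that interval.  If the set of sums, which is closed, had empty interior, each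
   of the finitely many intervals would contain a point at positive distance from it. *)

(** * Complex numbers and their modulus *)

Section ComplexNorm.
Variable R : realType.

(** The threshold comes from counting powers of K in the square of a block. Dominating the measure
    of Y by a uniform grid costs K^(D-S). For fixed X, the points X' with nearly the same omega lie
    along a line; those at radial distance about m/K from X fit in two balls of radius O(1/K), of
    mass O(K^-S), and the sum over the block gives each of them K/(|r|(m+1)). Up to a logarithm the
    total is K^(D+1-2S)/|r|. With S = ls and D = ld the exponent is negative exactly when s > d/2 +
    1/(2l). The cutoff for close omega is in fact a small power of K above 1/K, so that repeated
    geometric sums can defeat the remaining pairs; this loss and the logarithm fit in the slack of
    the strict inequality.

    The obstacle is r = 0: there the intercept r/X_c no longer separates points on a line through
    the origin, whence the factor |r|^(-1/2). That singularity is integrable, so values of r near 0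
    carry little of the average and a good r can be found away from 0.

    Finite measures turn all of the Fourier analysis into finite sums, without weak limits; the
    price is that every constant must be uniform in n. *)

Definition Cx : numClosedFieldType := R[i].

Definition cx (x : R) : Cx := (x%:C)%C.
Definition mkcx (x y : R) : Cx := (x +i* y)%C.
Definition nc (z : Cx) : R := ComplexField.Normc.normc z.

Implicit Types (x y : R) (z : Cx).

Lemma nc0 : nc 0 = 0. Proof. exact: ComplexField.Normc.normc0. Qed.

Lemma nc1 : nc 1 = 1. Proof. exact: ComplexField.Normc.normc1. Qed.

Lemma ncM z z' : nc (z * z') = nc z * nc z'.
Proof. exact: ComplexField.Normc.normcM. Qed.

Lemma ncV z : nc z^-1 = (nc z)^-1.
Proof. exact: ComplexField.Normc.normcV. Qed.

Lemma nc_ge0 z : 0 <= nc z.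
Proof. by case: z => a b; exact: sqrtr_ge0. Qed.

Lemma ncD_le z z' : nc (z + z') <= nc z + nc z'.
Proof. exact: le_normcD. Qed.

Lemma ncN z : nc (- z) = nc z.
Proof. exact: normcN. Qed.

Lemma nc_cx x : nc (cx x) = `|x|.
Proof. by rewrite /nc /= expr0n addr0 sqrtr_sqr. Qed.

Lemma nc_conj z : nc z^* = nc z.
Proof. by case: z => a b; rewrite /nc /= sqrrN. Qed.

Lemma nc_sqr z : cx (nc z ^+ 2) = z * z^*.
Proof.
case: z => a b; rewrite /nc /= sqr_sqrtr ?addr_ge0 ?sqr_ge0//.
by apply/eqP; rewrite eq_complex /=; apply/andP; split; apply/eqP; ring.
Qed.

Lemma cx_sum (I : Type) (r : seq I) (P : pred I) (F : I -> R) :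
  cx (\sum_(i <- r | P i) F i) = \sum_(i <- r | P i) cx (F i).
Proof. exact: (rmorph_sum (@real_complex R)). Qed.

Lemma cx1 : cx 1 = 1. Proof. by []. Qed.

Lemma cx0 : cx 0 = 0. Proof. by []. Qed.

Lemma cxD x y : cx (x + y) = cx x + cx y.
Proof. exact: (rmorphD (@real_complex R)). Qed.

Lemma cxM x y : cx (x * y) = cx x * cx y.
Proof. exact: (rmorphM (@real_complex R)). Qed.

Lemma cxB x y : cx (x - y) = cx x - cx y.
Proof. exact: (rmorphB (@real_complex R)). Qed.

Lemma conj_cx x : (cx x)^* = cx x.
Proof. exact: conjc_real. Qed.

Lemma nc_mkcx x y : nc (mkcx x y) = Num.sqrt (x ^+ 2 + y ^+ 2).
Proof. by []. Qed.

Lemma mkcx10 : mkcx 1 0 = 1. Proof. by []. Qed.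

Lemma mkcxM a b c d : mkcx a b * mkcx c d = mkcx (a * c - b * d) (a * d + b * c).
Proof. by []. Qed.

Lemma mkcxB a b c d : mkcx a b - mkcx c d = mkcx (a - c) (b - d).
Proof. by []. Qed.

Lemma conj_mkcx a b : (mkcx a b)^* = mkcx a (- b).
Proof. by []. Qed.

End ComplexNorm.
Global Opaque Cx cx mkcx nc.

(** * The exponential e(x) = exp(2 pi i x), geometric sums and summation by parts *)

Section Exponential.
Variable R : realType.
Implicit Types (x y : R) (z : Cx R).

Lemma nc_sum (I : Type) (r : seq I) (P : pred I) (F : I -> Cx R) :
  nc (\sum_(i <- r | P i) F i) <= \sum_(i <- r | P i) nc (F i).
Proof.
elim/big_ind2 : _ => //; first by rewrite nc0.
by move=> a b c d ab cd; apply: (le_trans (ncD_le _ _)); exact: lerD.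
Qed.

Lemma nc_prod (I : Type) (r : seq I) (P : pred I) (F : I -> Cx R) :
  nc (\prod_(i <- r | P i) F i) = \prod_(i <- r | P i) nc (F i).
Proof.
elim/big_ind2 : _ => //; first by rewrite nc1.
by move=> a b c d <- <-; rewrite ncM.
Qed.

Definition e x : Cx R := mkcx (cos (2 * pi * x)) (sin (2 * pi * x)).

Lemma e0 : e 0 = 1.
Proof. by rewrite /e mulr0 cos0 sin0 mkcx10. Qed.

Lemma eD x y : e (x + y) = e x * e y.
Proof.
by rewrite /e mulrDr cosD sinD mkcxM [_ + cos _ * sin _]addrC.
Qed.

Lemma eN x : e (- x) = (e x)^*.
Proof. by rewrite /e mulrN cosN sinN conj_mkcx. Qed.

Lemma nc_e x : nc (e x) = 1.
Proof. by rewrite nc_mkcx cos2Dsin2 sqrtr1. Qed.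

Lemma e_sum (I : Type) (r : seq I) (P : pred I) (F : I -> R) :
  e (\sum_(i <- r | P i) F i) = \prod_(i <- r | P i) e (F i).
Proof. by apply: (big_morph e eD e0). Qed.

Lemma eMn n x : e (n%:R * x) = e x ^+ n.
Proof.
elim: n => [|n IH]; first by rewrite mul0r e0 expr0.
by rewrite -natr1 mulrDl mul1r eD IH exprSr.
Qed.

Lemma e_nat n : e n%:R = 1.
Proof.
have e1 : e 1 = 1.
  by rewrite /e mulr1 mulr_natl cos2pi sin2pi mkcx10.
by rewrite -[n%:R]mulr1 eMn e1 expr1n.
Qed.

Lemma sin_MVT x : 0 < x -> exists2 c, 0 < c < x & sin x = cos c * x.
Proof.
move=> x0.
have der y : y \in `]0, x[%R -> is_derive y 1 sin (cos y).
  by move=> _; exact: is_derive_sin.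
have con : {within `[0, x], continuous (@sin R)}.
  by apply: continuous_subspaceT => y; exact: continuous_sin.
have [c] := MVT x0 der con.
by rewrite in_itv /= sin0 !subr0 => cx ->; exists c.
Qed.

Lemma sin_le_id x : `|sin x| <= `|x|.
Proof.
wlog x0 : x / 0 < x.
  move=> W; have [x0|x0|->] := ltgtP x 0; last by rewrite sin0.
    by rewrite -normrN -sinN -[`|x|]normrN W// oppr_gt0.
  exact: W.
have [c _ ->] := sin_MVT x0.
by rewrite normrM ler_piMl// cos_max.
Qed.

Lemma sin_ge_half x : `|x| <= 1 -> `|x| / 2 <= `|sin x|.
Proof.
wlog x0 : x / 0 < x.
  move=> W; have [x0|x0|->] := ltgtP x 0; last by rewrite sin0 normr0 mul0r.
    by rewrite -[`|sin x|]normrN -sinN -[`|x|]normrN; apply: W; rewrite oppr_gt0.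
  exact: W.
rewrite (ger0_norm (ltW x0)) => x1.
have [c /andP[c0 cx] ->] := sin_MVT x0.
(* Half-angle formula: cos c = 1 - 2 sin^2(c/2), and |sin(c/2)| <= c/2 <= 1/2. *)
have cc : 2^-1 <= cos c.
  have {1}-> : c = (c / 2) *+ 2 by rewrite mulr2n; field.
  rewrite cos_mulr2n cos2sin2.
  have : sin (c / 2) ^+ 2 <= (c / 2) ^+ 2.
    rewrite -[leLHS]real_normK ?num_real// -[leRHS]real_normK ?num_real//.
    by rewrite ler_sqr ?nnegrE// sin_le_id.
  have : (c / 2) ^+ 2 <= 4^-1.
    have -> : 4^-1 = 2^-1 ^+ 2 :> R by field.
    by rewrite ler_sqr ?nnegrE ?invr_ge0 ?divr_ge0 ?(ltW c0)//; lra.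
  set s := sin _ ^+ 2; set q := (_ / _) ^+ 2; move=> ? ?; lra.
rewrite ger0_norm; last by rewrite mulr_ge0 ?(ltW x0)//; lra.
by rewrite mulrC ler_wpM2r// ltW.
Qed.

Lemma nc_e_sub1 x : nc (e x - 1) = 2 * `|sin (pi * x)|.
Proof.
rewrite /e; have -> : 2 * pi * x = (pi * x) *+ 2 by rewrite mulr2n; ring.
rewrite -mkcx10 mkcxB nc_mkcx cos_mulr2n sin_mulr2n cos2sin2 subr0.
set s := sin _; set c := cos _.
have cs : c ^+ 2 + s ^+ 2 = 1 by exact: cos2Dsin2.
have -> : ((1 - s ^+ 2) *+ 2 - 1 - 1) ^+ 2 + (c * s *+ 2) ^+ 2 = (2 * s) ^+ 2.
  rewrite !mulr2n.
  transitivity (4 * s ^+ 2 * (c ^+ 2 + s ^+ 2)); first ring.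
  by rewrite cs; ring.
by rewrite sqrtr_sqr normrM ger0_norm.
Qed.

Lemma e_sub1_le x : nc (e x - 1) <= 8 * `|x|.
Proof.
rewrite nc_e_sub1.
have := sin_le_id (pi * x); rewrite normrM (ger0_norm (pi_ge0 R)).
have := pihalf_lt2 R; have := normr_ge0 x; nra.
Qed.

(** The bound 1/8 places pi x in [-1, 1] using only pi < 4. It is the origin of every later
    requirement that a phase or a step be at most 1/8. *)
Lemma e_sub1_ge x : `|x| <= 8^-1 -> 2 * `|x| <= nc (e x - 1).
Proof.
move=> x8; rewrite nc_e_sub1.
have x0 := normr_ge0 x.
have p4 := pihalf_lt2 R; have p2 := pi_ge2 R.
have px : `|pi * x| <= 1.
  by rewrite normrM (ger0_norm (pi_ge0 R)); nra.
have := sin_ge_half px; rewrite normrM (ger0_norm (pi_ge0 R)); nra.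
Qed.

Lemma nc_geom n x : x != 0 -> `|x| <= 8^-1 ->
  nc (\sum_(k < n) e (k%:R * x)) <= `|x|^-1.
Proof.
move=> x0 x8; have xp : 0 < `|x| by rewrite normr_gt0.
have /(f_equal (@nc R)) : (e x - 1) * (\sum_(k < n) e (k%:R * x)) = e (n%:R * x) - 1.
  rewrite eMn subrX1; congr (_ * _); apply: eq_bigr => k _; exact: eMn.
rewrite ncM => E.
have h1 : nc (e (n%:R * x) - 1) <= 2.
  by apply: (le_trans (ncD_le _ _)); rewrite ncN nc_e nc1.
have h2 := e_sub1_ge x8.
rewrite -(ler_pM2l xp) divff ?gt_eqF//.
have := nc_ge0 (\sum_(k < n) e (k%:R * x)); nra.
Qed.

Lemma sum_e_eq0 n x : x != 0 -> `|x| <= 8^-1 -> e (n%:R * x) = 1 ->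
  \sum_(k < n) e (k%:R * x) = 0.
Proof.
move=> x0 x8 E.
have e1 : e x - 1 != 0.
  apply/eqP => /(f_equal (@nc R)); rewrite nc0 => h.
  have := e_sub1_ge x8; rewrite h.
  by rewrite leNgt mulr_gt0 // normr_gt0.
apply: (mulfI e1); rewrite mulr0.
under eq_bigr do rewrite eMn.
by rewrite -subrX1 -eMn E subrr.
Qed.

(** Summation by parts: [n%:R * V] bounds the total variation of the coefficients, [B] the partial
    sums of [z]. *)
Lemma abel_bound (c z : nat -> Cx R) n (A V B : R) : 0 <= A -> 0 <= V ->
  (forall m, (m <= n)%N -> nc (\sum_(k < m) z k) <= B) ->
  (forall k, (k < n)%N -> nc (c k) <= A) ->
  (forall k, (k.+1 < n)%N -> nc (c k.+1 - c k) <= V) ->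
  nc (\sum_(k < n) c k * z k) <= (A + n%:R * V) * B.
Proof.
move=> A0 V0 hz hc hd.
have B0 : 0 <= B by apply: le_trans (hz 0 (leq0n _)); exact: nc_ge0.
case: n hz hc hd => [|n] hz hc hd.
  by rewrite big_ord0 nc0 mul0r addr0 mulr_ge0.
have -> : \sum_(k < n.+1) c k * z k = c n * (\sum_(k < n.+1) z k)
    - \sum_(k < n) (c k.+1 - c k) * \sum_(j < k.+1) z j.
  clear; elim: n => [|n IH].
    by rewrite !big_ord_recr !big_ord0 /= !add0r subr0.
  rewrite big_ord_recr /= IH.
  have -> : \sum_(k < n.+2) z k = \sum_(k < n.+1) z k + z n.+1 by rewrite big_ord_recr.
  rewrite [X in _ = _ - X]big_ord_recr /=; ring.
apply: (le_trans (ncD_le _ _)); rewrite ncN ncM mulrDl.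
apply: lerD.
  by apply: ler_pM (nc_ge0 _) (nc_ge0 _) (hc _ _) (hz _ _).
apply: (le_trans (nc_sum _ _ _)).
apply: (@le_trans _ _ (\sum_(k < n) V * B)).
  apply: ler_sum => k _; rewrite ncM.
  by apply: ler_pM (nc_ge0 _) (nc_ge0 _) (hd _ _) (hz _ _); have := ltn_ord k; lia.
rewrite sumr_const card_ord -[leLHS]mulr_natl -mulrA ler_wpM2r ?mulr_ge0//.
by rewrite ler_nat.
Qed.

End Exponential.

(** * Two inequalities for finite sums *)

Section FiniteSums.
Variable R : realType.

Lemma sum_inj_le (I J : finType) (P : pred I) (h : I -> J) (F : J -> R) :
  (forall j, 0 <= F j) -> {in P &, injective h} ->
  \sum_(i | P i) F (h i) <= \sum_j F j.
Proof.
move=> F0 hi.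
rewrite -(big_imset F (A := P) (h := h)) /=; last by [].
rewrite [leRHS](bigID (mem (h @: P)%SET)) /= lerDl.
by apply: sumr_ge0.
Qed.

(** The variance about m, the weighted sum of g, is nonnegative. A total mass below 1 does no harm,
    since m^2 times that mass is still at most m^2. *)
Lemma jensen_sqr (I : finType) (p g : I -> R) :
  (forall i, 0 <= p i) -> \sum_i p i <= 1 ->
  (\sum_i p i * g i) ^+ 2 <= \sum_i p i * g i ^+ 2.
Proof.
move=> p0 p1; have [m mE] : exists m, m = \sum_i p i * g i by eexists.
rewrite -mE.
have : 0 <= \sum_i p i * (g i - m) ^+ 2.
  by apply: sumr_ge0 => i _; rewrite mulr_ge0// sqr_ge0.
have -> : \sum_i p i * (g i - m) ^+ 2 =
   \sum_i p i * g i ^+ 2 - 2 * m * m + m ^+ 2 * \sum_i p i.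
  transitivity (\sum_i p i * g i ^+ 2 - 2 * m * (\sum_i p i * g i)
      + m ^+ 2 * \sum_i p i); last by rewrite -mE.
  rewrite !mulr_sumr -sumrB -big_split /=; apply: eq_bigr => i _; ring.
have : m ^+ 2 * \sum_i p i <= m ^+ 2 by rewrite ler_piMr// sqr_ge0.
lra.
Qed.

End FiniteSums.

(** * Exponential sums over a block of frequencies *)

Section Block.
Variables (R : realType) (T I : finType) (om : I -> T -> R) (u : I -> R).
Variables (H K M : nat) (c : T).
Hypothesis omc : forall i, om i c = 1.

Definition phase i (y : T -> R) : R := \sum_t om i t * y t - u i.

(* Shifting by a sum of [M] independent uniform grid points makes the [Z]-sum of
   an exponential a product of [M] geometric sums in each coordinate. *)
Definition shifted (y0 : T -> R) (Z : {ffun 'I_M * T -> 'I_H}) : T -> R :=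
  fun t => y0 t + \sum_(a < M) (Z (a, t))%:R / H%:R.

Lemma phase_shifted i y0 Z : phase i (shifted y0 Z) =
  phase i y0 + \sum_p (Z p)%:R * (om i p.2 / H%:R).
Proof.
rewrite /phase /shifted addrAC; congr (_ + _).
rewrite (eq_bigr (fun t => om i t * y0 t +
   \sum_(a < M) (Z (a, t))%:R * (om i t / H%:R))); last first.
  move=> t _; rewrite mulrDr; congr (_ + _); rewrite mulr_sumr.
  by apply: eq_bigr => a _; ring.
rewrite big_split /=; congr (_ + _).
by rewrite exchange_big pair_bigA /=; apply: eq_bigr => -[].
Qed.

Lemma sum_e_shifted (x x' : R) i i' y0 :
  \sum_Z e (x * phase i (shifted y0 Z) - x' * phase i' (shifted y0 Z)) =
  e (x * phase i y0 - x' * phase i' y0) *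
  \prod_(p : 'I_M * T) \sum_(z < H) e (z%:R * ((x * om i p.2 - x' * om i' p.2) / H%:R)).
Proof.
rewrite bigA_distr_bigA mulr_sumr; apply: eq_bigr => Z _.
rewrite -e_sum -eD; congr e; rewrite !phase_shifted !mulrDr opprD addrACA.
congr (_ + _); rewrite !mulr_sumr -sumrB; apply: eq_bigr => p _; ring.
Qed.

Variable cf : I -> nat -> Cx R.

Definition expsum (y : T -> R) : Cx R :=
  \sum_i \sum_(k < K) cf i k * e ((K + k)%:R * phase i y).

(* Since [om i c = 1] for all [i], summing over [Z] in the coordinate [c] kills all
   the terms with two distinct frequencies. *)
Lemma sum_sqr_expsum y0 : (0 < M)%N -> (8 * K <= H)%N ->
  \sum_Z nc (expsum (shifted y0 Z)) ^+ 2 <=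
  \sum_i \sum_i' nc (\sum_Z \sum_(k < K) cf i k * (cf i' k)^* *
     e ((K + k)%:R * (phase i (shifted y0 Z) - phase i' (shifted y0 Z)))).
Proof.
move=> M0 KH.
have [K0|K0] := posnP K.
  rewrite big1 => [|Z _]; last first.
    rewrite /expsum big1 ?nc0 ?expr0n// => i _.
    by apply: big1 => -[k] /=; rewrite {1}K0.
  by apply: sumr_ge0 => i _; apply: sumr_ge0 => j _; exact: nc_ge0.
have H0 : (0 < H)%N by lia.
have Hr : (0 : R) < H%:R by rewrite ltr0n.
set lhs := (X in X <= _).
pose W := \sum_i \sum_i' \sum_Z \sum_(k < K) cf i k * (cf i' k)^* *
     e ((K + k)%:R * (phase i (shifted y0 Z) - phase i' (shifted y0 Z))).
have E : cx lhs = W.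
  rewrite cx_sum /=.
  under eq_bigr do rewrite nc_sqr {1}/expsum mulr_suml.
  rewrite exchange_big /=; apply: eq_bigr => i _.
  under eq_bigr => Z _.
    rewrite /expsum rmorph_sum mulr_sumr /=.
    over.
  rewrite exchange_big /=; apply: eq_bigr => i' _.
  have step Z : (\sum_(k < K) cf i k * e ((K + k)%:R * phase i (shifted y0 Z))) *
     (\sum_(k < K) cf i' k * e ((K + k)%:R * phase i' (shifted y0 Z)))^* =
     \sum_(k < K) \sum_(k' < K) cf i k * (cf i' k')^* *
       e ((K + k)%:R * phase i (shifted y0 Z) - (K + k')%:R * phase i' (shifted y0 Z)).
    rewrite mulr_suml; apply: eq_bigr => k _.
    rewrite rmorph_sum mulr_sumr; apply: eq_bigr => k' _.
    by rewrite rmorphM /= mulrACA -eN -eD.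
  under eq_bigr do rewrite step.
  rewrite exchange_big [RHS]exchange_big /=; apply: eq_bigr => k _.
  rewrite exchange_big /= (bigD1 k)//= [X in _ + X]big1 ?addr0.
    by apply: eq_bigr => Z _; rewrite -mulrBr.
  move=> k' kk'.
  (* The factor of coordinate [c] is a geometric sum of [H] terms with step (k - k')/H. It runs over
     whole periods, and [8 * K <= H] keeps the nonzero step within 1/8, so that its exponential is
     not 1. *)
  rewrite -mulr_sumr sum_e_shifted (bigD1 (Ordinal M0, c))//= !omc !mulr1.
  rewrite sum_e_eq0 ?mul0r ?mulr0//.
  - rewrite mulf_eq0 invr_eq0 negb_or subr_eq0 eqr_nat eqn_add2l eq_sym.
    by rewrite kk' gt_eqF.
  - rewrite normrM normfV [`|H%:R|]gtr0_norm// ler_pdivrMr//.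
    have [hk hk'] : (k < K)%N /\ (k' < K)%N by rewrite !ltn_ord.
    have : (K%:R : R) <= 8^-1 * H%:R.
      have : ((8 * K)%:R : R) <= H%:R by rewrite ler_nat.
      rewrite natrM; lra.
    apply: le_trans.
    rewrite !natrD opprD addrACA subrr add0r.
    have [a b] : (k%:R : R) <= K%:R /\ (k'%:R : R) <= K%:R by rewrite !ler_nat; split; exact: ltnW.
    have := ler0n R k; have := ler0n R k'.
    by move=> ? ?; rewrite ler_norml; apply/andP; split; lra.
  - rewrite mulrC divfK ?gt_eqF// eD eN !e_nat.
    by rewrite conjC1 mulr1.
have l0 : 0 <= lhs by apply: sumr_ge0 => Z _; rewrite sqr_ge0.
have -> : lhs = nc W by rewrite -E nc_cx ger0_norm.
apply: (le_trans (nc_sum _ _ _)); apply: ler_sum => i _.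
exact: nc_sum.
Qed.

End Block.

(** * Three bounds for the contribution of one pair of slopes *)

Section PairBounds.
Variables (R : realType) (T I : finType) (om : I -> T -> R) (u : I -> R).
Variables (H K M : nat).
Variables (cf : I -> nat -> Cx R) (i i' : I) (y0 : T -> R).

Let term (Z : {ffun 'I_M * T -> 'I_H}) (k : nat) : Cx R :=
  cf i k * (cf i' k)^* *
     e ((K + k)%:R * (phase om u i (shifted y0 Z) - phase om u i' (shifted y0 Z))).

Lemma nc_pair_trivial (A : R) : 0 <= A ->
  (forall k, (k < K)%N -> nc (cf i k * (cf i' k)^*) <= A) ->
  nc (\sum_Z \sum_(k < K) term Z k) <= (H ^ (M * #|T|))%:R * (K%:R * A).
Proof.
move=> A0 hA; apply: (le_trans (nc_sum _ _ _)).
have -> : (H ^ (M * #|T|))%:R * (K%:R * A) =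
    \sum_(Z : {ffun 'I_M * T -> 'I_H}) K%:R * A.
  by rewrite sumr_const card_ffun card_prod !card_ord mulr_natl.
apply: ler_sum => Z _; apply: (le_trans (nc_sum _ _ _)).
have -> : K%:R * A = \sum_(k < K) A by rewrite sumr_const card_ord mulr_natl.
by apply: ler_sum => k _; rewrite /term ncM nc_e mulr1 hA.
Qed.

(** Each of the [M] geometric sums in the coordinate [t] has a step of size at least K sg / H, hence
    is at most H / (K sg); the other factors are bounded by their [H] terms. Frequencies below 2K
    and slopes up to [Om] give steps of at most 4 K Om / H, which is where 32 comes from. *)
Lemma nc_pair_far (A Om sg : R) (t : T) : 0 <= A -> (0 < K)%N ->
  (forall k, (k < K)%N -> nc (cf i k * (cf i' k)^*) <= A) ->
  (forall t, `|om i t| <= Om) -> (forall t, `|om i' t| <= Om) ->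
  32 * K%:R * Om <= H%:R ->
  0 < sg -> sg <= `|om i t - om i' t| ->
  nc (\sum_Z \sum_(k < K) term Z k) <=
    (H ^ (M * #|T|))%:R * (K%:R * A * (K%:R * sg) ^- M).
Proof.
move=> A0 K0 hA om1 om2 KH s0 hs.
have Kr : (0 : R) < K%:R by rewrite ltr0n.
have Om0 : 0 < Om.
  have := om1 t; have := om2 t; have := ler_normB (om i t) (om i' t); lra.
have Hr : (0 : R) < H%:R by nra.
have HH : (0 < H)%N by rewrite -(ltr0n R).
rewrite exchange_big; apply: (le_trans (nc_sum _ _ _)).
have -> : (H ^ (M * #|T|))%:R * (K%:R * A * (K%:R * sg) ^- M) =
    \sum_(k < K) A * ((H ^ (M * #|T|))%:R * (K%:R * sg) ^- M).
  rewrite sumr_const card_ord -[RHS]mulr_natl; ring.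
apply: ler_sum => k _; rewrite /term -mulr_sumr ncM.
apply: ler_pM; rewrite ?nc_ge0 ?hA//.
under eq_bigr do rewrite mulrBr.
rewrite sum_e_shifted ncM nc_e mul1r nc_prod.
set g := fun p : 'I_M * T => if p.2 == t then (K%:R * sg)^-1 else 1.
have g0 p : 0 <= g p.
  by rewrite /g; case: ifP => // _; rewrite invr_ge0 mulr_ge0 // ltW.
have -> : (H ^ (M * #|T|))%:R * (K%:R * sg) ^- M = \prod_p (H%:R * g p).
  rewrite big_split /= prodr_const card_prod card_ord natrX; congr (_ * _).
  rewrite (eq_bigr (fun p => (fun (a : 'I_M) (t' : T) => g (a, t')) p.1 p.2));
    last by case.
  rewrite -(pair_bigA _ (fun (a : 'I_M) (t' : T) => g (a, t'))) /=.
  rewrite (eq_bigr (fun _ => (K%:R * sg)^-1)) ?prodr_const ?card_ord ?exprVn//.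
  move=> a _; rewrite (bigD1 t)//= big1 ?mulr1 /g ?eqxx//.
  by move=> t' /negPf /= ->.
apply: ler_prod => p _; rewrite nc_ge0 /=.
rewrite /g; case: ifP => [/eqP pt|_]; last first.
  rewrite mulr1; apply: (le_trans (nc_sum _ _ _)).
  by rewrite (eq_bigr (fun _ => 1)) ?sumr_const ?card_ord// => z _; exact: nc_e.
rewrite pt -mulrBr.
set phi := ((K + k)%:R * _ / _).
have ephi : `|phi| = (K + k)%:R * `|om i t - om i' t| / H%:R.
  by rewrite /phi normrM normfV normrM !normr_nat.
have kK : (K%:R : R) <= (K + k)%:R by rewrite ler_nat leq_addr.
have kK2 : ((K + k)%:R : R) <= 2 * K%:R.
  by rewrite -natrM ler_nat mul2n -addnn leq_add2l ltnW.
have lo : K%:R * sg / H%:R <= `|phi|.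
  rewrite ephi ler_pM2r ?invr_gt0//; apply: ler_pM => //; exact: ltW.
have lo0 : 0 < K%:R * sg / H%:R by rewrite divr_gt0// mulr_gt0.
apply: (@le_trans _ _ `|phi|^-1).
  apply: nc_geom; first by rewrite -normr_gt0; exact: lt_le_trans lo0 lo.
  rewrite ephi ler_pdivrMr//.
  apply: (@le_trans _ _ (2 * K%:R * (2 * Om))); last by lra.
  apply: ler_pM => //.
  apply: (le_trans (ler_normB _ _)); have := om1 t; have := om2 t; lra.
by rewrite -[leRHS]invf_div lef_pV2 ?posrE// (lt_le_trans lo0 lo).
Qed.

(** For every shift the difference of phases is u i' - u i up to an error of a quarter of its size,
    because close slopes make the linear part negligible. It is thus a single small nonzero
    frequency in k, and Abel summation over k applies for each shift separately. *)
Lemma nc_pair_near (A V sg By : R) : 0 <= A -> 0 <= V ->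
  (forall k, (k < K)%N -> nc (cf i k * (cf i' k)^*) <= A) ->
  (forall k, (k.+1 < K)%N ->
     nc (cf i k.+1 * (cf i' k.+1)^* - cf i k * (cf i' k)^*) <= V) ->
  (forall Z t, `|shifted y0 (Z : {ffun 'I_M * T -> 'I_H}) t| <= By) ->
  0 < sg -> (forall t, `|om i t - om i' t| <= sg) ->
  4 * #|T|%:R * By * sg <= `|u i - u i'| -> 0 < `|u i - u i'| ->
  `|u i| <= 32^-1 -> `|u i'| <= 32^-1 ->
  nc (\sum_Z \sum_(k < K) term Z k) <=
    (H ^ (M * #|T|))%:R * ((A + K%:R * V) * (2 / `|u i - u i'|)).
Proof.
move=> A0 V0 hA hV hB s0 hs hu u0 ui ui'.
apply: (le_trans (nc_sum _ _ _)).
set X := (A + _) * _.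
have -> : (H ^ (M * #|T|))%:R * X = \sum_(Z : {ffun 'I_M * T -> 'I_H}) X.
  by rewrite sumr_const card_ffun card_prod !card_ord mulr_natl.
apply: ler_sum => Z _.
set b := phase om u i (shifted y0 Z) - phase om u i' (shifted y0 Z).
have bE : b = \sum_t (om i t - om i' t) * shifted y0 Z t - (u i - u i').
  rewrite /b /phase; have -> : \sum_t (om i t - om i' t) * shifted y0 Z t =
    \sum_t om i t * shifted y0 Z t - \sum_t om i' t * shifted y0 Z t.
    by rewrite -sumrB; apply: eq_bigr => t _; rewrite mulrBl.
  ring.
have hS : `|\sum_t (om i t - om i' t) * shifted y0 Z t| <= `|u i - u i'| / 4.
  apply: (le_trans (ler_norm_sum _ _ _)).
  apply: (@le_trans _ _ (\sum_(t : T) sg * By)); last first.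
    by rewrite sumr_const -[leLHS]mulr_natl; lra.
  by apply: ler_sum => t _; rewrite normrM; apply: ler_pM.
have ud : `|u i - u i'| <= 16^-1 by apply: (le_trans (ler_normB _ _)); lra.
have b1 : `|b| <= 8^-1.
  by rewrite bE; apply: (le_trans (ler_normB _ _)); lra.
have b2 : `|u i - u i'| / 2 <= `|b|.
  rewrite bE [leRHS]distrC; apply: le_trans (lerB_dist _ _); lra.
have b0 : b != 0 by rewrite -normr_gt0; lra.
have -> : \sum_(k < K) term Z k =
   e (K%:R * b) * \sum_(k < K) (cf i k * (cf i' k)^*) * e (k%:R * b).
  rewrite mulr_sumr; apply: eq_bigr => k _.
  by rewrite /term -/b natrD mulrDl eD mulrCA.
rewrite ncM nc_e mul1r.
apply: (le_trans (@abel_bound _ (fun k => cf i k * (cf i' k)^*)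
   (fun k => e (k%:R * b)) K A V `|b|^-1 A0 V0 _ hA hV)).
  by move=> m _; exact: nc_geom.
rewrite /X ler_wpM2l ?addr_ge0 ?mulr_ge0// -[2 / _]invrK lef_pV2 ?posrE ?invr_gt0 ?divr_gt0//.
  by rewrite invfM invrK mulrC.
by rewrite normr_gt0.
Qed.

End PairBounds.

Lemma nc_mulB (R : realType) (a b c d : Cx R) :
  nc (a * b - c * d) <= nc (a - c) * nc b + nc c * nc (b - d).
Proof.
rewrite -!ncM; apply: le_trans (ncD_le _ _).
by rewrite le_eqVlt; apply/orP; left; apply/eqP; congr nc; ring.
Qed.

(** * Smearing a grid point over a box *)

Section Smoothing.
Variables (R : realType) (T : finType) (H K N : nat) (Om : R) (f : T -> R).
Hypothesis N0 : (0 < N)%N.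
Hypothesis K0 : (0 < K)%N.
Hypothesis HN : 32 * K%:R * #|T|%:R * Om * N%:R <= H%:R.
Hypothesis H0 : (0 < H)%N.
Hypothesis fO : forall t, `|f t| <= Om.

Let boxes := {ffun T -> 'I_N}.

Definition box_shift (a : boxes) : R := \sum_t f t * (a t)%:R / H%:R.

(* The factor by which smearing a grid point over a box of side [N] multiplies the
   exponential of frequency [K + k]. *)
Definition box_avg (k : nat) : Cx R :=
  cx ((N ^ #|T|)%:R^-1) * \sum_(a : boxes) e ((K + k)%:R * box_shift a).

Let Hr : (0 : R) < H%:R. Proof. by rewrite ltr0n. Qed.
Let Kr : (0 : R) < K%:R. Proof. by rewrite ltr0n. Qed.

Lemma box_shift_le a : `|box_shift a| <= (32 * K%:R)^-1.
Proof.
apply: (@le_trans _ _ (\sum_(t : T) Om * N%:R / H%:R)).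
  apply: (le_trans (ler_norm_sum _ _ _)); apply: ler_sum => t _.
  rewrite normrM normfV normr_nat ler_pM2r ?invr_gt0// normrM normr_nat.
  by apply: ler_pM => //; rewrite ler_nat ltnW.
rewrite sumr_const -[leLHS]mulr_natl mulrA ler_pdivrMr//.
rewrite ler_pdivlMl; last by rewrite mulr_gt0.
by move: HN; lra.
Qed.

Let card_boxes : #|{: boxes}| = (N ^ #|T|)%N.
Proof. by rewrite card_ffun card_ord. Qed.

Let Nr : (0 : R) < (N ^ #|T|)%:R.
Proof. by rewrite ltr0n expn_gt0 N0. Qed.

Lemma avg_boxes_le (F : boxes -> Cx R) (x : R) :
  (forall a, nc (F a) <= x) ->
  nc (cx ((N ^ #|T|)%:R^-1) * \sum_a F a) <= x.
Proof.
move=> Fx; rewrite ncM nc_cx ger0_norm; last by rewrite invr_ge0 ltW.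
rewrite ler_pdivrMl//; apply: (le_trans (nc_sum _ _ _)).
have -> : (N ^ #|T|)%:R * x = \sum_(a : boxes) x.
  by rewrite sumr_const card_boxes mulr_natl.
exact: ler_sum.
Qed.

Lemma avg_boxes_cst (z : Cx R) :
  cx ((N ^ #|T|)%:R^-1) * (\sum_(a : boxes) z) = z.
Proof.
have -> : z = cx 1 * z by rewrite cx1 mul1r.
rewrite -mulr_suml -cx_sum mulrA -cxM sumr_const card_boxes.
by rewrite mulVf ?gt_eqF.
Qed.

(** Box shifts are at most 1/(32K) and frequencies below 2K, so each averaged exponential is within
    8/16 of 1. The average can therefore be inverted. *)
Lemma box_avg_sub1 k : (k < K)%N -> nc (box_avg k - 1) <= 2^-1.
Proof.
move=> kK; rewrite -[1]avg_boxes_cst -mulrBr -sumrB; apply: avg_boxes_le => a.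
apply: (le_trans (e_sub1_le _)).
have := box_shift_le a; have := normr_ge0 (box_shift a).
rewrite normrM normr_nat.
have kK2 : ((K + k)%:R : R) <= 2 * K%:R.
  by rewrite -natrM ler_nat mul2n -addnn leq_add2l ltnW.
have -> : (32 * K%:R)^-1 = 32^-1 * K%:R^-1 :> R by rewrite invfM.
have := mulVf (lt0r_neq0 Kr).
set x := `| _ |; set y := K%:R^-1; set z := K%:R in kK2 *.
move=> yz x0 xy.
apply: (@le_trans _ _ (8 * ((2 * z) * (32^-1 * y)))).
  by rewrite ler_wpM2l//; apply: ler_pM.
by move: yz; lra.
Qed.

Lemma box_avg_ge k : (k < K)%N -> 2^-1 <= nc (box_avg k).
Proof.
move=> kK; have := box_avg_sub1 kK.
have := ncD_le (box_avg k) (1 - box_avg k); rewrite addrCA subrr addr0 nc1.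
have -> : nc (1 - box_avg k) = nc (box_avg k - 1) by rewrite -ncN opprB.
lra.
Qed.

Lemma box_avg_diff k : nc (box_avg k.+1 - box_avg k) <= (4 * K%:R)^-1.
Proof.
rewrite -mulrBr -sumrB; apply: avg_boxes_le => a.
have -> : e ((K + k.+1)%:R * box_shift a) - e ((K + k)%:R * box_shift a) =
    e ((K + k)%:R * box_shift a) * (e (box_shift a) - 1).
  by rewrite addnS -natr1 mulrDl mul1r eD; ring.
rewrite ncM nc_e mul1r; apply: (le_trans (e_sub1_le _)).
have := box_shift_le a; rewrite !invfM; lra.
Qed.

Definition box_avg_inv k : Cx R := (box_avg k)^-1.

Lemma box_avg_inv_le k : (k < K)%N -> nc (box_avg_inv k) <= 2.
Proof.
move=> kK; have := box_avg_ge kK => h.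
have h0 : 0 < nc (box_avg k) by lra.
by rewrite /box_avg_inv ncV -[2]invrK lef_pV2 ?posrE// invr_gt0.
Qed.

Lemma box_avg_neq0 k : (k < K)%N -> box_avg k != 0.
Proof.
move=> kK; apply/eqP => E; have := box_avg_ge kK; rewrite E nc0; lra.
Qed.

Lemma box_avg_inv_diff k : (k.+1 < K)%N -> nc (box_avg_inv k.+1 - box_avg_inv k) <= K%:R^-1.
Proof.
move=> kK; have kK' : (k < K)%N by exact: ltnW.
have -> : box_avg_inv k.+1 - box_avg_inv k = box_avg_inv k.+1 * box_avg_inv k * - (box_avg k.+1 - box_avg k).
  by rewrite /box_avg_inv; field; rewrite !box_avg_neq0.
rewrite !ncM ncN.
apply: (@le_trans _ _ (2 * 2 * (4 * K%:R)^-1)).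
  by apply: ler_pM; rewrite ?mulr_ge0 ?nc_ge0 ?box_avg_diff//; apply: ler_pM;
    rewrite ?nc_ge0 ?box_avg_inv_le.
by rewrite invfM; lra.
Qed.

(** A point mass may be replaced by the uniform measure on a box, exactly, once the coefficient of
    each frequency is multiplied by [box_avg_inv]. These factors are bounded and vary by at most 1/K
    from one frequency to the next, so Abel summation survives. *)
Lemma box_avg_invE k (x : R) : (k < K)%N ->
  e x = cx ((N ^ #|T|)%:R^-1) *
    \sum_(a : boxes) box_avg_inv k * e (x + (K + k)%:R * box_shift a).
Proof.
move=> kK.
have -> : \sum_(a : boxes) box_avg_inv k * e (x + (K + k)%:R * box_shift a) =
   box_avg_inv k * e x * \sum_(a : boxes) e ((K + k)%:R * box_shift a).
  by rewrite mulr_sumr; apply: eq_bigr => a _; rewrite eD mulrA.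
by rewrite mulrCA -/(box_avg k) mulrAC /box_avg_inv mulVf ?mul1r// box_avg_neq0.
Qed.

End Smoothing.

(** * The estimate for one block of frequencies *)

Section BlockBound.
Variables (R : realType) (T I J : finType) (c : T).
Variables (w : I -> R) (v : J -> R) (om : I -> T -> R) (u : I -> R).
Variables (ze : J -> T -> nat) (H K N M : nat) (Om V th sg : R) (be : nat -> R).
Hypothesis w0 : forall i, 0 <= w i.
Hypothesis v0 : forall j, 0 <= v j.
Hypothesis v1 : \sum_j v j <= 1.
Hypothesis omc : forall i, om i c = 1.
Hypothesis omO : forall i t, `|om i t| <= Om.
Hypothesis u32 : forall i, `|u i| <= 32^-1.
Hypothesis N0 : (0 < N)%N.
Hypothesis K0 : (0 < K)%N.
Hypothesis M0 : (0 < M)%N.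
Hypothesis HN : 32 * K%:R * #|T|%:R * Om * N%:R <= H%:R.
Hypothesis zeH : forall j t, (M * H <= ze j t)%N && (ze j t + N <= M.+2 * H)%N.
Hypothesis V0 : 0 <= V.
Hypothesis zeV : forall z : T -> nat,
  \sum_(j | [forall t, (ze j t <= z t < ze j t + N)%N]) v j <= V.
Hypothesis th0 : 0 <= th.
Hypothesis be1 : forall k, (k < K)%N -> `|be k| <= th.
Hypothesis be2 : forall k, (k.+1 < K)%N -> `|be k.+1 - be k| <= th / K%:R.
Hypothesis sg0 : 0 < sg.

(** A base position below (M+2)H plus [M] shifts below [H] covers every position in [MH, (M+2)H)
    equally often. Recentring at M+1 turns this range into [-1, 1), where the points [ze j] and
    their boxes live. *)
Definition gridpt (z : T -> nat) : T -> R :=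
  fun t => (z t)%:R / H%:R - M.+1%:R.

(* The trivial bound, improved by the [M]-fold geometric sum when the slopes [om i],
   [om i'] are far apart, and by Abel summation over the frequencies when the slopes
   are close but the intercepts [u i], [u i'] are not. *)
Definition pair_bound (i i' : I) : R :=
  if [exists t, sg < `|om i t - om i' t|] then
    4 * th ^+ 2 * K%:R * (K%:R * sg) ^- M
  else if 4 * #|T|%:R * M.+1%:R * sg <= `|u i - u i'| then
    32 * th ^+ 2 / `|u i - u i'|
  else 4 * th ^+ 2 * K%:R.

Let P := (M.+2 * H)%N.
Let boxes := {ffun T -> 'I_N}.
Let D1 : (1 : R) <= #|T|%:R.
Proof. by rewrite ler1n; apply/card_gt0P; exists c. Qed.
Let Kr : (0 : R) < K%:R. Proof. by rewrite ltr0n. Qed.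
Let Nr : (1 : R) <= N%:R. Proof. by rewrite ler1n. Qed.

Let Om1 (i : I) : 1 <= Om.
Proof. by have := omO i c; rewrite omc normr1. Qed.

Let HKO (i : I) : 32 * K%:R * Om <= H%:R.
Proof.
apply: le_trans HN; have := Om1 i => O1.
rewrite -[leLHS]mulr1 -[32 * _ * _ * _ * _]mulrA -!mulrA ler_pM2l// ler_pM2l//.
have -> : #|T|%:R * (Om * N%:R) = Om * (#|T|%:R * N%:R) by ring.
rewrite ler_pM2l; last by lra.
by rewrite -[leLHS]mulr1; apply: ler_pM.
Qed.

Let H0 (i : I) : (0 < H)%N.
Proof.
rewrite -(ltr0n R); apply: lt_le_trans (HKO i); rewrite !mulr_gt0//.
exact: lt_le_trans (Om1 i).
Qed.

Let cf i k : Cx R := cx (w i * be k) * box_avg_inv H K N (om i) k.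
Let G := expsum om u K cf.

Let cfE i i' k : cf i k * (cf i' k)^* =
  cx (w i * w i' * (be k ^+ 2)) *
    (box_avg_inv H K N (om i) k * (box_avg_inv H K N (om i') k)^*).
Proof.
rewrite /cf rmorphM /= conj_cx mulrACA -cxM; congr (cx _ * _); ring.
Qed.

Let gl i k : (k < K)%N -> nc (box_avg_inv H K N (om i) k) <= 2.
Proof. by move=> kK; apply: (box_avg_inv_le N0 K0 HN (H0 i)) => //; exact: omO. Qed.

Let gd i k : (k.+1 < K)%N ->
  nc (box_avg_inv H K N (om i) k.+1 - box_avg_inv H K N (om i) k) <= K%:R^-1.
Proof. by move=> kK; apply: (box_avg_inv_diff N0 K0 HN (H0 i)) => //; exact: omO. Qed.

Let cf_le i i' k : (k < K)%N ->
  nc (cf i k * (cf i' k)^*) <= w i * w i' * (4 * th ^+ 2).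
Proof.
move=> kK; rewrite cfE ncM nc_cx ncM nc_conj.
rewrite ger0_norm; last exact: mulr_ge0 (mulr_ge0 _ _) (sqr_ge0 _).
have -> : w i * w i' * (4 * th ^+ 2) = (w i * w i' * th ^+ 2) * (2 * 2) by ring.
have ww : 0 <= w i * w i' by exact: mulr_ge0.
apply: ler_pM; [exact: mulr_ge0 (sqr_ge0 _)|by rewrite mulr_ge0 ?nc_ge0| |].
  rewrite ler_wpM2l// -[leLHS]real_normK ?num_real// ler_sqr ?nnegrE//.
  exact: be1.
by apply: ler_pM; rewrite ?nc_ge0 ?gl.
Qed.

Let cf_diff i i' k : (k.+1 < K)%N ->
  nc (cf i k.+1 * (cf i' k.+1)^* - cf i k * (cf i' k)^*)
  <= w i * w i' * (12 * th ^+ 2 / K%:R).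
Proof.
move=> kK; have kK' : (k < K)%N by exact: ltnW.
rewrite !cfE; apply: (le_trans (nc_mulB _ _ _ _)).
have b1 := be1 kK; have b2 := be1 kK'; have b3 := be2 kK.
have -> : w i * w i' * (12 * th ^+ 2 / K%:R) =
   (w i * w i' * (th / K%:R * (2 * th))) * (2 * 2) +
   (w i * w i' * th ^+ 2) * (K%:R^-1 * 2 + 2 * K%:R^-1) by ring.
have ww : 0 <= w i * w i' by rewrite mulr_ge0.
apply: lerD.
  apply: ler_pM; rewrite ?nc_ge0//.
    rewrite -cxB nc_cx -mulrBr normrM (ger0_norm ww) ler_wpM2l//.
    rewrite subr_sqr normrM; apply: ler_pM => //.
    apply: (le_trans (ler_normD _ _)); lra.
  by rewrite ncM nc_conj; apply: ler_pM; rewrite ?nc_ge0 ?gl.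
apply: ler_pM; rewrite ?nc_ge0//.
  rewrite nc_cx ger0_norm; last exact: mulr_ge0 (sqr_ge0 _).
  rewrite ler_wpM2l//.
  by rewrite -[leLHS]real_normK ?num_real// ler_sqr ?nnegrE.
apply: (le_trans (nc_mulB _ _ _ _)); rewrite -rmorphB /= !nc_conj.
by apply: lerD; apply: ler_pM; rewrite ?nc_ge0 ?gl ?gd.
Qed.

Let shifted_le (i : I) (Z0 : {ffun T -> 'I_P}) (Z : {ffun 'I_M * T -> 'I_H}) t :
  `|shifted (gridpt (fun t => Z0 t : nat)) Z t| <= M.+1%:R.
Proof.
have Hr : (0 : R) < H%:R by rewrite ltr0n (H0 i).
rewrite /shifted /gridpt -mulr_suml -natr_sum addrAC -mulrDl -natrD.
set n := (_ + _)%N.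
(* Base position at most (M+2)H, shifts at most MH in total: after recentring the range is
   symmetric. *)
have hn : (n <= (2 * M.+1) * H)%N.
  have h1 : (\sum_(a < M) Z (a, t) <= M * H)%N.
    apply: (@leq_trans (\sum_(a < M) H)); last by rewrite sum_nat_const card_ord.
    by apply: leq_sum => a _; exact: ltnW.
  have h2 : (Z0 t <= M.+2 * H)%N by exact: ltnW.
  rewrite /n; have -> : (2 * M.+1 * H = M.+2 * H + M * H)%N by clear; lia.
  exact: leq_add.
have hn' : n%:R / H%:R <= 2 * M.+1%:R :> R.
  by rewrite ler_pdivrMr// -!natrM ler_nat.
have : 0 <= n%:R / H%:R :> R by rewrite divr_ge0// ltW.
by rewrite ler_norml; move=> ?; apply/andP; split; lra.
Qed.

Let pair_le i i' (Z0 : {ffun T -> 'I_P}) :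
  nc (\sum_(Z : {ffun 'I_M * T -> 'I_H}) \sum_(k < K) cf i k * (cf i' k)^* *
     e ((K + k)%:R * (phase om u i (shifted (gridpt (fun t => Z0 t : nat)) Z)
       - phase om u i' (shifted (gridpt (fun t => Z0 t : nat)) Z))))
  <= (H ^ (M * #|T|))%:R * (w i * w i' * pair_bound i i').
Proof.
have A0 : 0 <= w i * w i' * (4 * th ^+ 2).
  by apply: mulr_ge0; [exact: mulr_ge0|exact: mulr_ge0 (sqr_ge0 _)].
have V00 : 0 <= w i * w i' * (12 * th ^+ 2 / K%:R).
  apply: mulr_ge0; first exact: mulr_ge0.
  by apply: mulr_ge0; [exact: mulr_ge0 (sqr_ge0 _)|rewrite invr_ge0 ltW].
rewrite /pair_bound; case: ifPn => [/existsP[t ht]|/existsPn far].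
  apply: (le_trans (nc_pair_far _ _ _ A0 K0 (cf_le i i') (omO i) (omO i') (HKO i) sg0 (ltW ht))).
  by rewrite le_eqVlt; apply/orP; left; apply/eqP; ring.
case: ifPn => hu.
  have near t : `|om i t - om i' t| <= sg by rewrite leNgt.
  have up : 0 < `|u i - u i'|.
    by apply: lt_le_trans hu; rewrite !mulr_gt0// (lt_le_trans _ D1).
  apply: (le_trans (nc_pair_near A0 V00 (cf_le i i') (cf_diff i i')
    (shifted_le i Z0) sg0 near hu up (u32 i) (u32 i'))).
  by rewrite le_eqVlt; apply/orP; left; apply/eqP; field; rewrite !lt0r_neq0.
apply: (le_trans (nc_pair_trivial _ _ _ _ _ A0 (cf_le i i'))).
by rewrite le_eqVlt; apply/orP; left; apply/eqP; ring.
Qed.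

Let F (z : T -> nat) : R := nc (G (gridpt z)) ^+ 2.

Let F0 z : 0 <= F z. Proof. exact: sqr_ge0. Qed.

(** For each choice [Z] of shifts, a position z >= MH is reached from the base z - [sh Z], which is
    again a valid base. So the sum over these positions, repeated for each [Z], is at most the sum
    over all bases and shifts, and for a fixed base the orthogonality of frequencies and the pair
    bounds apply. *)
Let smooth_sum (i : I) :
  (H ^ (M * #|T|))%:R * \sum_(z : {ffun T -> 'I_P} | [forall t, (M * H <= z t)%N]) F (fun t => z t : nat)
  <= (P ^ #|T|)%:R * ((H ^ (M * #|T|))%:R * \sum_i \sum_i' w i * w i' * pair_bound i i').
Proof.
have P0 : (0 < P)%N by rewrite muln_gt0 (H0 i).
pose sh (Z : {ffun 'I_M * T -> 'I_H}) t := (\sum_(a < M) Z (a, t))%N.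
have shH Z t : (sh Z t <= M * H)%N.
  apply: (@leq_trans (\sum_(a < M) H)); last by rewrite sum_nat_const card_ord.
  by apply: leq_sum => a _; exact: ltnW.
pose X := \sum_(Z0 : {ffun T -> 'I_P}) \sum_(Z : {ffun 'I_M * T -> 'I_H})
    F (fun t => (Z0 t + sh Z t)%N).
apply: (@le_trans _ _ X).
  have -> : (H ^ (M * #|T|))%:R * \sum_(z : {ffun T -> 'I_P} | [forall t, (M * H <= z t)%N]) F (fun t => z t : nat) =
    \sum_(Z : {ffun 'I_M * T -> 'I_H}) \sum_(z : {ffun T -> 'I_P} | [forall t, (M * H <= z t)%N]) F (fun t => z t : nat).
    by rewrite [RHS]sumr_const card_ffun card_prod !card_ord mulr_natl.
  rewrite /X [leRHS]exchange_big /=; apply: ler_sum => Z _.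
  have lt_sub (z : {ffun T -> 'I_P}) t : (z t - sh Z t < P)%N.
    by apply: leq_ltn_trans (leq_subr _ _) _.
  pose h (z : {ffun T -> 'I_P}) : {ffun T -> 'I_P} := [ffun t => Ordinal (lt_sub z t)].
  have := @sum_inj_le R _ _ [pred z : {ffun T -> 'I_P} | [forall t, (M * H <= z t)%N]] h
     (fun Z0 : {ffun T -> 'I_P} => F (fun t => (Z0 t + sh Z t)%N)).
  move=> /(_ (fun _ => F0 _)) hh.
  apply: le_trans (hh _).
    apply: ler_sum => z /forallP hz; rewrite le_eqVlt; apply/orP; left; apply/eqP.
    congr F; apply: funext => t; rewrite ffunE /= subnK//.
    exact: leq_trans (hz t).
  move=> z z' /forallP hz /forallP hz' /ffunP E; apply/ffunP => t.
  apply: val_inj; have := E t; rewrite !ffunE => /(congr1 val) /=.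
  by move: (hz t) (hz' t) (shH Z t); clear; lia.
have -> : (P ^ #|T|)%:R * ((H ^ (M * #|T|))%:R * \sum_i \sum_i' w i * w i' * pair_bound i i') =
  \sum_(Z0 : {ffun T -> 'I_P}) ((H ^ (M * #|T|))%:R * \sum_i \sum_i' w i * w i' * pair_bound i i').
  by rewrite [RHS]sumr_const card_ffun card_ord mulr_natl.
apply: ler_sum => Z0 _.
have -> : \sum_(Z : {ffun 'I_M * T -> 'I_H}) F (fun t => (Z0 t + sh Z t)%N) =
   \sum_(Z : {ffun 'I_M * T -> 'I_H}) nc (G (shifted (gridpt (fun t => Z0 t : nat)) Z)) ^+ 2.
  apply: eq_bigr => Z _; rewrite /F; congr (nc (G _) ^+ 2); apply: funext => t.
  by rewrite /gridpt /shifted -mulr_suml -natr_sum natrD; ring.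
apply: (le_trans (sum_sqr_expsum _ omc _ _ M0 _)).
  rewrite -(ler_nat R) natrM; have := HKO i; have := Om1 i; have := Kr; nra.
rewrite mulr_sumr; apply: ler_sum => i1 _; rewrite mulr_sumr; apply: ler_sum => i2 _.
exact: pair_le.
Qed.

Let target : Cx R := \sum_i \sum_j \sum_(k < K)
  cx (w i * v j * be k) * e ((K + k)%:R * phase om u i (gridpt (ze j))).

Let target_avg : target = \sum_j \sum_(a : boxes)
  cx (v j * (N ^ #|T|)%:R^-1) * G (gridpt (fun t => (ze j t + a t)%N)).
Proof.
have ph i j (a : boxes) : phase om u i (gridpt (fun t => (ze j t + a t)%N)) =
   phase om u i (gridpt (ze j)) + box_shift H (om i) a.
  rewrite /phase /box_shift /gridpt addrAC -big_split /=; congr (_ - _).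
  by apply: eq_bigr => t _; rewrite natrD; ring.
rewrite /target exchange_big; apply: eq_bigr => j _.
transitivity (\sum_i \sum_(k < K) \sum_(a : boxes) cx (v j * (N ^ #|T|)%:R^-1) *
  (cf i k * e ((K + k)%:R * phase om u i (gridpt (fun t => (ze j t + a t)%N))))).
  apply: eq_bigr => i _; apply: eq_bigr => k _.
  rewrite (box_avg_invE N0 K0 HN (H0 i) (omO i) _ (ltn_ord k)).
  rewrite mulrA -cxM mulr_sumr; apply: eq_bigr => a _.
  rewrite /cf !mulrA -!cxM; congr (cx _ * _ * e _); first ring.
  by rewrite ph -mulrDr.
under eq_bigr do rewrite exchange_big.
rewrite exchange_big; apply: eq_bigr => a _.
rewrite /G /expsum mulr_sumr; apply: eq_bigr => i _.
by rewrite mulr_sumr.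
Qed.

Lemma block_bound : nc (\sum_i \sum_j \sum_(k < K)
    cx (w i * v j * be k) * e ((K + k)%:R * phase om u i (gridpt (ze j)))) ^+ 2
  <= (N ^ #|T|)%:R^-1 * V * (P ^ #|T|)%:R *
     \sum_i \sum_i' w i * w i' * pair_bound i i'.
Proof.
(* Positivity of [H] is derived from 1 <= [Om], which needs an element of [I]; for empty [I] both
   sides vanish. *)
have [i _|/eq_card0 I0] := pickP I; last first.
  have /fintype0 hI : #|I| = 0%N by [].
  rewrite big1 ?nc0 ?expr0n /=; last by move=> i; have := hI i.
  by rewrite [X in _ * X]big1 ?mulr0// => i; have := hI i.
have Nr' : (0 : R) < (N ^ #|T|)%:R by rewrite ltr0n expn_gt0 N0.
have Hr' : (0 : R) < (H ^ (M * #|T|))%:R by rewrite ltr0n expn_gt0 (H0 i).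
rewrite -/target target_avg pair_bigA /=.
pose p (x : J * boxes) : R := v x.1 * (N ^ #|T|)%:R^-1.
pose pos (x : J * boxes) : T -> nat := fun t => (ze x.1 t + x.2 t)%N.
have p0 x : 0 <= p x by rewrite mulr_ge0// invr_ge0 ltW.
have p1 : \sum_x p x <= 1.
  rewrite -(pair_bigA _ (fun (j : J) (a : boxes) => p (j, a))) /=.
  under eq_bigr => j _.
    rewrite /p /= sumr_const card_ffun card_ord -[v j / _ *+ _]mulr_natr divfK ?gt_eqF//.
    over.
  exact: v1.
(* Jensen for the smeared measure [p], which has mass at most 1. *)
apply: (@le_trans _ _ (\sum_x p x * F (pos x))).
  apply: le_trans (jensen_sqr _ p0 p1).
  rewrite ler_sqr ?nnegrE ?nc_ge0//; last first.
    by apply: sumr_ge0 => x _; rewrite mulr_ge0 ?nc_ge0.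
  apply: (le_trans (nc_sum _ _ _)); apply: ler_sum => x _.
  by rewrite ncM nc_cx ger0_norm ?p0.
(* Domination: a grid position receives mass only from the [j] whose box contains it, at most [V] in
   total, divided by the number of points of a box. *)
apply: (@le_trans _ _ ((N ^ #|T|)%:R^-1 * V *
   \sum_(z : {ffun T -> 'I_P} | [forall t, (M * H <= z t)%N]) F (fun t => z t : nat))); last first.
  rewrite -[leRHS]mulrA ler_wpM2l ?mulr_ge0 ?invr_ge0 ?(ltW Nr')//.
  rewrite -(ler_pM2l Hr'); apply: (le_trans (smooth_sum i)).
  by rewrite mulrCA.
rewrite -(pair_bigA _ (fun (j : J) (a : boxes) => p (j, a) * F (pos (j, a)))) /=.
pose ind j (z : {ffun T -> 'I_P}) := [forall t, (ze j t <= z t < ze j t + N)%N].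
have step j : \sum_(a : boxes) F (pos (j, a)) <=
   \sum_(z : {ffun T -> 'I_P} | [forall t, (M * H <= z t)%N])
      (if ind j z then F (fun t => z t : nat) else 0).
  have hlt (a : boxes) t : (ze j t + a t < P)%N.
    have /andP[_ h] := zeH j t; apply: leq_trans h; rewrite ltn_add2l.
    exact: ltn_ord.
  pose h (a : boxes) : {ffun T -> 'I_P} := [ffun t => Ordinal (hlt a t)].
  have hinj : {in xpredT &, injective h}.
    move=> a b _ _ /ffunP E; apply/ffunP => t; apply: val_inj.
    by have := E t; rewrite !ffunE => /(congr1 val) /= /addnI.
  rewrite [leRHS]big_mkcond /=.
  apply: le_trans (sum_inj_le _ hinj); last first.
    by move=> z; case: ifP => // _; case: ifP.
  apply: ler_sum => a _.
  have -> : [forall t, (M * H <= h a t)%N].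
    apply/forallP => t; rewrite ffunE /=; have /andP[q _] := zeH j t.
    exact: leq_trans q (leq_addr _ _).
  have -> : ind j (h a).
    by apply/forallP => t; rewrite ffunE /= leq_addr ltn_add2l ltn_ord.
  rewrite le_eqVlt; apply/orP; left; apply/eqP; congr F.
  by apply: funext => t; rewrite ffunE.
apply: (@le_trans _ _ (\sum_j v j * (N ^ #|T|)%:R^-1 *
   \sum_(z : {ffun T -> 'I_P} | [forall t, (M * H <= z t)%N])
      (if ind j z then F (fun t => z t : nat) else 0))).
  apply: ler_sum => j _; rewrite /p /= -mulr_sumr ler_wpM2l//.
  by rewrite mulr_ge0// invr_ge0 ltW.
rewrite (eq_bigr _ (fun j _ => mulr_sumr _ _ _ _)) exchange_big mulr_sumr /=.
apply: ler_sum => z _.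
rewrite (eq_bigr (fun j => (N ^ #|T|)%:R^-1 * (if ind j z then v j else 0) * F (fun t => z t : nat))).
  rewrite -mulr_suml -mulr_sumr ler_wpM2r// ler_wpM2l ?invr_ge0 ?(ltW Nr')//.
  by rewrite -big_mkcond /=; exact: zeV.
by move=> j _; case: ifP => _; ring.
Qed.

End BlockBound.

(** * Summing the pair bounds against a measure with a ball condition *)

Section PairSum.
Variables (R : realType) (T I : finType) (c : T).
Variables (w : I -> R) (X : I -> T -> R).

(** Frostman's condition in the sup norm. The radii stop at [dl] because the atoms of a finite
    measure violate it at small scales. *)
Definition ball_cond (C S dl : R) := forall (X0 : T -> R) (rho : R), dl <= rho ->
  \sum_(i | [forall t, `|X i t - X0 t| <= rho]) w i <= C * rho `^ S.

Definition slope (i : I) (t : T) : R := X i t / X i c.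

Variables (B eta Lam R1 r C S dl sg th : R) (K M a : nat).
Hypothesis w0 : forall i, 0 <= w i.
Hypothesis w1 : \sum_i w i <= 1.
Hypothesis XB : forall i t, `|X i t| <= B.
Hypothesis Xc : forall i, eta <= `|X i c|.
Hypothesis eta0 : 0 < eta.
Hypothesis Lam0 : 0 < Lam.
Hypothesis B1 : 1 <= B.
Hypothesis R11 : 1 <= R1.
Hypothesis r0 : r != 0.
Hypothesis rR : `|r| <= R1.
Hypothesis C0 : 0 <= C.
Hypothesis Xball : ball_cond C S dl.
Hypothesis sg0 : 0 < sg.
Hypothesis sgK : 1 <= K%:R * sg.
Hypothesis sgdl : dl <= sg.
Hypothesis aB : 2 * B < 2 ^+ a * sg.

Definition intercept (i : I) : R := r / (Lam * X i c).

Definition gap (i i' : I) : nat := Num.truncn (`|X i c - X i' c| / sg).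

Let D1 : (1 : R) <= #|T|%:R.
Proof. by rewrite ler1n; apply/card_gt0P; exists c. Qed.

(** Sum of the constants of the two cases of a close pair: 32 (2 Lam B^2 + R1) when Abel summation
    applies, and the trivial bound's constant, with 4 enlarged to 32, otherwise. *)
Definition pair_cst : R := 64 * Lam * B ^+ 2 +
  32 * (4 * #|T|%:R * M.+1%:R * Lam * B ^+ 2 + R1).

Let rp : 0 < `|r|. Proof. by rewrite normr_gt0. Qed.

Let Xc0 i : X i c != 0.
Proof. by rewrite -normr_gt0; exact: lt_le_trans (Xc i). Qed.

Lemma gap_itv i i' :
  (gap i i')%:R * sg <= `|X i c - X i' c| < (gap i i').+1%:R * sg.
Proof.
rewrite -ler_pdivlMr// -ltr_pdivrMr//; apply: truncn_itv.
by rewrite divr_ge0// ltW.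
Qed.

(** The difference of the intercepts is -r (X_c - X'_c) / (Lam X_c X'_c). This is how radial
    separation reaches the phases, and the only source of the factor |r|. *)
Lemma intercept_dist i i' :
  `|r| * `|X i c - X i' c| <= Lam * B ^+ 2 * `|intercept i - intercept i'|.
Proof.
have -> : intercept i - intercept i' = - (r * (X i c - X i' c)) / (Lam * (X i c * X i' c)).
  by rewrite /intercept; field; rewrite !Xc0 (lt0r_neq0 Lam0).
rewrite normrM normrN normfV !normrM (gtr0_norm Lam0).
rewrite [leRHS]mulrA ler_pdivlMr; last by rewrite mulr_gt0 // mulr_gt0 // normr_gt0.
rewrite mulrC ler_wpM2r ?mulr_ge0// ler_pM2l// expr2.
exact: ler_pM.
Qed.

(** With m the gap, |r| m sg is at most Lam B^2 |u - u'|. If the intercepts are far apart, this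
    converts 1/|u - u'| into K/(|r|(m+1)); if they are close, it bounds |r|(m+1), and the trivial
    bound already has the required form. *)
Lemma pair_bound_near i i' : ~~ [exists t, sg < `|slope i t - slope i' t|] ->
  pair_bound slope intercept K M th sg i i' <=
  th ^+ 2 * pair_cst * K%:R / (`|r| * (gap i i').+1%:R).
Proof.
move=> far; rewrite /pair_bound (negPf far).
set m := gap i i'; set du := `|intercept i - intercept i'|.
have /andP[gm1 gm2] := gap_itv i i'; rewrite -/m in gm1 gm2.
have hd := intercept_dist i i'; rewrite -/du in hd.
have K0 : (0 : R) <= K%:R by [].
have mp : (0 : R) < m.+1%:R by [].
have t0 : 0 <= th ^+ 2 by exact: sqr_ge0.
have LB : 0 < Lam * B ^+ 2.
  by rewrite mulr_gt0// exprn_gt0//; exact: lt_le_trans B1.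
set Z := 4 * #|T|%:R * M.+1%:R * Lam * B ^+ 2.
have Z0 : 0 < Z.
  rewrite /Z -2!mulrA mulr_gt0//; last by rewrite mulr_gt0.
  by rewrite mulr_gt0 // (lt_le_trans _ D1).
have rm : 0 < `|r| * m.+1%:R by rewrite mulr_gt0.
rewrite ler_pdivlMr//.
have rm1 : `|r| * m.+1%:R = `|r| * m%:R + `|r| by rewrite -natr1; ring.
have ph : `|r| * m%:R * sg <= Lam * B ^+ 2 * du.
  by apply: le_trans hd; rewrite -mulrA ler_pM2l.
rewrite /pair_cst -/Z.
case: ifPn => hu.
- have du0 : 0 < du.
    apply: lt_le_trans hu; rewrite !mulr_gt0//; exact: lt_le_trans D1.
  rewrite mulrAC ler_pdivrMr//.
  have hsd : sg <= du.
    apply: le_trans hu; rewrite ler_peMl ?(ltW sg0)//.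
    have : (1 : R) <= M.+1%:R by rewrite ler1n.
    have := D1; nra.
  have : `|r| * m.+1%:R * 1 <= (2 * Lam * B ^+ 2 + R1) * (K%:R * du).
    have : `|r| * m%:R <= Lam * B ^+ 2 * (K%:R * du).
      have h1 : `|r| * m%:R <= (`|r| * m%:R) * (K%:R * sg).
        by rewrite ler_peMr// mulr_ge0.
      have h2 := ler_wpM2l K0 ph; lra.
    have : `|r| <= R1 * (K%:R * du).
      apply: (le_trans rR); rewrite ler_peMr ?(le_trans ler01 R11)//.
      by apply: (le_trans sgK); rewrite ler_wpM2l.
    have : 0 <= Lam * B ^+ 2 * (K%:R * du).
      exact: mulr_ge0 (ltW LB) (mulr_ge0 K0 (ltW du0)).
    rewrite rm1; lra.
  rewrite mulr1 => hh.
  apply: (@le_trans _ _ (32 * th ^+ 2 * ((2 * Lam * B ^+ 2 + R1) * (K%:R * du)))).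
    by rewrite ler_wpM2l// mulr_ge0.
  have : 0 <= th ^+ 2 * Z * (K%:R * du).
    exact: mulr_ge0 (mulr_ge0 t0 (ltW Z0)) (mulr_ge0 K0 (ltW du0)).
  lra.
- move: hu; rewrite -ltNge => hu.
  have h1 : `|r| * m%:R <= Z.
    have : `|r| * m%:R * sg < Z * sg.
      apply: (le_lt_trans ph).
      have -> : Z * sg = Lam * B ^+ 2 * (4 * #|T|%:R * M.+1%:R * sg) by rewrite /Z; ring.
      by rewrite ltr_pM2l.
    by rewrite ltr_pM2r// => /ltW.
  have : `|r| * m.+1%:R <= Z + R1 by rewrite rm1 lerD.
  move=> h2.
  apply: (@le_trans _ _ (4 * th ^+ 2 * K%:R * (Z + R1))).
    by rewrite ler_wpM2l//; exact: mulr_ge0 (mulr_ge0 (ler0n _ 4) t0) K0.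
  have : 0 <= th ^+ 2 * K%:R * (Lam * B ^+ 2).
    exact: mulr_ge0 (mulr_ge0 t0 K0) (ltW LB).
  have : 0 <= th ^+ 2 * K%:R * (Z + R1).
    by apply: mulr_ge0 (mulr_ge0 t0 K0) _; have := Z0; have := R11; lra.
  lra.
Qed.

Lemma slope_le i t : `|slope i t| <= B / eta.
Proof.
rewrite /slope normrM normfV; apply: ler_pM => //.
by rewrite lef_pV2// posrE normr_gt0.
Qed.

(** A point whose slope is close to that of X and whose coordinate [c] differs from X_c by about m
    sg is close to the multiple of X with coordinate [c] equal to X_c + m sg or X_c - m sg: two
    balls of radius O(sg). *)
Lemma near_gap_mass i m :
  \sum_(i' | ~~ [exists t, sg < `|slope i t - slope i' t|] && (gap i i' == m)) w i'
  <= 2 * C * ((B + B / eta) * sg) `^ S.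
Proof.
set rho := (B + B / eta) * sg.
have rd : dl <= rho.
  apply: (le_trans sgdl); rewrite /rho ler_peMl ?(ltW sg0)//.
  have : 0 <= B / eta by rewrite divr_ge0 ?(ltW eta0)// (le_trans ler01 B1).
  have := B1; lra.
pose X0 (s : R) (t : T) : R := (X i c + s * (m%:R * sg)) * slope i t.
apply: (@le_trans _ _ (\sum_(i' | [forall t, `|X i' t - X0 1 t| <= rho]) w i' +
   \sum_(i' | [forall t, `|X i' t - X0 (- 1) t| <= rho]) w i')); last first.
  by apply: (le_trans (lerD (Xball _ rd) (Xball _ rd))); lra.
rewrite big_mkcond [X in _ <= X + _]big_mkcond [X in _ <= _ + X]big_mkcond -big_split /=.
apply: ler_sum => i' _; case: ifPn => [/andP[/existsPn near /eqP gm]|_]; last first.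
  by apply: addr_ge0; case: ifP.
have /andP[g1 g2] := gap_itv i i'; rewrite gm in g1 g2.
have key s : `|X i' c - (X i c + s * (m%:R * sg))| <= sg ->
    [forall t, `|X i' t - X0 s t| <= rho].
  move=> hs; apply/forallP => t.
  have -> : X i' t - X0 s t = X i' c * (slope i' t - slope i t) +
      (X i' c - (X i c + s * (m%:R * sg))) * slope i t.
    rewrite /X0 {1}(_ : X i' t = X i' c * slope i' t); first by ring.
    by rewrite /slope mulrC divfK.
  apply: (le_trans (ler_normD _ _)); rewrite normrM [X in _ + X]normrM /rho mulrDl.
  apply: lerD.
    by apply: ler_pM => //; rewrite distrC leNgt.
  by rewrite mulrC; apply: ler_pM => //; exact: slope_le.
have [d0|d0] := leP 0 (X i' c - X i c).
  rewrite (key 1) ?lerDl; first by case: ifP.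
  rewrite distrC ger0_norm// in g1 g2.
  by rewrite mul1r ler_norml; apply/andP; split; move: g2; rewrite -natr1 => g2; lra.
rewrite (key (-1)) ?lerDr; first by case: ifP.
rewrite ger0_norm in g1 g2; last by lra.
by rewrite ler_norml; apply/andP; split; move: g2; rewrite -natr1 => g2; lra.
Qed.

(** Each dyadic block of the harmonic sum is at most 1. *)
Lemma harmonic_le : \sum_(m < 2 ^ a) (m.+1%:R)^-1 <= a.+1%:R :> R.
Proof.
elim: a => [|n IH]; first by rewrite expn0 big_ord1 invr1.
rewrite expnS mul2n -addnn big_split_ord /= -natr1; apply: lerD => //.
apply: (@le_trans _ _ (\sum_(m < 2 ^ n) (2 ^ n)%:R^-1)).
  apply: ler_sum => m _; rewrite lef_pV2 ?posrE ?ltr0n ?expn_gt0//.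
  by rewrite ler_nat leqW// leq_addr.
rewrite sumr_const card_ord -[leLHS]mulr_natl divff//.
Qed.

Lemma pair_sum :
  \sum_i \sum_i' w i * w i' * pair_bound slope intercept K M th sg i i' <=
  th ^+ 2 * K%:R * (4 * (K%:R * sg) ^- M +
   2 * C * pair_cst * ((B + B / eta) * sg) `^ S * a.+1%:R / `|r|).
Proof.
set RHS := (X in _ <= X).
have t0 : 0 <= th ^+ 2 by exact: sqr_ge0.
have Z0 : 0 <= pair_cst.
  have LB : 0 <= Lam * B ^+ 2 by rewrite mulr_ge0 ?sqr_ge0// ltW.
  have hM : 0 <= #|T|%:R * M.+1%:R * (Lam * B ^+ 2) by rewrite mulr_ge0.
  by rewrite /pair_cst; have := R11; move: hM LB; lra.
have kM : 0 <= (K%:R * sg) ^- M by rewrite invr_ge0 exprn_ge0// mulr_ge0// ltW.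
have tK : 0 <= th ^+ 2 * K%:R by exact: mulr_ge0.
have Y0 : 0 <= 4 * th ^+ 2 * K%:R * (K%:R * sg) ^- M.
  by apply: mulr_ge0 kM; move: tK; lra.
have CP : 0 <= 2 * C * ((B + B / eta) * sg) `^ S.
  exact: mulr_ge0 (mulr_ge0 (ler0n _ 2) C0) (powR_ge0 _ _).
have RHS0 : 0 <= RHS.
  apply: mulr_ge0 tK _; apply: addr_ge0; first by rewrite mulr_ge0.
  rewrite divr_ge0//; apply: mulr_ge0 => //.
  exact: mulr_ge0 (mulr_ge0 (mulr_ge0 (ler0n _ 2) C0) Z0) (powR_ge0 _ _).
(* The ball condition is used only in the second variable, uniformly in [i]; the outer sum costs the
   mass, at most 1. *)
suff main i : \sum_i' w i' * pair_bound slope intercept K M th sg i i' <= RHS.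
  apply: (@le_trans _ _ (\sum_i w i * RHS)).
    apply: ler_sum => i _; under eq_bigr do rewrite -mulrA.
    by rewrite -mulr_sumr ler_wpM2l.
  by rewrite -mulr_suml ler_piMl.
have gap_lt i' : (gap i i' < 2 ^ a)%N.
  rewrite -(ltr_nat R) natrX -(ltr_pM2r sg0); apply: le_lt_trans aB.
  have /andP[+ _] := gap_itv i i' => /le_trans; apply.
  apply: (le_trans (ler_normB _ _)).
  by have := XB i c; have := XB i' c; lra.
pose far i' := [exists t, sg < `|slope i t - slope i' t|].
rewrite (bigID far) /= /RHS mulrDr; apply: lerD.
  apply: (@le_trans _ _ (\sum_i' w i' * (4 * th ^+ 2 * K%:R * (K%:R * sg) ^- M))).
    rewrite big_mkcond /=; apply: ler_sum => i' _.
    case: ifPn => [f|_]; last by rewrite mulr_ge0.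
    by rewrite ler_wpM2l// /pair_bound -/(far i') f.
  rewrite -mulr_suml; apply: (@le_trans _ _ (4 * th ^+ 2 * K%:R * (K%:R * sg) ^- M)).
    by rewrite ler_piMl.
  by rewrite le_eqVlt; apply/orP; left; apply/eqP; ring.
set Q := th ^+ 2 * pair_cst * K%:R.
have Q0 : 0 <= Q by exact: mulr_ge0 (mulr_ge0 t0 Z0) (ler0n _ _).
apply: (@le_trans _ _ (\sum_(i' | ~~ far i') w i' * (Q / (`|r| * (gap i i').+1%:R)))).
  apply: ler_sum => i' nf; rewrite ler_wpM2l//; exact: pair_bound_near.
rewrite (partition_big (fun i' => Ordinal (gap_lt i')) xpredT) //=.
apply: (@le_trans _ _ (\sum_(m < 2 ^ a)
    2 * C * ((B + B / eta) * sg) `^ S * (Q / (`|r| * m.+1%:R)))).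
  apply: ler_sum => m _.
  rewrite (eq_bigr (fun i' => w i' * (Q / (`|r| * m.+1%:R)))); last first.
    by move=> i' /andP[_ /eqP <-].
  rewrite -mulr_suml ler_wpM2r ?(divr_ge0 Q0)//.
  apply: le_trans (near_gap_mass i m).
  rewrite le_eqVlt; apply/orP; left; apply/eqP; apply: eq_bigl => i'.
  by congr (_ && _).
rewrite -mulr_sumr.
under eq_bigr do rewrite invfM [Q * _]mulrA.
rewrite -mulr_sumr.
apply: (@le_trans _ _ (2 * C * ((B + B / eta) * sg) `^ S * (Q / `|r| * a.+1%:R))).
  rewrite ler_wpM2l// ler_wpM2l ?divr_ge0//.
  exact: harmonic_le.
by rewrite /Q le_eqVlt; apply/orP; left; apply/eqP; ring.
Qed.

End PairSum.

(** * Real powers of two *)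

Section PowersOfTwo.
Variable R : realType.
Implicit Types a b : R.

Definition pw2 a : R := 2 `^ a.

Lemma pw2_gt0 a : 0 < pw2 a. Proof. exact: powR_gt0. Qed.

Lemma pw2_ge0 a : 0 <= pw2 a. Proof. exact: powR_ge0. Qed.

Lemma pw2D a b : pw2 (a + b) = pw2 a * pw2 b.
Proof. by rewrite /pw2 powRD// pnatr_eq0 implybT. Qed.

Lemma pw2N a : pw2 (- a) = (pw2 a)^-1. Proof. exact: powRN. Qed.

Lemma pw2_nat n : pw2 n%:R = 2 ^+ n.
Proof. by rewrite /pw2 powR_mulrn. Qed.

Lemma pw2M a b : pw2 (a * b) = pw2 a `^ b. Proof. exact: powRrM. Qed.

Lemma pw2Mn a n : pw2 (a * n%:R) = pw2 a ^+ n.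
Proof. by rewrite pw2M powR_mulrn// pw2_ge0. Qed.

Lemma pw2_le a b : a <= b -> pw2 a <= pw2 b.
Proof. by apply: ler_powR; rewrite ler1n. Qed.

Lemma pw2_0 : pw2 0 = 1. Proof. by rewrite /pw2 powRr0. Qed.

Lemma pw2_gt1 a : 0 < a -> 1 < pw2 a.
Proof.
move=> a0; rewrite -pw2_0 /pw2 /powR pnatr_eq0 ltr_expR mul0r mulr_gt0// ln_gt0//.
by rewrite ltr1n.
Qed.

(** Bernoulli's inequality. It absorbs the logarithm of the harmonic sum into an arbitrarily small
    power of the frequency. *)
Lemma linear_le_pw2 a : 0 < a ->
  exists2 E : R, 0 <= E & forall q : nat, q.+1%:R <= E * pw2 (a * q%:R).
Proof.
move=> a0; have y1 := pw2_gt1 a0; set y := pw2 a in y1.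
exists (1 + (y - 1)^-1) => [|q].
  by rewrite addr_ge0// invr_ge0; lra.
rewrite pw2Mn -/y.
have b : 1 + q%:R * (y - 1) <= y ^+ q.
  elim: q => [|q IH]; first by rewrite mul0r addr0 expr0.
  have : 0 <= (q%:R : R) by [].
  rewrite exprS -natr1 => q0.
  have : y * (1 + q%:R * (y - 1)) <= y * y ^+ q by rewrite ler_wpM2l//; lra.
  have : 0 <= q%:R * ((y - 1) * (y - 1)) by rewrite mulr_ge0// mulr_ge0//; lra.
  nra.
have y0 : 0 < y - 1 by lra.
have h1 : q%:R <= (y - 1)^-1 * y ^+ q.
  by rewrite ler_pdivlMl// mulrC; lra.
have h2 : 1 <= y ^+ q by rewrite exprn_ege1//; lra.
by rewrite -natr1 mulrDl mul1r; lra.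
Qed.

End PowersOfTwo.

Lemma shift_ge0 (z : int) (H M : nat) : (2 * absz z <= H)%N ->
  0 <= z + (M.+1 * H)%:Z.
Proof. by rewrite mulSn; lia. Qed.

Lemma shift_box (z : int) (H N M : nat) : (2 * absz z <= H)%N -> (2 * N <= H)%N ->
  (M * H <= absz (z + (M.+1 * H)%:Z)%R)%N && (absz (z + (M.+1 * H)%:Z)%R + N <= M.+2 * H)%N.
Proof.
rewrite !mulSn; move: (M * H)%N => p zH NH.
by apply/andP; split; lia.
Qed.

Lemma succ_add_le q b : ((q + b).+1 <= b.+1 * q.+1)%N.
Proof. by rewrite mulSn mulnS; lia. Qed.

(** * Fejér sums in a chart *)

Section Chart.
Variables (R : realType) (T : finType).
Variables (B C S eta R1 : R) (lam : nat).
Hypothesis B1 : 1 <= B.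
Hypothesis C0 : 0 <= C.
Hypothesis eta0 : 0 < eta.
Hypothesis R11 : 1 <= R1.
Hypothesis DS : #|T|%:R + 1 < 2 * S.
Hypothesis lamR : 32 * R1 <= 2 ^+ lam * eta.

(** This is (X.Y - r) / (2^lam X_c) with Y = g / 2^n. The extra factor 2^lam brings the coordinates
    of Y into [-1/2, 1/2] and the intercepts below 1/32. *)
Definition chart_phase (n : nat) (c : T) (I J : finType) (X : I -> T -> R)
  (g : J -> T -> int) (r : R) (i : I) (j : J) : R :=
  phase (slope c X) (intercept c X (2 ^+ lam) r) i
    (fun t => (g j t)%:~R / 2 ^+ (n + lam)).

(** Here all parameters of the block estimate are chosen as powers of K = 2^q. The gain per block is
    rh^q with rh = 2^-eps, and [c0] records how far K must stay below 2^n for the boxes to contain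
    grid points. *)
Lemma chart_block : exists (C4 rh : R) (c0 : nat),
  [/\ 0 <= C4, 2 / 3 <= rh, rh < 1 &
  forall (n q : nat) (c : T) (I J : finType) (w : I -> R) (v : J -> R)
    (X : I -> T -> R) (g : J -> T -> int) (r th : R) (be : nat -> R),
  (q + c0 <= n)%N ->
  (forall i, 0 <= w i) -> \sum_i w i <= 1 ->
  (forall j, 0 <= v j) -> \sum_j v j <= 1 ->
  (forall i t, `|X i t| <= B) -> (forall i, eta <= `|X i c|) ->
  ball_cond w X C S (2 ^- n) ->
  ball_cond v (fun j t => (g j t)%:~R / 2 ^+ n) C S (2 ^- n) ->
  (forall j t, (2 * absz (g j t) <= 2 ^ (n + lam))%N) ->
  r != 0 -> `|r| <= R1 -> 0 <= th ->
  (forall k, (k < 2 ^ q)%N -> `|be k| <= th) ->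
  (forall k, (k.+1 < 2 ^ q)%N -> `|be k.+1 - be k| <= th / 2 ^+ q) ->
  nc (\sum_i \sum_j \sum_(k < 2 ^ q) cx (w i * v j * be k) *
     e ((2 ^ q + k)%:R * chart_phase n c X g r i j)) ^+ 2 <=
  th ^+ 2 * C4 * (rh ^+ q) ^+ 2 / `|r| ].
Proof.
pose D : R := #|T|%:R.
have D0 : 0 <= D by [].
pose Dl := 2 * S - D - 1.
have Dl0 : 0 < Dl by rewrite /Dl; move: DS; rewrite -/D; lra.
have S0 : 0 < S by move: DS; rewrite -/D; lra.
(* [Dl] is the slack in 2S > D + 1. Half of it is spent on h1 S and on the logarithm, a quarter
   each; the other half pays for 2 eps. The cap 1/2 gives rh >= 2^(-1/2) > 2/3. *)
pose eps := Num.min (Dl / 4) 2^-1.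
have eps0 : 0 < eps by rewrite /eps lt_min; apply/andP; split; lra.
have eps1 : eps <= Dl / 4 by rewrite /eps ge_min lexx.
have eps2 : eps <= 2^-1 by rewrite /eps ge_min lexx orbT.
pose h1 := Dl / (4 * S).
have h10 : 0 < h1 by rewrite divr_gt0// mulr_gt0.
have h1S : h1 * S = Dl / 4 by rewrite /h1; field; rewrite lt0r_neq0.
have h11 : h1 <= 1.
  rewrite -(ler_pM2r S0) h1S mul1r /Dl; lra.
have [E E0 hE] := linear_le_pw2 (divr_gt0 Dl0 (ltr0n _ 4)).
(* With K sg = K^h1, this many geometric sums beat the factor K^(D+1) and leave K^-1 to spare. *)
pose M := (Num.bound ((D + 2) / h1)).+1.
have hM : D + 2 <= h1 * M%:R.
  rewrite mulrC -ler_pdivrMr// /M -natr1.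
  have := archi_boundP (divr_ge0 (addr_ge0 D0 (ler0n _ 2)) (ltW h10)); lra.
have [c0 hc0] : exists c0 : nat, 32 * D * (B / eta) <= 2 ^+ c0 /\ (0 < c0)%N.
  exists (Num.bound (32 * D * (B / eta))).+1; split => //.
  have x0 : 0 <= 32 * D * (B / eta).
    rewrite mulr_ge0 ?divr_ge0 ?mulr_ge0//; last exact: ltW.
    by apply: le_trans B1.
  apply: (le_trans (ltW (archi_boundP x0))).
  rewrite -natrX ler_nat; apply: leq_trans (leqnSn _) _.
  exact: ltnW (ltn_expl _ _).
case: hc0 => hc0 c00.
(* As K sg >= 1, all gaps are below 2^(q + b0), so the harmonic sum is at most q + b0 + 1. *)
have [b0 hb0] : exists b0 : nat, 2 * B < 2 ^+ b0.
  exists (Num.bound (2 * B)).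
  have x0 : 0 <= 2 * B by move: B1; lra.
  apply: (lt_le_trans (archi_boundP x0)); rewrite -natrX ler_nat.
  exact: ltnW (ltn_expl _ _).
pose Cp : R := 2 * C * pair_cst T B (2 ^+ lam) R1 M * (B + B / eta) `^ S * b0.+1%:R * E.
pose C4 := C * (M.+2%:R) ^+ #|T| * pw2 (D * c0%:R + S * (lam%:R - c0%:R)) *
  (4 * R1 + Cp).
have pc0 : 0 <= pair_cst T B (2 ^+ lam) R1 M.
  have LB : 0 <= (2 ^+ lam : R) * B ^+ 2 by rewrite mulr_ge0 ?sqr_ge0// exprn_ge0.
  have hM' : 0 <= #|T|%:R * M.+1%:R * ((2 ^+ lam : R) * B ^+ 2) by rewrite mulr_ge0.
  by rewrite /pair_cst; have := R11; move: hM' LB; lra.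
have Cp0 : 0 <= Cp.
  apply: mulr_ge0 E0; apply: mulr_ge0 => //; apply: mulr_ge0 (powR_ge0 _ _).
  by apply: mulr_ge0 pc0; rewrite mulr_ge0.
exists C4, (pw2 (- eps)), c0; split.
- rewrite /C4; apply: mulr_ge0; last by have := R11; lra.
  apply: mulr_ge0 (pw2_ge0 _); apply: mulr_ge0 => //; exact: exprn_ge0.
- rewrite -(ler_pM2l (pw2_gt0 (eps *+ 2))).
  rewrite mulr2n -pw2D addrK.
  have p2 : pw2 (eps + eps) <= 2.
    by rewrite -[leRHS]expr1 -pw2_nat; apply: pw2_le; lra.
  have p1 := pw2_gt0 (eps + eps).
  rewrite -(@ler_pXn2r _ 2)// ?nnegrE ?pw2_ge0//; last by rewrite mulr_ge0// ltW.
  have -> : pw2 eps ^+ 2 = pw2 (eps + eps) by rewrite pw2D expr2.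
  set z := pw2 (eps + eps) in p1 p2 *; nra.
- have := pw2_gt1 eps0 => h; rewrite pw2N invf_lt1 ?pw2_gt0//.
move=> n q c I J w v X g r th be qn w0 w1 v0 v1 XB Xc wb vb gb r0 rR th0 be1 be2.
set Kn := (2 ^ q)%N.
have KE : Kn%:R = pw2 q%:R :> R by rewrite pw2_nat natrX.
(* Boxes of relative side N/H = 2^(-q - c0), a small multiple of 1/K; the choice of [c0] makes the
   smearing invertible. *)
pose N := (2 ^ (n + lam - q - c0))%N.
pose H := (2 ^ (n + lam))%N.
have HE : H%:R = pw2 (n + lam)%:R :> R by rewrite pw2_nat natrX.
have NE : N%:R = pw2 ((n + lam)%:R - q%:R - c0%:R) :> R.
  rewrite /N natrX -pw2_nat; congr pw2.
  rewrite -subnDA natrB; last exact: leq_trans qn (leq_addr _ _).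
  by rewrite [(q + c0)%:R]natrD opprD addrA.
(* The cutoff for close slopes, slightly coarser than 1/K. *)
pose sg : R := pw2 (- (1 - h1) * q%:R).
have sg0 : 0 < sg by exact: pw2_gt0.
have Ksg : Kn%:R * sg = pw2 (h1 * q%:R) by rewrite KE /sg -pw2D; congr pw2; ring.
have rp : 0 < `|r| by rewrite normr_gt0.
pose ze j t := absz (g j t + (M.+1 * H)%:Z).
have zeE j t : (ze j t)%:R = (g j t)%:~R + M.+1%:R * H%:R :> R.
  have -> : (ze j t)%:R = ((ze j t)%:Z)%:~R :> R by [].
  rewrite /ze gez0_abs; first by rewrite intrD -natrM.
  exact: shift_ge0 (gb j t).
have Hn0 : (H%:R : R) != 0 by rewrite HE lt0r_neq0// pw2_gt0.
have grid j : gridpt R H M (ze j) = fun t => (g j t)%:~R / 2 ^+ (n + lam).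
  apply: funext => t; rewrite /gridpt zeE mulrDl mulfK// addrK.
  by rewrite -natrX.
have u32 i : `|intercept c X (2 ^+ lam) r i| <= 32^-1.
  rewrite /intercept normrM normfV normrM ler_pdivrMr; last first.
    by rewrite mulr_gt0 ?normr_gt0 ?expf_neq0// -normr_gt0; exact: lt_le_trans (Xc i).
  rewrite (ger0_norm (exprn_ge0 _ _))//.
  have : 2 ^+ lam * eta <= 2 ^+ lam * `|X i c| by rewrite ler_wpM2l ?exprn_ge0.
  by move: rR lamR; lra.
have HN : 32 * Kn%:R * #|T|%:R * (B / eta) * N%:R <= H%:R.
  have -> : 32 * Kn%:R * #|T|%:R * (B / eta) * N%:R =
    (32 * D * (B / eta)) * (Kn%:R * N%:R) by rewrite /D; ring.
  apply: (@le_trans _ _ (2 ^+ c0 * (Kn%:R * N%:R))).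
    by rewrite ler_wpM2r.
  by rewrite -pw2_nat KE NE HE -!pw2D; apply: pw2_le; lra.
have zeH j t : (M * H <= ze j t)%N && (ze j t + N <= M.+2 * H)%N.
  have NH : (2 * N <= H)%N.
    rewrite /N /H -expnS leq_exp2l// -subnDA -subSn.
      by rewrite leq_subLR -add1n leq_add2r (leq_trans c00)// leq_addl.
    exact: leq_trans qn (leq_addr _ _).
  exact: shift_box (gb j t) NH.
(* In the scale of Y a box has side N/2^n = 2^(lam - q - c0), at least 2^-n, so the ball condition
   applies to it. *)
pose V := C * pw2 (S * (lam%:R - q%:R - c0%:R)).
have V0 : 0 <= V by rewrite mulr_ge0 ?pw2_ge0.
have zeV (z : T -> nat) :
    \sum_(j | [forall t, (ze j t <= z t < ze j t + N)%N]) v j <= V.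
  have nn : pw2 (lam%:R - q%:R - c0%:R) = N%:R / 2 ^+ n :> R.
    by rewrite NE -pw2_nat -pw2N -pw2D; congr pw2; rewrite natrD; ring.
  have dn : 2 ^- n <= N%:R / 2 ^+ n :> R.
    by rewrite -[leLHS]mul1r ler_wpM2r ?invr_ge0 ?exprn_ge0// ler1n expn_gt0.
  rewrite /V mulrC [_ * (_ - _)]mulrC pw2M nn mulrC.
  apply: le_trans (vb (fun t => ((z t)%:R - M.+1%:R * H%:R) / 2 ^+ n) _ dn).
  rewrite big_mkcond [leRHS]big_mkcond; apply: ler_sum => j _.
  case: ifPn => [/forallP hz|_]; last by case: ifP.
  case: ifPn => // /negP[].
  apply/forallP => t; have /andP[z1 z2] := hz t.
  rewrite -mulrBl normrM normfV (ger0_norm (exprn_ge0 _ _))//.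
  rewrite ler_wpM2r ?invr_ge0 ?exprn_ge0//.
  have -> : (g j t)%:~R - ((z t)%:R - M.+1%:R * H%:R) = (ze j t)%:R - (z t)%:R :> R.
    by rewrite zeE; ring.
  move: z1 z2; rewrite -(ler_nat R) -(ltr_nat R) natrD => z1 z2.
  by rewrite ler_norml; apply/andP; split; move: z1 z2; lra.
have K0 : (0 < Kn)%N by rewrite expn_gt0.
have N0 : (0 < N)%N by rewrite expn_gt0.
have be2' k : (k.+1 < Kn)%N -> `|be k.+1 - be k| <= th / Kn%:R.
  by move=> /be2; rewrite natrX.
have sX i : slope c X i c = 1.
  by rewrite /slope divff// -normr_gt0; exact: lt_le_trans (Xc i).
have sO i t : `|slope c X i t| <= B / eta.
  exact: slope_le XB Xc eta0 i t.
have := @block_bound _ _ _ _ c w v (slope c X) (intercept c X (2 ^+ lam) r)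
  ze H Kn N M (B / eta) V th sg be w0 v0 v1 sX sO u32 N0 K0 isT HN zeH V0 zeV
  th0 be1 be2' sg0.
set lhs := (X in X <= _ -> _); set lhs' := (X in _ -> X <= _).
have -> : lhs = lhs'.
  rewrite /lhs /lhs'; congr (nc _ ^+ 2).
  by apply: eq_bigr => i _; apply: eq_bigr => j _; apply: eq_bigr => k _; rewrite grid.
move=> /le_trans; apply.
have hq0 : 0 <= h1 * q%:R by rewrite mulr_ge0// ltW.
have sgK : 1 <= Kn%:R * sg by rewrite Ksg -[leLHS]pw2_0; exact: pw2_le.
have aB : 2 * B < 2 ^+ (q + b0) * sg.
  rewrite exprD mulrAC -[2 ^+ q]pw2_nat -KE.
  by apply: (lt_le_trans hb0); rewrite ler_peMl// exprn_ge0.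
have sgdl : 2 ^- n <= sg.
  rewrite -pw2_nat -pw2N; apply: pw2_le.
  have : (q%:R : R) <= n%:R by rewrite ler_nat (leq_trans (leq_addr _ _) qn).
  by move: hq0; lra.
have l0 : 0 < (2 ^+ lam : R) by rewrite exprn_gt0.
have ps := pair_sum th M w0 w1 XB Xc eta0 l0 B1 R11 r0 rR C0 wb sg0 sgK sgdl aB.
pose A := C * M.+2%:R ^+ #|T| * pw2 (D * c0%:R + S * (lam%:R - c0%:R)).
have A0 : 0 <= A.
  by apply: mulr_ge0 (pw2_ge0 _); apply: mulr_ge0 => //; exact: exprn_ge0.
have preE : (N ^ #|T|)%:R^-1 * V * ((M.+2 * H) ^ #|T|)%:R = A * pw2 ((D - S) * q%:R).
  rewrite [(N ^ _)%:R]natrX [((_ * _) ^ _)%:R]natrX natrM exprMn NE HE -!pw2Mn -pw2N /V /A -/D.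
  have -> (a b c' d : R) : a * (C * b) * (c' * d) = C * c' * (a * b * d) by ring.
  rewrite -[RHS]mulrA -!pw2D; congr (_ * pw2 _); rewrite natrD; ring.
have P0 : 0 <= (N ^ #|T|)%:R^-1 * V * ((M.+2 * H) ^ #|T|)%:R.
  by rewrite preE mulr_ge0// pw2_ge0.
apply: (le_trans (ler_wpM2l P0 ps)); rewrite preE.
have -> : (pw2 (- eps) ^+ q) ^+ 2 = pw2 (- eps * q%:R * 2%:R) by rewrite !pw2Mn.
set x := pw2 (- eps * q%:R * 2%:R).
have q0 : 0 <= q%:R :> R by [].
(* Far pairs: the exponent D + 1 - S - h1 M is at most -1, hence at most -2 eps. The factor R1/|r|
   >= 1 only gives both parts the same shape. *)
have F1 : pw2 ((D - S) * q%:R) * (Kn%:R * (4 * (Kn%:R * sg) ^- M)) <= 4 * R1 * x / `|r|.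
  have -> : pw2 ((D - S) * q%:R) * (Kn%:R * (4 * (Kn%:R * sg) ^- M)) =
     4 * pw2 (((D + 1 - S) - h1 * M%:R) * q%:R).
    rewrite Ksg -pw2Mn -pw2N KE.
    have -> (a b d : R) : a * (b * (4 * d)) = 4 * (a * b * d) by ring.
    by rewrite -!pw2D; congr (4 * pw2 _); ring.
  have : pw2 (((D + 1 - S) - h1 * M%:R) * q%:R) <= x.
    apply: pw2_le; rewrite [leRHS]mulrAC ler_wpM2r//.
    by move: hM eps2 S0; lra.
  move=> h2; have := ler_pM (normr_ge0 r) (pw2_ge0 _) rR h2.
  by rewrite ler_pdivlMr//; lra.
(* Close pairs: the exponent is D + 1 - 2S + h1 S + Dl/4 = -Dl/2, the summand Dl/4 paying for the
   logarithm. *)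
have F2 : pw2 ((D - S) * q%:R) * (Kn%:R * (2 * C * pair_cst T B (2 ^+ lam) R1 M *
    ((B + B / eta) * sg) `^ S * (q + b0).+1%:R / `|r|)) <= Cp * x / `|r|.
  rewrite mulrA [leLHS]mulrA ler_wpM2r ?invr_ge0//.
  have BB : 0 <= B + B / eta.
    by rewrite addr_ge0 ?divr_ge0 ?(ltW eta0) ?(le_trans ler01 B1).
  rewrite powRM//; last exact: ltW.
  rewrite /sg -pw2M.
  set Y := 2 * C * _; set Z := _ `^ S.
  have Y0 : 0 <= Y * Z.
    by apply: mulr_ge0 (powR_ge0 _ _); apply: mulr_ge0 pc0; rewrite mulr_ge0.
  have qb : (q + b0).+1%:R <= b0.+1%:R * E * pw2 (Dl / 4 * q%:R).
    apply: (@le_trans _ _ (b0.+1%:R * q.+1%:R)).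
      by rewrite -natrM ler_nat succ_add_le.
    by rewrite -mulrA ler_wpM2l.
  have -> : Cp * x = (Y * Z) * (b0.+1%:R * E * x) by rewrite /Cp -/Y -/Z; ring.
  set W := pw2 (_ * S).
  have -> : pw2 ((D - S) * q%:R) * Kn%:R * (Y * (Z * W) * (q + b0).+1%:R) =
    (Y * Z) * ((q + b0).+1%:R * (pw2 ((D - S) * q%:R) * Kn%:R * W)) by ring.
  rewrite ler_wpM2l//.
  rewrite KE /W -!pw2D.
  apply: (le_trans (ler_wpM2r (pw2_ge0 _) qb)).
  rewrite -[leLHS]mulrA -pw2D ler_wpM2l ?mulr_ge0//; apply: pw2_le.
  have -> : Dl / 4 * q%:R + ((D - S) * q%:R + q%:R + - (1 - h1) * q%:R * S) =
     (Dl / 4 + (D - S) + 1 - S + h1 * S) * q%:R by ring.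
  rewrite h1S [leRHS]mulrAC ler_wpM2r//.
  by rewrite /Dl in eps1 *; move: eps1; lra.
rewrite /C4 -/A.
have -> : th ^+ 2 * (A * (4 * R1 + Cp)) * x / `|r| =
  th ^+ 2 * A * (4 * R1 * x / `|r| + Cp * x / `|r|) by ring.
have -> : A * pw2 ((D - S) * q%:R) * (th ^+ 2 * Kn%:R * (4 * (Kn%:R * sg) ^- M +
   2 * C * pair_cst T B (2 ^+ lam) R1 M * ((B + B / eta) * sg) `^ S *
   (q + b0).+1%:R / `|r|)) =
   th ^+ 2 * A * (pw2 ((D - S) * q%:R) * (Kn%:R * (4 * (Kn%:R * sg) ^- M)) +
    pw2 ((D - S) * q%:R) * (Kn%:R * (2 * C * pair_cst T B (2 ^+ lam) R1 M *
    ((B + B / eta) * sg) `^ S * (q + b0).+1%:R / `|r|))) by ring.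
rewrite ler_wpM2l//; last exact: lerD.
by apply: mulr_ge0 A0; exact: sqr_ge0.
Qed.

End Chart.

(** * The Fejér kernel *)

Section Fejer.
Variable R : realType.
Implicit Types a b : R.

(** Normalised to have mean 1 over a period and the value [T] at 0, so that averages of it
    approximate a density. *)
Definition fejer (T : nat) a : R := nc (\sum_(k < T) e (k%:R * a)) ^+ 2 / T%:R.

Lemma fejer_ge0 T a : 0 <= fejer T a.
Proof. by rewrite divr_ge0// sqr_ge0. Qed.

Lemma fejerE T a : (0 < T)%N -> cx (fejer T a) = 1 +
  \sum_(k < T.-1) cx (1 - k.+1%:R / T%:R) * (e (k.+1%:R * a) + (e (k.+1%:R * a))^*).
Proof.
case: T => // T _ /=.
have Tp : (T.+1%:R : R) != 0 by [].
have main (n : nat) : cx (nc (\sum_(k < n.+1) e (k%:R * a)) ^+ 2) = cx n.+1%:R +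
  \sum_(k < n) cx (n.+1%:R - k.+1%:R) * (e (k.+1%:R * a) + (e (k.+1%:R * a))^*).
  elim: n => [|n IH].
    by rewrite big_ord1 big_ord0 mul0r e0 nc1 expr1n addr0.
  rewrite nc_sqr big_ord_recr /= rmorphD /= mulrDl !mulrDr -nc_sqr IH.
  rewrite [X in _ + _ + X]addrC -!addrA; rewrite -eN -eD subrr e0.
  set x := e (n.+1%:R * a); set P := \sum_(i < n.+1) e _.
  have hP : P * e (- (n.+1%:R * a)) + x * P^* =
     \sum_(k < n.+1) (e (k.+1%:R * a) + (e (k.+1%:R * a))^*).
    rewrite /P rmorph_sum mulr_suml mulr_sumr -big_split /=.
    rewrite (reindex_inj rev_ord_inj) /=; apply: eq_bigr => k _.
    have kn : (k <= n)%N by rewrite -ltnS.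
    rewrite /x -!eN -!eD addrC subSS; congr (e _ + e _).
      rewrite (natrB _ kn) -[n.+1%:R]natr1 -[k.+1%:R]natr1.
      by move: (n%:R : R) ((k : nat)%:R : R) => x1 x2; ring.
    rewrite (natrB _ kn) -[n.+1%:R]natr1 -[k.+1%:R]natr1.
      by move: (n%:R : R) ((k : nat)%:R : R) => x1 x2; ring.
  have -> : P * e (- (n.+1%:R * a)) + (1 + x * P^*) = 1 + \sum_(k < n.+1) (e (k.+1%:R * a) + (e (k.+1%:R * a))^*).
    by rewrite -hP; ring.
  have -> : \sum_(k < n.+1) cx (n.+2%:R - k.+1%:R) * (e (k.+1%:R * a) + (e (k.+1%:R * a))^*) =
    \sum_(k < n) cx (n.+1%:R - k.+1%:R) * (e (k.+1%:R * a) + (e (k.+1%:R * a))^*) +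
    \sum_(k < n.+1) (e (k.+1%:R * a) + (e (k.+1%:R * a))^*).
    have -> : \sum_(k < n) cx (n.+1%:R - k.+1%:R) * (e (k.+1%:R * a) + (e (k.+1%:R * a))^*) =
      \sum_(k < n.+1) cx (n.+1%:R - k.+1%:R) * (e (k.+1%:R * a) + (e (k.+1%:R * a))^*).
      by rewrite [RHS]big_ord_recr /= subrr cx0 mul0r addr0.
    rewrite -big_split /=; apply: eq_bigr => k _.
    by rewrite -[n.+2%:R]natr1 addrAC cxD cx1 mulrDl mul1r.
  by rewrite -[n.+2%:R]natr1 cxD cx1; ring.
rewrite /fejer mulrC cxM main mulrDr -cxM mulVf// cx1; congr (_ + _).
rewrite mulr_sumr; apply: eq_bigr => k _.
by rewrite mulrA -cxM mulrBr mulVf// [_^-1 * _]mulrC.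
Qed.

Lemma fejer_far T a : a != 0 -> `|a| <= 8^-1 -> fejer T a <= (T%:R * a ^+ 2)^-1.
Proof.
move=> a0 a8; rewrite /fejer invfM mulrC ler_wpM2l ?invr_ge0//.
have -> : (a ^+ 2)^-1 = `|a|^-1 ^+ 2 by rewrite exprVn real_normK ?num_real.
by rewrite ler_sqr ?nnegrE ?nc_ge0 ?invr_ge0// nc_geom.
Qed.

Lemma dirichlet_diff T a b :
  nc (\sum_(k < T) e (k%:R * a) - \sum_(k < T) e (k%:R * b)) <=
    8 * T%:R ^+ 2 * `|a - b|.
Proof.
rewrite -sumrB; apply: (le_trans (nc_sum _ _ _)).
have -> : 8 * T%:R ^+ 2 * `|a - b| = \sum_(k < T) 8 * (T%:R * `|a - b|).
  by rewrite sumr_const card_ord -[RHS]mulr_natl; ring.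
apply: ler_sum => k _.
have -> : e (k%:R * a) - e (k%:R * b) = e (k%:R * b) * (e (k%:R * (a - b)) - 1).
  by rewrite mulrBr mulr1 -eD; congr (e _ - _); ring.
rewrite ncM nc_e mul1r; apply: (le_trans (e_sub1_le _)).
rewrite ler_wpM2l// normrM normr_nat ler_wpM2r// ler_nat.
exact: ltnW.
Qed.

Lemma fejer_near T a : (0 < T)%N -> `|a| <= (16 * T%:R)^-1 -> T%:R / 4 <= fejer T a.
Proof.
move=> T0 ha; have Tr : (0 : R) < T%:R by rewrite ltr0n.
rewrite /fejer ler_pdivlMr//.
have := dirichlet_diff T a 0.
rewrite subr0 [X in _ - X](eq_bigr (fun _ => 1)); last by move=> k _; rewrite mulr0 e0.
rewrite sumr_const card_ord.
set P := \sum_(k < T) _ => h.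
have Tn : nc (1 *+ T : Cx R) = T%:R.
  have -> : (1 *+ T : Cx R) = cx (T%:R : R).
    rewrite -[T in LHS]card_ord -[T in RHS]card_ord -!sumr_const cx_sum.
    by apply: eq_bigr => *; rewrite cx1.
  by rewrite nc_cx normr_nat.
have := ncD_le P (1 *+ T - P); rewrite addrCA subrr addr0 Tn.
have -> : nc (1 *+ T - P) = nc (P - 1 *+ T) by rewrite -ncN opprB.
have : 8 * T%:R ^+ 2 * `|a| <= T%:R / 2.
  apply: (@le_trans _ _ (8 * T%:R ^+ 2 * (16 * T%:R)^-1)).
    by rewrite ler_wpM2l// mulr_ge0// sqr_ge0.
  by rewrite le_eqVlt; apply/orP; left; apply/eqP; field; rewrite lt0r_neq0.
move: h; set x := nc P; set y := nc _ => h1 h2 h3.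
have hx : T%:R / 2 <= x by lra.
have : (T%:R / 2) ^+ 2 <= x ^+ 2.
  by rewrite ler_sqr ?nnegrE ?nc_ge0// divr_ge0.
by rewrite expr2; lra.
Qed.

Lemma dirichlet_le T a : nc (\sum_(k < T) e (k%:R * a)) <= T%:R.
Proof.
apply: (le_trans (nc_sum _ _ _)).
by rewrite (eq_bigr (fun _ => 1)) ?sumr_const ?card_ord// => k _; rewrite nc_e.
Qed.

Lemma fejer_lip T a b : (0 < T)%N ->
  fejer T a <= fejer T b + 16 * T%:R ^+ 2 * `|a - b|.
Proof.
move=> T0; have Tr : (0 : R) < T%:R by rewrite ltr0n.
rewrite /fejer -lerBlDl -mulrBl ler_pdivrMr//.
have := dirichlet_diff T a b.
set P := \sum_(k < T) _; set P' := \sum_(k < T) e (_ * b).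
have := dirichlet_le T a; have := dirichlet_le T b; rewrite -/P -/P'.
have := ncD_le (P - P') P'; rewrite subrK.
have := nc_ge0 P; have := nc_ge0 P'; have := nc_ge0 (P - P').
have : 0 <= `|a - b| by [].
set x := nc P; set y := nc P'; set z := nc (P - P'); set d := `|_|.
move=> d0 z0 y0 x0 h1 h2 h3 h4.
rewrite subr_sqr mulrC.
have h5 : (x + y) * (x - y) <= (x + y) * z.
  by rewrite ler_wpM2l ?addr_ge0//; lra.
have h6 : (x + y) * z <= (2 * T%:R) * (8 * T%:R ^+ 2 * d).
  by apply: ler_pM => //; rewrite ?addr_ge0//; lra.
lra.
Qed.

End Fejer.

Lemma sum_dyadic (V : zmodType) (f : nat -> V) p :
  \sum_(k < (2 ^ p).-1) f k.+1 = \sum_(q < p) \sum_(k < 2 ^ q) f (2 ^ q + k)%N.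
Proof.
elim: p => [|p IH]; first by rewrite big_ord0 big_ord0.
rewrite big_ord_recr /= -IH.
have -> : (2 ^ p.+1).-1 = ((2 ^ p).-1 + 2 ^ p)%N.
  by rewrite expnS; have := expn_gt0 2 p; lia.
rewrite big_split_ord /=; congr (_ + _); apply: eq_bigr => k _.
by rewrite -addSn prednK ?expn_gt0.
Qed.

(** The terms grow geometrically up to p0, with ratio 2 rh > 1, and decay afterwards with ratio rh,
    so everything is comparable to rh^p0. The induction for the first half needs 8 <= 12 rh, whence
    2/3. *)
Lemma dyadic_weights (R : realType) (rh : R) (p0 p : nat) : 2 / 3 <= rh -> rh < 1 ->
  \sum_(q < p) (if (q < p0)%N then 2 ^+ q.+1 / 2 ^+ p0 else 1) * rh ^+ q <=
  (6 + (1 - rh)^-1) * rh ^+ p0.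
Proof.
move=> r1 r2.
have rh0 : 0 <= rh by lra.
have head (m : nat) : (m <= p0)%N ->
    \sum_(q < m) (2 ^+ q.+1 / 2 ^+ p0) * rh ^+ q <= 6 * (2 ^+ m / 2 ^+ p0) * rh ^+ m.
  elim: m => [|m IH] mp; first by rewrite big_ord0 !mulr_ge0// ?invr_ge0 ?exprn_ge0.
  rewrite big_ord_recr /=.
  apply: (le_trans (lerD (IH (ltnW mp)) (lexx _))).
  rewrite !exprS.
  have y0 : 0 <= 2 ^+ m / 2 ^+ p0 * rh ^+ m by rewrite !mulr_ge0 ?invr_ge0 ?exprn_ge0.
  nra.
have tail (m n : nat) : \sum_(q < n) rh ^+ (m + q) <= (1 - rh)^-1 * rh ^+ m.
  have -> : \sum_(q < n) rh ^+ (m + q) = rh ^+ m * \sum_(q < n) rh ^+ q.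
    by rewrite mulr_sumr; apply: eq_bigr => q _; rewrite exprD.
  rewrite mulrC ler_wpM2r ?exprn_ge0//.
  have d0 : 0 < 1 - rh by lra.
  rewrite -[leRHS]mul1r ler_pdivlMr//.
  have := subrX1 rh n; have : 0 <= rh ^+ n by rewrite exprn_ge0.
  nra.
have nn : 0 <= (1 - rh)^-1 * rh ^+ p0.
  by rewrite mulr_ge0 ?exprn_ge0// invr_ge0; lra.
have [pp|pp] := leqP p p0.
  apply: (@le_trans _ _ (\sum_(q < p0) (2 ^+ q.+1 / 2 ^+ p0) * rh ^+ q)).
    rewrite -(subnKC pp) big_split_ord /= ler_wpDr//.
      apply: sumr_ge0 => q _.
      by rewrite !mulr_ge0// ?invr_ge0 ?exprn_ge0.
    by apply: ler_sum => q _; rewrite ltn_addr.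
  apply: (le_trans (head _ (leqnn _))).
  by rewrite divff ?expf_neq0// mulr1 [leRHS]mulrDl; move: nn; lra.
rewrite -(subnKC (ltnW pp)) big_split_ord /= mulrDl; apply: lerD.
  apply: le_trans (le_trans (head _ (leqnn _)) _).
    by apply: ler_sum => q _ /=; rewrite ltn_ord.
  by rewrite divff ?expf_neq0// mulr1.
apply: le_trans (tail p0 (p - p0)%N).
by apply: ler_sum => q _; rewrite ltnNge leq_addr /= mul1r.
Qed.

Lemma sum_invsqrt_le (R : realType) L :
  \sum_(m < L) (Num.sqrt (m.+1%:R : R))^-1 <= 2 * Num.sqrt (L%:R : R).
Proof.
elim: L => [|L IH]; first by rewrite big_ord0 mulr_ge0// sqrtr_ge0.
rewrite big_ord_recr /=.
set x := Num.sqrt (L%:R : R) in IH *; set y := Num.sqrt (L.+1%:R : R).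
have x0 : 0 <= x by exact: sqrtr_ge0.
have y0 : 0 < y by rewrite sqrtr_gt0.
have xx : x ^+ 2 = L%:R by rewrite sqr_sqrtr.
have yy : y ^+ 2 = L%:R + 1 by rewrite sqr_sqrtr// natr1.
have : y^-1 <= 2 * (y - x).
  rewrite -[leLHS]mul1r ler_pdivrMr//; nra.
lra.
Qed.

(** * Averages of the Fejér kernel and their frequency expansion *)

Section FejerSum.
Variables (R : realType) (T : finType).
Variables (n lam : nat) (c : T) (I J : finType) (w : I -> R) (v : J -> R).
Variables (X : I -> T -> R) (g : J -> T -> int).

Definition fejer_sum (K : nat) (r : R) : R :=
  \sum_i \sum_j w i * v j * fejer K (chart_phase lam n c X g r i j).

Definition expo_sum (r : R) (k : nat) : Cx R :=
  \sum_i \sum_j cx (w i * v j) * e (k%:R * chart_phase lam n c X g r i j).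

Lemma fejer_sumE K r : (0 < K)%N -> cx (fejer_sum K r) =
  cx (\sum_i \sum_j w i * v j) +
  \sum_(k < K.-1) cx (1 - k.+1%:R / K%:R) * (expo_sum r k.+1 + (expo_sum r k.+1)^*).
Proof.
move=> K0.
have -> : \sum_(k < K.-1) cx (1 - k.+1%:R / K%:R) * (expo_sum r k.+1 + (expo_sum r k.+1)^*)
  = \sum_i \sum_j \sum_(k < K.-1) cx (w i * v j) * (cx (1 - k.+1%:R / K%:R) *
     (e (k.+1%:R * chart_phase lam n c X g r i j) +
      (e (k.+1%:R * chart_phase lam n c X g r i j))^*)).
  rewrite (eq_bigr (fun i => \sum_(k < K.-1) \sum_j cx (w i * v j) * (cx (1 - k.+1%:R / K%:R) *
     (e (k.+1%:R * chart_phase lam n c X g r i j) +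
      (e (k.+1%:R * chart_phase lam n c X g r i j))^*)))); last first.
    by move=> i _; rewrite exchange_big.
  rewrite [RHS]exchange_big /=; apply: eq_bigr => k _.
  rewrite /expo_sum rmorph_sum -big_split mulr_sumr /=; apply: eq_bigr => i _.
  rewrite rmorph_sum -big_split mulr_sumr /=; apply: eq_bigr => j _.
  by rewrite rmorphM /= conj_cx; ring.
rewrite /fejer_sum !cx_sum -big_split /=; apply: eq_bigr => i _.
rewrite !cx_sum -big_split /=; apply: eq_bigr => j _.
by rewrite cxM fejerE// mulrDr mulr1 mulr_sumr.
Qed.

Definition fejer_weight (p p0 k : nat) : R :=
  (1 - k%:R / 2 ^+ p) - (if (k < 2 ^ p0)%N then 1 - k%:R / 2 ^+ p0 else 0).

(** The frequency 0 has the same coefficient in both orders and cancels; positive and negative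
    frequencies are conjugate. What remains is a sum of blocks 2^q <= k < 2^(q+1). *)
Lemma fejer_sum_diffE p p0 r : (p0 <= p)%N ->
  let Z := \sum_(q < p) \sum_i \sum_j \sum_(k < 2 ^ q)
     cx (w i * v j * fejer_weight p p0 (2 ^ q + k)) *
     e ((2 ^ q + k)%:R * chart_phase lam n c X g r i j) in
  cx (fejer_sum (2 ^ p) r - fejer_sum (2 ^ p0) r) = Z + Z^*.
Proof.
move=> pp Z.
have ZE : Z = \sum_(k < (2 ^ p).-1) cx (fejer_weight p p0 k.+1) * expo_sum r k.+1.
  rewrite (sum_dyadic (fun k => cx (fejer_weight p p0 k) * expo_sum r k)).
  apply: eq_bigr => q _.
  rewrite (eq_bigr (fun i => \sum_(k < 2 ^ q) \sum_j
    cx (w i * v j * fejer_weight p p0 (2 ^ q + k)) *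
     e ((2 ^ q + k)%:R * chart_phase lam n c X g r i j))); last first.
    by move=> i _; rewrite exchange_big.
  rewrite exchange_big /=; apply: eq_bigr => k _.
  rewrite /expo_sum mulr_sumr; apply: eq_bigr => i _.
  rewrite mulr_sumr; apply: eq_bigr => j _.
  by rewrite mulrA -cxM [w i * _ * _]mulrC.
rewrite cxB !fejer_sumE ?expn_gt0// opprD addrACA subrr add0r.
have -> : \sum_(k < (2 ^ p0).-1) cx (1 - k.+1%:R / (2 ^ p0)%:R) * (expo_sum r k.+1 + (expo_sum r k.+1)^*)
  = \sum_(k < (2 ^ p).-1) cx (if (k.+1 < 2 ^ p0)%N then 1 - k.+1%:R / 2 ^+ p0 else 0) *
     (expo_sum r k.+1 + (expo_sum r k.+1)^*).
  have le2 : ((2 ^ p0).-1 <= (2 ^ p).-1)%N.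
    by rewrite -!subn1 leq_sub2r// leq_exp2l.
  rewrite -[in RHS](subnKC le2) big_split_ord /=.
  rewrite [X in _ = _ + X]big1 ?addr0.
    apply: eq_bigr => k _; rewrite natrX.
    by have -> : (k.+1 < 2 ^ p0)%N by have := ltn_ord k; lia.
  move=> k _.
  have -> : (((2 ^ p0).-1 + k).+1 < 2 ^ p0)%N = false.
    by have := expn_gt0 2 p0; lia.
  by rewrite cx0 mul0r.
rewrite -sumrB ZE rmorph_sum -big_split /=; apply: eq_bigr => k _.
by rewrite -mulrBl -cxB rmorphM /= conj_cx -mulrDr natrX.
Qed.

End FejerSum.

(** * Comparing Fejér averages of two orders *)

Section FejerDiff.
Variables (R : realType) (T : finType).
Variables (B C S eta R1 : R) (lam : nat).
Hypothesis B1 : 1 <= B.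
Hypothesis C0 : 0 <= C.
Hypothesis eta0 : 0 < eta.
Hypothesis R11 : 1 <= R1.
Hypothesis DS : #|T|%:R + 1 < 2 * S.
Hypothesis lamR : 32 * R1 <= 2 ^+ lam * eta.

(** The asymmetry is due to the chart: [w] is a probability measure restricted to |X_c| >= eta,
    while [v] keeps its full mass. *)
Definition chart_data (n : nat) (c : T) (I J : finType) (w : I -> R) (v : J -> R)
    (X : I -> T -> R) (g : J -> T -> int) : Prop :=
  [/\ [/\ forall i, 0 <= w i, \sum_i w i <= 1, forall j, 0 <= v j & \sum_j v j = 1],
      [/\ forall i t, `|X i t| <= B, forall i, eta <= `|X i c| &
        forall j t, (2 * absz (g j t) <= 2 ^ (n + lam))%N],
      ball_cond w X C S (2 ^- n) &
      ball_cond v (fun j t => (g j t)%:~R / 2 ^+ n) C S (2 ^- n)].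

Lemma fejer_weight_bounds (p p0 q : nat) : (p0 <= p)%N -> (q < p)%N ->
  let th : R := if (q < p0)%N then 2 ^+ q.+1 / 2 ^+ p0 else 1 in
  [/\ 0 <= th,
   (forall k, (k < 2 ^ q)%N -> `|fejer_weight R p p0 (2 ^ q + k)| <= th) &
   (forall k, (k.+1 < 2 ^ q)%N -> `|fejer_weight R p p0 (2 ^ q + k.+1) -
      fejer_weight R p p0 (2 ^ q + k)| <= th / 2 ^+ q) ].
Proof.
move=> pp qp /=.
have P0 : (0 : R) < 2 ^- p by rewrite invr_gt0 exprn_gt0.
have P00 : (0 : R) < 2 ^- p0 by rewrite invr_gt0 exprn_gt0.
have PP : (2 ^- p : R) <= 2 ^- p0.
  by rewrite lef_pV2 ?posrE ?exprn_gt0// ler_eXn2l// ltr1n.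
case: ifPn => [qp0|]; last rewrite -leqNgt => qp0.
- have lt k : (k < 2 ^ q)%N -> (2 ^ q + k < 2 ^ p0)%N.
    move=> kq; apply: (@leq_trans (2 ^ q.+1)); last by rewrite leq_exp2l.
    by rewrite expnS mul2n -addnn ltn_add2l.
  (* Below 2^p0 the constant terms of the two coefficients cancel, and the difference is small of
     order 2^(q - p0). *)
  have fw k : (k < 2 ^ q)%N -> fejer_weight R p p0 (2 ^ q + k) = (2 ^ q + k)%:R * (2 ^- p0 - 2 ^- p).
    by move=> kq; rewrite /fejer_weight lt//; ring.
  have d0 : 0 <= 2 ^- p0 - 2 ^- p :> R by lra.
  have d1 : 2 ^- p0 - 2 ^- p <= 2 ^- p0 :> R by lra.
  split; first by rewrite divr_ge0 ?exprn_ge0.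
    move=> k kq; rewrite fw// normrM normr_nat (ger0_norm d0).
    apply: ler_pM => //; rewrite -natrX ler_nat expnS mul2n -addnn leq_add2l.
    exact: ltnW.
  move=> k kq; rewrite !fw//; last exact: ltnW.
  rewrite addnS -natr1 mulrDl mul1r addrAC subrr add0r (ger0_norm d0).
  apply: (le_trans d1).
  have -> : 2 ^+ q.+1 / 2 ^+ p0 / 2 ^+ q = 2 * 2 ^- p0 :> R.
    by rewrite exprS; field; rewrite !expf_neq0.
  by move: P00; lra.
- have ge k : (2 ^ q + k < 2 ^ p0)%N = false.
    by apply/negbTE; rewrite -leqNgt; apply: leq_trans (leq_addr _ _); rewrite leq_exp2l.
  split => //.
    move=> k kq; rewrite /fejer_weight ge subr0 ger0_norm; last first.
      rewrite subr_ge0 ler_pdivrMr ?exprn_gt0// mul1r -natrX ler_nat.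
      apply: (@leq_trans (2 ^ q.+1)); last by rewrite leq_exp2l.
      by rewrite expnS mul2n -addnn leq_add2l ltnW.
    by rewrite gerBl divr_ge0 ?exprn_ge0.
  move=> k kq; rewrite /fejer_weight !ge !subr0 addnS -natr1.
  have -> : 1 - ((2 ^ q + k)%:R + 1) / 2 ^+ p - (1 - (2 ^ q + k)%:R / 2 ^+ p) = - 2 ^- p :> R by ring.
  rewrite normrN (ger0_norm (ltW P0)) mul1r lef_pV2 ?posrE ?exprn_gt0// ler_eXn2l ?ltr1n//.
  exact: ltnW.
Qed.

(** The square root of each block bound is summed over the blocks with the dyadic weights; this
    turns 1/|r| into |r|^(-1/2). *)
Lemma fejer_sum_diff : exists (C6 rh : R) (c0 : nat),
  [/\ 0 <= C6, 0 <= rh, rh < 1 &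
  forall (n p p0 : nat) (c : T) (I J : finType) (w : I -> R) (v : J -> R)
    (X : I -> T -> R) (g : J -> T -> int) (r : R),
  chart_data n c w v X g -> (p0 <= p)%N -> (p + c0 <= n)%N ->
  r != 0 -> `|r| <= R1 ->
  `|fejer_sum n lam c w v X g (2 ^ p) r - fejer_sum n lam c w v X g (2 ^ p0) r|
  <= C6 * rh ^+ p0 / Num.sqrt `|r| ].
Proof.
have [C4 [rh [c0 [C40 rh1 rh2 H]]]] := chart_block B1 C0 eta0 R11 DS lamR.
have rh0 : 0 <= rh by lra.
exists (2 * Num.sqrt C4 * (6 + (1 - rh)^-1)), rh, c0; split => //.
  rewrite mulr_ge0 ?mulr_ge0 ?sqrtr_ge0// addr_ge0// invr_ge0; lra.
move=> n p p0 c I J w v X g r [[w0 w1 v0 v1] [XB Xc gb] wb vb] pp pn r0 rR.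
have := fejer_sum_diffE n lam c w v X g r pp.
set Z := \sum_(q < p) _ => /= E.
rewrite -nc_cx E; apply: (le_trans (ncD_le _ _)); rewrite nc_conj.
suff hZ : nc Z <= Num.sqrt C4 * ((6 + (1 - rh)^-1) * rh ^+ p0) / Num.sqrt `|r|.
  by move: hZ; lra.
apply: (le_trans (nc_sum _ _ _)).
rewrite mulrAC.
have sc0 : 0 <= Num.sqrt C4 / Num.sqrt `|r| by rewrite divr_ge0 ?sqrtr_ge0.
apply: le_trans (ler_wpM2l sc0 (dyadic_weights p0 p rh1 rh2)).
rewrite mulr_sumr; apply: ler_sum => q _.
have [th0 be1 be2] := fejer_weight_bounds pp (ltn_ord q).
have qn : (q + c0 <= n)%N.
  by apply: leq_trans pn; rewrite leq_add2r ltnW.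
have v1' : \sum_j v j <= 1 by rewrite v1.
have := H n q c I J w v X g r _ (fun k => fejer_weight R p p0 (2 ^ q + k)) qn
  w0 w1 v0 v1' XB Xc wb vb gb r0 rR th0 be1 be2.
set x := nc _; set th := (if _ then _ else _) => hx.
have rp : 0 < `|r| by rewrite normr_gt0.
rewrite -(@ler_pXn2r _ 2)// ?nnegrE; last 2 first.
- exact: nc_ge0.
- by rewrite mulr_ge0// mulr_ge0 ?exprn_ge0.
apply: (le_trans hx).
rewrite !exprMn exprVn !sqr_sqrtr ?(ltW rp)//.
by rewrite le_eqVlt; apply/orP; left; apply/eqP; ring.
Qed.

End FejerDiff.

(** * From Fejér averages to values of the form *)

Section ChartCore.
Variables (R : realType) (T : finType).
Variables (B C S eta R2 m0 : R) (lam : nat).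
Hypothesis B1 : 1 <= B.
Hypothesis C0 : 0 <= C.
Hypothesis eta0 : 0 < eta.
Hypothesis R21 : 1 <= R2.
Hypothesis m00 : 0 < m0.
Hypothesis DS : #|T|%:R + 1 < 2 * S.
Hypothesis lamR : 32 * (R2 + 2) <= 2 ^+ lam * eta.

Definition grid_dot (n : nat) (I J : finType) (X : I -> T -> R) (g : J -> T -> int)
  (i : I) (j : J) : R := \sum_t X i t * ((g j t)%:~R / 2 ^+ n).

Let Lam : R := 2 ^+ lam.
Let Lam0 : 0 < Lam. Proof. exact: exprn_gt0. Qed.

Section Data.
Variables (n : nat) (c : T) (I J : finType) (w : I -> R) (v : J -> R).
Variables (X : I -> T -> R) (g : J -> T -> int).
Hypothesis data : chart_data B C S eta lam n c w v X g.
Hypothesis gR : forall i j, `|grid_dot n X g i j| <= R2.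

Let N := fejer_sum n lam c w v X g.

Lemma chart_phaseE r i j :
  chart_phase lam n c X g r i j = (grid_dot n X g i j - r) / (Lam * X i c).
Proof.
have [_ [_ Xc _] _ _] := data.
have x0 : X i c != 0 by rewrite -normr_gt0; exact: lt_le_trans (Xc i).
rewrite /chart_phase /phase /intercept mulrBl; congr (_ - _).
rewrite /grid_dot mulr_suml; apply: eq_bigr => t _.
rewrite /slope exprD /Lam; field.
by rewrite x0 !expf_neq0.
Qed.

Lemma chart_phase_le r i j :
  `|chart_phase lam n c X g r i j| <= `|grid_dot n X g i j - r| / (Lam * eta).
Proof.
have [_ [_ Xc _] _ _] := data.
rewrite chart_phaseE normrM normfV normrM (gtr0_norm Lam0) ler_wpM2l//.
rewrite lef_pV2 ?posrE ?mulr_gt0// ?ler_pM2l//.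
exact: lt_le_trans (Xc i).
Qed.

Lemma chart_phase_ge r i j :
  `|grid_dot n X g i j - r| / (Lam * B) <= `|chart_phase lam n c X g r i j|.
Proof.
have [_ [XB Xc _] _ _] := data.
have xp : 0 < `|X i c| by exact: lt_le_trans (Xc i).
rewrite chart_phaseE normrM normfV normrM (gtr0_norm Lam0) ler_wpM2l//.
by rewrite lef_pV2 ?posrE ?mulr_gt0// ?ler_pM2l// (lt_le_trans ltr01 B1).
Qed.

Let w0 i : 0 <= w i. Proof. by have [[]] := data. Qed.
Let v0 j : 0 <= v j. Proof. by have [[]] := data. Qed.
Let w1 : \sum_i w i <= 1. Proof. by have [[]] := data. Qed.
Let v1 : \sum_j v j = 1. Proof. by have [[]] := data. Qed.

Lemma weighted_avg_le (F : I -> J -> R) x : 0 <= x ->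
  (forall i j, F i j <= x) -> \sum_i \sum_j w i * v j * F i j <= x.
Proof.
move=> x0 Fx; apply: (@le_trans _ _ (\sum_i w i * x)).
  apply: ler_sum => i _.
  rewrite -[x]mul1r -v1 mulr_suml mulr_sumr; apply: ler_sum => j _.
  by rewrite -mulrA ler_wpM2l// ler_wpM2l.
by rewrite -mulr_suml ler_piMl.
Qed.

Lemma fejer_sum1 r : N 1 r <= 1.
Proof.
apply: weighted_avg_le => // i j; rewrite /fejer big_ord1 mul0r e0 nc1.
by rewrite expr1n divr1.
Qed.

Lemma fejer_sum_lip K r r' : (0 < K)%N ->
  N K r <= N K r' + 16 * K%:R ^+ 2 * (`|r - r'| / (Lam * eta)).
Proof.
move=> K0; have [_ [_ Xc _] _ _] := data.
set x := 16 * _ * _.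
have x0 : 0 <= x.
  apply: mulr_ge0; first exact: mulr_ge0 (sqr_ge0 _).
  by rewrite divr_ge0// mulr_ge0// ltW.
apply: (@le_trans _ _ (N K r' + \sum_i \sum_j w i * v j * x)); last first.
  by rewrite lerD2l; apply: weighted_avg_le.
rewrite -big_split /=; apply: ler_sum => i _.
rewrite -big_split /=; apply: ler_sum => j _.
rewrite -mulrDr ler_wpM2l ?mulr_ge0//.
apply: (le_trans (fejer_lip _ (chart_phase lam n c X g r' i j) K0)).
rewrite lerD2l ler_wpM2l//.
rewrite !chart_phaseE -mulrBl normrM normfV normrM (gtr0_norm Lam0).
have -> : grid_dot n X g i j - r - (grid_dot n X g i j - r') = - (r - r') by ring.
rewrite normrN ler_wpM2l// lef_pV2 ?posrE ?mulr_gt0// ?ler_pM2l//.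
exact: lt_le_trans (Xc i).
Qed.

(** If no value comes within [gp] of r, every phase lies between gp/(Lam B) and 1/8 in absolute
    value, away from all integers, where the kernel is O(1/K). *)
Lemma fejer_sum_far K r gp : 0 < gp -> (0 < K)%N -> `|r| <= R2 + 2 ->
  (forall i j, gp <= `|grid_dot n X g i j - r|) ->
  N K r <= (Lam * B) ^+ 2 / (K%:R * gp ^+ 2).
Proof.
move=> g0 K0 rR hg.
have Kr : (0 : R) < K%:R by rewrite ltr0n.
have LB : 0 < Lam * B by rewrite mulr_gt0// (lt_le_trans ltr01 B1).
apply: weighted_avg_le => [|i j].
  by rewrite divr_ge0 ?sqr_ge0// mulr_ge0 ?sqr_ge0// ltW.
have ph := chart_phase_ge r i j.
set a := chart_phase _ _ _ _ _ _ _ _ in ph *.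
have lo : gp / (Lam * B) <= `|a|.
  by apply: le_trans ph; rewrite ler_wpM2r ?invr_ge0 ?(ltW LB).
have lo0 : 0 < gp / (Lam * B) by rewrite divr_gt0.
have ap : 0 < `|a| by exact: lt_le_trans lo.
have a8 : `|a| <= 8^-1.
  apply: (le_trans (chart_phase_le r i j)).
  rewrite ler_pdivrMr ?mulr_gt0//.
  have := ler_normB (grid_dot n X g i j) r; have := gR i j; move: rR lamR.
  by rewrite -/Lam; have := R21; lra.
apply: (le_trans (fejer_far K _ a8)); first by rewrite -normr_gt0.
have -> : (Lam * B) ^+ 2 / (K%:R * gp ^+ 2) = (K%:R * (gp / (Lam * B)) ^+ 2)^-1.
  have LBn := lt0r_neq0 LB.
  by field; rewrite (lt0r_neq0 g0) !lt0r_neq0// (lt_le_trans ltr01 B1).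
have a2 : 0 < a ^+ 2 by rewrite -real_normK ?num_real// exprn_gt0.
rewrite lef_pV2 ?posrE ?(mulr_gt0 Kr) ?(exprn_gt0 2 lo0)//.
rewrite ler_pM2l// -[leRHS]real_normK ?num_real// ler_sqr ?nnegrE//.
exact: ltW.
Qed.

(* Half-integers keep the values away from 0, where [fejer_sum_diff] says nothing. *)
Definition grid_value (h : R) (x : bool * nat) : R :=
  (-1) ^+ x.1 * ((x.2%:R + 2^-1) * h).

Lemma grid_value_norm h x : 0 < h -> `|grid_value h x| = (x.2%:R + 2^-1) * h.
Proof.
move=> h0; rewrite /grid_value normrM normrX normrN1 expr1n mul1r ger0_norm//.
by rewrite mulr_ge0 ?addr_ge0// ltW.
Qed.

(** Each value X.Y has a grid value within h/2. There the phase is at most 1/(16K), so a single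
    kernel already contributes K/4; the others are nonnegative. *)
Lemma fejer_sum_grid K L h : 0 < h -> (0 < K)%N -> R2 < L%:R * h ->
  h <= Lam * eta / (8 * K%:R) ->
  K%:R / 4 * \sum_i w i <= \sum_(x : bool * 'I_L) N K (grid_value h (x.1, x.2 : nat)).
Proof.
move=> h0 K0 RL hK.
have Kr : (0 : R) < K%:R by rewrite ltr0n.
rewrite [leRHS](exchange_big) /= mulr_sumr; apply: ler_sum => i _.
rewrite exchange_big /=.
have -> : K%:R / 4 * w i = \sum_j w i * v j * (K%:R / 4).
  by rewrite -mulr_suml -mulr_sumr v1 mulr1 mulrC.
apply: ler_sum => j _.
set y := grid_dot n X g i j.
pose m := Num.truncn (`|y| / h).
have /andP[m1 m2] : m%:R <= `|y| / h < m.+1%:R by apply: truncn_itv; rewrite divr_ge0// ltW.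
have mL : (m < L)%N.
  rewrite -(ltr_nat R); apply: (le_lt_trans m1); rewrite ltr_pdivrMr//.
  exact: le_lt_trans (gR i j) RL.
have near : exists s : bool, `|y - grid_value h (s, m)| <= h / 2.
  move: m1 m2; rewrite ler_pdivlMr// ltr_pdivrMr// -natr1 => m1 m2.
  rewrite /grid_value /=; have [y0|y0] := leP 0 y.
    exists false; rewrite expr0 mul1r.
    rewrite ger0_norm// in m1 m2; rewrite ler_norml; apply/andP; split; lra.
  exists true; rewrite expr1 mulN1r.
  rewrite ltr0_norm// in m1 m2; rewrite ler_norml; apply/andP; split; lra.
have [s hs] := near.
rewrite (bigD1 (s, Ordinal mL))//= -[leLHS]addr0; apply: lerD; last first.
  by apply: sumr_ge0 => x _; exact: mulr_ge0 (mulr_ge0 (w0 _) (v0 _)) (fejer_ge0 _ _).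
rewrite ler_wpM2l ?mulr_ge0//; apply: fejer_near => //.
apply: (le_trans (chart_phase_le _ i j)).
rewrite ler_pdivrMr ?mulr_gt0//; apply: (le_trans hs).
apply: (@le_trans _ _ (Lam * eta / (8 * K%:R) / 2)).
  by rewrite ler_wpM2r// invr_ge0.
by rewrite le_eqVlt; apply/orP; left; apply/eqP; field; rewrite lt0r_neq0.
Qed.

End Data.
End ChartCore.

Lemma exp_small (R : realType) (a eps : R) : 0 <= a -> a < 1 -> 0 < eps ->
  exists p : nat, forall q, (p <= q)%N -> a ^+ q <= eps.
Proof.
move=> a0 a1 e0; have d0 : 0 < 1 - a by lra.
exists (Num.bound (eps^-1 / (1 - a))).+1 => q pq.
have b := archi_boundP (divr_ge0 (ltW (eqbRL (invr_gt0 _) e0)) (ltW d0)).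
have qr : eps^-1 / (1 - a) <= q%:R.
  by apply: (le_trans (ltW b)); rewrite ler_nat ltnW.
have : q%:R * a ^+ q <= (1 - a)^-1.
  have geo : \sum_(k < q) a ^+ k <= (1 - a)^-1.
    rewrite -[leRHS]mul1r ler_pdivlMr//.
    have := subrX1 a q; have : 0 <= a ^+ q by rewrite exprn_ge0.
    nra.
  apply: le_trans geo.
  have -> : q%:R * a ^+ q = \sum_(k < q) a ^+ q by rewrite sumr_const card_ord mulr_natl.
  by apply: ler_sum => k _; rewrite ler_wiXn2l ?(ltW a1)// ltnW.
move=> h.
have aq : 0 <= a ^+ q by rewrite exprn_ge0.
have h2 : eps^-1 / (1 - a) * a ^+ q <= (1 - a)^-1.
  by apply: le_trans h; rewrite ler_wpM2r.
rewrite -[leRHS]mulr1 -(ler_pdivrMl _ _ e0) -(ler_pM2l (eqbRL (invr_gt0 _) d0)).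
by rewrite mulr1; lra.
Qed.

Lemma sum_ord_lt_le (R : realType) (L Lc : nat) (F : nat -> R) :
  (forall m, 0 <= F m) ->
  \sum_(m < L | (m < Lc)%N) F m <= \sum_(m < Lc) F m.
Proof.
move=> F0; have [le|/ltnW le] := leqP Lc L.
  by rewrite [leRHS](big_ord_widen _ F le).
rewrite [leRHS](bigID (fun m : 'I_Lc => (m < L)%N)) /= -(big_ord_widen _ F le).
apply: (@le_trans _ _ (\sum_(m < L) F m)); last by rewrite lerDl sumr_ge0.
by rewrite big_mkcond; apply: ler_sum => m _; case: ifP.
Qed.

(* The finite list [rl] and the radius [kp] depend neither on the precision [gp] nor
   on the scale [n]: this survives the passage from finite sets to the limit. *)
Lemma chart_core (R : realType) (T : finType) (B C S eta R2 m0 : R) (lam : nat) :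
  1 <= B -> 0 <= C -> 0 < eta -> 1 <= R2 -> 0 < m0 ->
  #|T|%:R + 1 < 2 * S -> 32 * (R2 + 2) <= 2 ^+ lam * eta ->
  exists (rl : seq R) (kp : R), 0 < kp /\
  forall gp : R, 0 < gp -> exists n0 : nat, forall n, (n0 <= n)%N ->
  forall (c : T) (I J : finType) (w : I -> R) (v : J -> R)
    (X : I -> T -> R) (g : J -> T -> int),
  chart_data B C S eta lam n c w v X g -> m0 <= \sum_i w i ->
  (forall i j, `|grid_dot n X g i j| <= R2) ->
  exists2 r, r \in rl & forall r', `|r' - r| <= kp ->
    exists i j, `|grid_dot n X g i j - r'| < gp.
Proof.
move=> B1 C0 eta0 R21 m00 DS lamR.
have R11 : 1 <= R2 + 2 by lra.
have [C6 [rh [c0 [C60 rh0 rh1 diff]]]] := fejer_sum_diff B1 C0 eta0 R11 DS lamR.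
pose Lam : R := 2 ^+ lam.
have Lam0 : 0 < Lam by exact: exprn_gt0.
have LE : 0 < Lam * eta by exact: mulr_gt0.
(* [h0 / 2 ^+ p0] is the largest spacing for which a grid of values sees the peak of the kernel of
   order 2^p0. *)
pose h0 := Lam * eta / 8.
have h00 : 0 < h0 by rewrite divr_gt0.
pose C7 := Num.sqrt (R2 + 2) + C6.
have C70 : 0 < C7 by rewrite /C7 ltr_wpDr// sqrtr_gt0; lra.
(* Chosen so that grid values with index below c1 T0, the ones near 0, contribute at most T0 m0 / 16
   in total. *)
pose c1 := h0 / 2 * (m0 / (64 * C7)) ^+ 2.
have c10 : 0 < c1 by rewrite mulr_gt0 ?exprn_gt0 ?divr_gt0 ?mulr_gt0.
pose c2 := R2 / h0 + 2.
have c20 : 0 < c2 by rewrite ltr_wpDl// divr_ge0 ?(ltW h00)//; lra.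
(* The grid has at most 2 c2 T0 values; if the average were at most c' at each, they would
   contribute at most T0 m0 / 8. *)
pose c' := m0 / (16 * c2).
have c'0 : 0 < c' by rewrite divr_gt0// mulr_gt0.
(* A lower bound for |r| at the good grid value. Neither it nor c' involves p0, which can therefore
   be chosen afterwards, with the error at |r'| >= cr/2 below c'/4. *)
pose cr := c1 * h0 / 2.
have cr0 : 0 < cr by rewrite divr_gt0// mulr_gt0.
have [p0 [hp1 hp2]] : exists p0 : nat,
    C6 * rh ^+ p0 / Num.sqrt (cr / 2) <= c' / 4 /\ h0 <= 2 ^+ p0.
  have s0 : 0 < Num.sqrt (cr / 2) by rewrite sqrtr_gt0 divr_gt0.
  have e0 : 0 < c' / 4 * Num.sqrt (cr / 2) / (C6 + 1).
    by apply: divr_gt0; [rewrite mulr_gt0// divr_gt0|rewrite ltr_wpDl].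
  have [p hp] := exp_small rh0 rh1 e0.
  exists (maxn p (Num.bound h0)); split.
    rewrite ler_pdivrMr//.
    have := hp _ (leq_maxl p (Num.bound h0)).
    rewrite ler_pdivlMr ?ltr_wpDl//.
    have : 0 <= rh ^+ maxn p (Num.bound h0) by rewrite exprn_ge0.
    set x := rh ^+ _; lra.
  apply: (le_trans (ltW (archi_boundP (ltW h00)))); rewrite -natrX ler_nat.
  apply: (leq_trans (leq_maxr p _)); exact: ltnW (ltn_expl _ _).
pose T0 : R := 2 ^+ p0.
have T00 : 0 < T0 by exact: exprn_gt0.
have T01 : 1 <= T0 by rewrite exprn_ege1// ler1n.
pose h := h0 / T0.
have hp0 : 0 < h by rewrite divr_gt0.
have h1 : h <= 1 by rewrite ler_pdivrMr// mul1r.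
pose L := (Num.truncn (R2 / h)).+1.
have R2h : 0 <= R2 / h by rewrite divr_ge0 ?(ltW hp0)//; lra.
have /andP[L1 L2] := truncn_itv R2h.
have RL : R2 < L%:R * h by rewrite -ltr_pdivrMr.
have LT : L%:R <= c2 * T0.
  rewrite /L -natr1; apply: (le_trans (lerD L1 (lexx 1))).
  have -> : R2 / h = R2 / h0 * T0 by rewrite /h; field; rewrite !lt0r_neq0.
  rewrite /c2 mulrDl lerD2l; lra.
(* Within this radius r' stays away from 0 and in the admissible range, and the average of order
   2^p0 drops by at most c'/4. *)
pose kp := Num.min (Num.min (cr / 2) 1) (c' * (Lam * eta) / (64 * T0 ^+ 2)).
have kp0 : 0 < kp.
  have T2 : 0 < 64 * T0 ^+ 2 by rewrite mulr_gt0// exprn_gt0.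
  by rewrite !lt_min (divr_gt0 cr0)// ltr01 (divr_gt0 _ T2)// mulr_gt0.
have kp1 : kp <= cr / 2 by rewrite /kp !ge_min lexx.
have kp2 : kp <= 1 by rewrite /kp !ge_min lexx orbT.
have kp3 : 16 * T0 ^+ 2 * (kp / (Lam * eta)) <= c' / 4.
  have T2 : 0 < T0 ^+ 2 by rewrite exprn_gt0.
  have : kp <= c' * (Lam * eta) / (64 * T0 ^+ 2) by rewrite /kp !ge_min lexx !orbT.
  rewrite ler_pdivlMr ?mulr_gt0// => hk.
  rewrite mulrA ler_pdivrMr//; lra.
exists [seq grid_value h x | x <- [seq (s, m) | s <- [:: true; false], m <- iota 0 L]], kp.
split=> // gp gp0.
pose LB := (Lam * B) ^+ 2 / gp ^+ 2.
have LB0 : 0 <= LB by rewrite divr_ge0 ?sqr_ge0.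
exists (c0 + p0 + Num.bound (4 * LB / c'))%N => n nn c I J w v X g data mw gR.
pose N K r := fejer_sum n lam c w v X g K r.
(* Comparison with order 1, whose kernel is constantly 1. *)
have small r : r != 0 -> `|r| <= R2 + 2 -> N (2 ^ p0)%N r <= C7 / Num.sqrt `|r|.
  move=> r0 rR.
  have pn : (p0 + c0 <= n)%N by apply: leq_trans nn; rewrite [(p0 + c0)%N]addnC leq_addr.
  have := diff n p0 0 c I J w v X g r data (leq0n _) pn r0 rR.
  rewrite expr0 mulr1 expn0 => hd.
  have := fejer_sum1 data r.
  have := le_trans (ler_norm _) hd; rewrite -/(N _ _) -/(N _ _) => hd1 hd2.
  have rp : 0 < `|r| by rewrite normr_gt0.
  have s0 : 0 < Num.sqrt `|r| by rewrite sqrtr_gt0.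
  have : 1 <= Num.sqrt (R2 + 2) / Num.sqrt `|r|.
    by rewrite ler_pdivlMr// mul1r ler_sqrt//; lra.
  by move: hd1 hd2; rewrite /C7 mulrDl -/(N 1 r); set x := N _ _; set y := N _ _; lra.
pose Lc := Num.truncn (c1 * T0).
have /andP[Lc1 Lc2] : Lc%:R <= c1 * T0 < Lc.+1%:R.
  by apply: truncn_itv; rewrite mulr_ge0// ltW.
have gv_le (x : bool * 'I_L) : `|grid_value h (x.1, x.2 : nat)| <= R2 + 1.
  rewrite grid_value_norm//= mulrDl.
  have : x.2%:R <= R2 / h.
    by apply: le_trans L1; rewrite ler_nat -ltnS.
  by rewrite ler_pdivlMr//; lra.
have gv0 (x : bool * 'I_L) : grid_value h (x.1, x.2 : nat) != 0.
  rewrite -normr_gt0 grid_value_norm//= mulr_gt0// ltr_wpDl// invr_gt0//.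
(* Otherwise the grid total would be at most (1/8 + 1/16) T0 m0, below the guaranteed T0 m0 / 4. *)
have [x xc xN] : exists2 x : bool * 'I_L, (Lc <= x.2)%N &
    c' <= N (2 ^ p0)%N (grid_value h (x.1, x.2 : nat)).
  apply: contrapT => none.
  have low (x : bool * 'I_L) : (Lc <= x.2)%N -> N (2 ^ p0)%N (grid_value h (x.1, x.2 : nat)) <= c'.
    by move=> xL; rewrite leNgt; apply/negP => xN; apply: none; exists x => //; exact: ltW.
  have hK : h <= Lam * eta / (8 * (2 ^ p0)%:R).
    by rewrite natrX -/T0 /h /h0 invfM mulrA.
  have K0 : (0 < 2 ^ p0)%N by rewrite expn_gt0.
  have := fejer_sum_grid eta0 data gR hp0 K0 RL hK.
  rewrite natrX -/T0 -/(N _ _) leNgt => /negP; apply.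
  rewrite (bigID (fun x : bool * 'I_L => (Lc <= x.2)%N)) /=.
  have hs0 : 0 < Num.sqrt (h / 2) by rewrite sqrtr_gt0 divr_gt0.
  have bigp : \sum_(x : bool * 'I_L | (Lc <= x.2)%N) N (2 ^ p0)%N (grid_value h (x.1, x.2 : nat))
     <= T0 * m0 / 8.
    apply: (@le_trans _ _ (\sum_(x : bool * 'I_L) c')).
      rewrite big_mkcond; apply: ler_sum => x _; case: ifPn => [/low//|_].
      exact: ltW.
    rewrite sumr_const card_prod card_bool card_ord -[leLHS]mulr_natl natrM.
    apply: (@le_trans _ _ (2 * (c2 * T0) * c')).
      by rewrite ler_wpM2r ?(ltW c'0)// ler_wpM2l.
    by rewrite /c' le_eqVlt; apply/orP; left; apply/eqP; field; rewrite lt0r_neq0.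
  have smallp : \sum_(x : bool * 'I_L | ~~ (Lc <= x.2)%N) N (2 ^ p0)%N (grid_value h (x.1, x.2 : nat))
     <= T0 * m0 / 16.
    pose bnd (m : nat) := C7 / Num.sqrt (h / 2) / Num.sqrt (m.+1%:R).
    have bnd0 m : 0 <= bnd m.
      by rewrite /bnd !divr_ge0 ?sqrtr_ge0// ltW.
    apply: (@le_trans _ _ (\sum_(x : bool * 'I_Lc) bnd x.2)); last first.
      rewrite -(pair_bigA _ (fun (s : bool) (m : 'I_Lc) => bnd m)) /=.
      rewrite sumr_const card_bool -[leLHS]mulr_natl -mulr_sumr.
      apply: (@le_trans _ _ (2 * (C7 / Num.sqrt (h / 2) * (2 * Num.sqrt Lc%:R)))).
        rewrite ler_wpM2l// ler_wpM2l ?sum_invsqrt_le//.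
        by rewrite divr_ge0 ?sqrtr_ge0// ltW.
      have e1 : Num.sqrt Lc%:R <= T0 * (m0 / (64 * C7)) * Num.sqrt (h / 2).
        have q0 : 0 <= T0 * (m0 / (64 * C7)) by rewrite mulr_ge0 ?(ltW T00)// divr_ge0 ?(ltW m00)// mulr_ge0// ltW.
        rewrite -[X in X * Num.sqrt _]ger0_norm// -sqrtr_sqr -sqrtrM ?sqr_ge0//.
        rewrite ler_wsqrtr//; apply: (le_trans Lc1).
        by rewrite /c1 /h le_eqVlt; apply/orP; left; apply/eqP; field; rewrite !lt0r_neq0.
      apply: (@le_trans _ _ (2 * (C7 / Num.sqrt (h / 2) * (2 * (T0 * (m0 / (64 * C7)) * Num.sqrt (h / 2)))))).
        rewrite ler_wpM2l// ler_wpM2l ?ler_wpM2l// divr_ge0 ?sqrtr_ge0// ltW//.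
      by rewrite le_eqVlt; apply/orP; left; apply/eqP; field; rewrite !lt0r_neq0.
    apply: (@le_trans _ _ (\sum_(x : bool * 'I_L | ~~ (Lc <= x.2)%N) bnd x.2)).
      apply: ler_sum => x _; apply: (le_trans (small _ (gv0 x) _)).
        by apply: (le_trans (gv_le x)); lra.
      rewrite /bnd -mulrA -invfM ler_wpM2l ?(ltW C70)// grid_value_norm//=.
      have q0 : 0 <= h / 2 by rewrite ltW// divr_gt0.
      rewrite -sqrtrM//.
      have q1 : 0 < h / 2 * (x.2).+1%:R by rewrite mulr_gt0// divr_gt0.
      have q2 : 0 < (x.2%:R + 2^-1) * h by rewrite mulr_gt0// ltr_wpDl// invr_gt0.
      rewrite lef_pV2 ?posrE ?sqrtr_gt0//.
      rewrite ler_wsqrtr// -[(x.2).+1%:R]natr1; have := ler0n R x.2; move: (x.2%:R : R) => y y0.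
      by have := mulr_ge0 y0 (ltW hp0); lra.
    apply: (@le_trans _ _ (\sum_(s : bool) \sum_(m < L | (m < Lc)%N) bnd m)).
      rewrite [leRHS]pair_big_dep /= le_eqVlt; apply/orP; left; apply/eqP.
      by apply: eq_bigl => x; rewrite -ltnNge.
    rewrite -(pair_bigA _ (fun (s : bool) (m : 'I_Lc) => bnd m)) /=.
    by apply: ler_sum => s _; exact: sum_ord_lt_le.
  have Tm : T0 / 4 * m0 <= T0 / 4 * \sum_i w i by rewrite ler_wpM2l// divr_ge0// ltW.
  have Tm0 : 0 < T0 * m0 by exact: mulr_gt0.
  lra.
set r := grid_value h (x.1, x.2 : nat) in xN.
have rR : `|r| <= R2 + 1 by exact: gv_le.
have rc : cr <= `|r|.
  rewrite grid_value_norm//= /cr.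
  (* m + 1/2 >= (m + 1)/2; the half-integers matter when [Lc] is 0. *)
  have hx : c1 * T0 / 2 <= x.2%:R + 2^-1.
    have : (Lc%:R : R) <= x.2%:R by rewrite ler_nat.
    have := ler0n R x.2; move: Lc2; rewrite -[Lc.+1%:R]natr1; lra.
  apply: le_trans (ler_wpM2r (ltW hp0) hx).
  by rewrite /h le_eqVlt; apply/orP; left; apply/eqP; field; rewrite lt0r_neq0.
exists r.
  have mL : (x.2 : nat) \in iota 0 L by rewrite mem_iota add0n; exact: ltn_ord.
  have sb : x.1 \in [:: true; false] by case: (x.1).
  by apply: map_f; apply/allpairsP; exists (x.1, x.2 : nat); split.
move=> r' hr'.
apply: contrapT => none.
have far i j : gp <= `|grid_dot n X g i j - r'|.
  by rewrite leNgt; apply/negP => hh; apply: none; exists i, j.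
have r'R : `|r'| <= R2 + 2.
  by have := ler_normD r (r' - r); rewrite addrC subrK; lra.
have r'c : cr / 2 <= `|r'|.
  have := lerB_dist r (r - r'); rewrite (_ : r - (r - r') = r'); last by ring.
  by move: hr'; rewrite distrC; lra.
have r'0 : r' != 0 by rewrite -normr_gt0; lra.
(* The highest order allowed at scale n. At r' it still has average at least c'/2, but a gap of size
   gp would force it below c'/4. *)
pose p := (n - c0)%N.
have np : (c0 <= n)%N by apply: leq_trans nn; rewrite -addnA leq_addr.
have pp : (p0 <= p)%N.
  rewrite leq_subRL//; apply: leq_trans nn; exact: leq_addr.
have pn : (p + c0 <= n)%N by rewrite subnK.
have lo1 : c' <= N (2 ^ p0)%N r' + c' / 4.
  have K0 : (0 < 2 ^ p0)%N by rewrite expn_gt0.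
  apply: (le_trans xN); apply: (le_trans (fejer_sum_lip eta0 data r r' K0)).
  rewrite -/(N _ _) lerD2l natrX -/T0 -/Lam.
  have T20 : 0 <= 16 * T0 ^+ 2 by rewrite mulr_ge0// sqr_ge0.
  apply: le_trans kp3; rewrite ler_wpM2l//.
  by rewrite ler_wpM2r ?invr_ge0 ?(ltW LE)// distrC.
have lo2 : N (2 ^ p0)%N r' <= N (2 ^ p)%N r' + c' / 4.
  have := diff n p p0 c I J w v X g r' data pp pn r'0 r'R.
  rewrite -/(N _ _) -/(N _ _) distrC => /(le_trans (ler_norm _)) hd.
  have : C6 * rh ^+ p0 / Num.sqrt `|r'| <= c' / 4.
    have Cr : 0 <= C6 * rh ^+ p0 by rewrite mulr_ge0// exprn_ge0.
    have cr2 : 0 < cr / 2 by rewrite divr_gt0.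
    apply: le_trans hp1; rewrite ler_wpM2l//.
    rewrite lef_pV2 ?posrE ?sqrtr_gt0 ?(lt_le_trans cr2 r'c)//.
    by rewrite ler_wsqrtr.
  lra.
have K0 : (0 < 2 ^ p)%N by rewrite expn_gt0.
have up := fejer_sum_far B1 eta0 R21 lamR data gR gp0 K0 r'R far.
have : N (2 ^ p)%N r' <= c' / 4.
  apply: (le_trans up).
  rewrite natrX -/Lam invfM mulrCA -/LB mulrC ler_pdivrMr ?exprn_gt0//.
  have pb : (Num.bound (4 * LB / c') <= 2 ^ p)%N.
    apply: leq_trans (ltnW (ltn_expl p (ltnSn 1))).
    by rewrite leq_subRL//; apply: leq_trans nn; rewrite leq_add2r leq_addr.
  have b0 : 0 <= 4 * LB / c' by rewrite divr_ge0 ?(ltW c'0)// mulr_ge0.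
  have : 4 * LB / c' <= 2 ^+ p.
    by apply: (le_trans (ltW (archi_boundP b0))); rewrite -natrX ler_nat.
  rewrite ler_pdivrMr//; lra.
lra.
Qed.

(** * Frostman measures *)

Section HausdorffContent.
Variables (R : realType) (d : nat).
Local Notation V := 'rV[R]_d.

Lemma cover_cost_ge0 (s : R) (U : set V) : 0 <= cover_cost s U.
Proof. by rewrite /cover_cost; case: ifP => // _; exact: powR_ge0. Qed.

Lemma hausdorff_delta_ge0 (s delta : R) (E : set V) :
  (0 <= hausdorff_delta s delta E)%E.
Proof.
apply: le_ereal_inf_tmp => _ [U _ <-]; apply: nneseries_ge0 => i _ _.
by rewrite lee_fin cover_cost_ge0.
Qed.

(** For s strictly between s0 and the dimension the s-dimensional measure is not 0, so some
    delta-premeasure is positive. It may be infinite, hence the real lower bound [c]. *)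
Lemma hausdorff_content_pos (E : set V) (s0 : R) : 0 <= s0 ->
  (s0%:E < hausdorff_dim E)%E ->
  exists s, s0 < s /\ exists delta c : R, [/\ 0 < delta, 0 < c &
    forall U : nat -> set V, E `<=` \bigcup_i U i ->
      (forall i, (ediam (U i) <= delta%:E)%E) ->
      (c%:E <= \sum_(0 <= i <oo) (cover_cost s (U i))%:E)%E].
Proof.
move=> s00 dimE.
have [s [s0s sdim]] : exists s, s0 < s /\ (s%:E < hausdorff_dim E)%E.
  move: dimE; case: (hausdorff_dim E) => [x| |//].
    rewrite lte_fin => sx; exists ((s0 + x) / 2); rewrite lte_fin; split; lra.
  by move=> _; exists (s0 + 1); rewrite ltry; split => //; lra.
exists s; split => //.
have Hs : hausdorff_measure s E != 0%E.
  apply/eqP => Hs; move: sdim; rewrite ltNge => /negP; apply.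
  by apply: ereal_inf_lbound; exists s => //; split=> //; lra.
have Hs0 : (0 < hausdorff_measure s E)%E.
  rewrite lt_neqAle eq_sym Hs /=.
  apply: (le_trans (hausdorff_delta_ge0 s 1 E)).
  by apply: ereal_sup_ubound; exists 1 => //; exact: ltr01.
have [_ [delta delta0 <-] dE] := ereal_sup_gt Hs0.
have [c [c0 cE]] : exists c : R, 0 < c /\ (c%:E <= hausdorff_delta s delta E)%E.
  move: dE; case: (hausdorff_delta s delta E) => [x| |//].
    by rewrite lte_fin => x0; exists x.
  by move=> _; exists 1; rewrite leey.
exists delta, c; split => // U EU dU; apply: (le_trans cE).
by apply: ereal_inf_lbound; exists U.
Qed.

(** The half-open dyadic cube of side 2^-k containing x, coded by the integer coordinates of its
    lower corner; the cubes of all levels form a tree. *)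
Definition cell (k : nat) (x : V) : {ffun 'I_d -> int} :=
  [ffun t => Num.floor (2 ^+ k * x ord0 t)].

Lemma floor_double (a b : R) : Num.floor (2 * a) = Num.floor (2 * b) ->
  Num.floor a = Num.floor b.
Proof.
have key (x : R) : Num.floor (2 * x) = 2 * Num.floor x \/
    Num.floor (2 * x) = 2 * Num.floor x + 1.
  have /andP[x1 x2] := floor_itv x; set p := Num.floor x in x1 x2 *.
  rewrite intrD in x2.
  have [h|h] := ltP x (p%:~R + 2^-1).
    by left; apply: floor_def; rewrite !intrD !intrM; apply/andP; split; lra.
  by right; apply: floor_def; rewrite !intrD !intrM; apply/andP; split; lra.
by case: (key a) => ->; case: (key b) => ->; lia.
Qed.

Lemma cell_coarser j k x y : (j <= k)%N -> cell k x = cell k y -> cell j x = cell j y.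
Proof.
move=> jk; rewrite -(subnK jk); elim: (k - j)%N => [|m IH]; first by [].
move=> /ffunP E; apply: IH; apply/ffunP => t; have := E t.
by rewrite !ffunE addSn exprS -!mulrA => /floor_double.
Qed.

Lemma cell_dist k x y t : cell k x = cell k y ->
  `|x ord0 t - y ord0 t| <= 2 ^- k.
Proof.
move=> /ffunP /(_ t); rewrite !ffunE => e.
have /andP[x1 x2] := floor_itv (2 ^+ k * x ord0 t).
have /andP[y1 y2] := floor_itv (2 ^+ k * y ord0 t).
rewrite e in x1 x2; rewrite !intrD in x2 y2.
have p0 : (0 : R) < 2 ^+ k by exact: exprn_gt0.
rewrite -[leRHS]mul1r ler_pdivlMr// -[X in _ * X](gtr0_norm p0) -normrM mulrBl.
rewrite ler_norml; apply/andP; split; lra.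
Qed.

Lemma edist_cell k x y : (0 < d)%N -> cell k x = cell k y ->
  Defs.edist x y <= d%:R * 2 ^- k.
Proof.
move=> d0 E; rewrite /Defs.edist.
have p0 : (0 : R) <= d%:R * 2 ^- k by rewrite mulr_ge0// invr_ge0 exprn_ge0.
rewrite -[leRHS](ger0_norm p0) -sqrtr_sqr ler_wsqrtr// /dotv.
apply: (@le_trans _ _ (\sum_(t < d) (2 ^- k) ^+ 2)).
  apply: ler_sum => t _; rewrite !mxE -expr2 -[leLHS]real_normK ?num_real//.
  by rewrite ler_sqr ?nnegrE ?invr_ge0 ?exprn_ge0//; exact: cell_dist.
rewrite sumr_const card_ord -[leLHS]mulr_natl exprMn ler_wpM2r ?sqr_ge0//.
by rewrite expr2 ler_peMl// ler1n.
Qed.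

Lemma cover_cost_cell (s : R) k ce : (0 < d)%N -> 0 <= s ->
  (ediam [set x | cell k x = ce] <= (d%:R * 2 ^- k)%:E)%E /\
  cover_cost s [set x | cell k x = ce] <= d%:R `^ s * pw2 (- (s * k%:R)).
Proof.
move=> d0 s0.
have dm : (ediam [set x | cell k x = ce] <= (d%:R * 2 ^- k)%:E)%E.
  apply: ge_ereal_sup => _ [x xc] [y yc] <-; rewrite lee_fin.
  by apply: edist_cell => //; rewrite xc yc.
split => //; rewrite /cover_cost; case: ifPn => [_|/asboolP ne].
  by rewrite mulr_ge0 ?powR_ge0 ?pw2_ge0.
have [x xc] : [set x | cell k x = ce] !=set0 by apply/set0P/eqP.
have dm0 : (0 <= ediam [set x | cell k x = ce])%E.
  apply: (@le_trans _ _ (Defs.edist x x)%:E); first by rewrite lee_fin sqrtr_ge0.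
  by apply: ereal_sup_ubound; exists x => //; exists x.
have -> : d%:R `^ s * pw2 (- (s * k%:R)) = (d%:R * 2 ^- k) `^ s :> R.
  rewrite powRM// ?invr_ge0 ?exprn_ge0//; congr (_ * _).
  by rewrite -pw2_nat -pw2N -pw2M mulNr mulrC.
have p0 : (0 : R) <= d%:R * 2 ^- k by rewrite mulr_ge0// invr_ge0 exprn_ge0.
apply: ge0_ler_powR => //; rewrite ?nnegrE ?fine_ge0//.
rewrite -[leRHS]/(fine (d%:R * 2 ^- k)%:E); apply: fine_le => //.
rewrite ge0_fin_numE//; exact: le_lt_trans dm (ltry _).
Qed.

Lemma diam_set0 : (ediam (set0 : set V) = -oo)%E.
Proof.
apply/eqP; rewrite -leeNy_eq; apply: ge_ereal_sup => _ [x []].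
Qed.

(** The finite cover is continued by empty sets, whose diameter is -oo and whose cost is 0. *)
Lemma finite_cell_cover (E : set V) (s delta c : R) (k0 : nat)
    (Cv : seq (nat * {ffun 'I_d -> int})) : (0 < d)%N -> 0 <= s ->
  (forall U : nat -> set V, E `<=` \bigcup_i U i ->
      (forall i, (ediam (U i) <= delta%:E)%E) ->
      (c%:E <= \sum_(0 <= i <oo) (cover_cost s (U i))%:E)%E) ->
  d%:R * 2 ^- k0 <= delta ->
  (forall p, p \in Cv -> (k0 <= p.1)%N) ->
  (forall x, E x -> exists2 p, p \in Cv & cell p.1 x = p.2) ->
  c <= d%:R `^ s * \sum_(p <- Cv) pw2 (- (s * p.1%:R)).
Proof.
move=> d0 s0 HC dk Ck CE.
pose p0 := (0%N, [ffun=> 0] : {ffun 'I_d -> int}).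
pose U i : set V := if (i < size Cv)%N then [set x | cell (nth p0 Cv i).1 x = (nth p0 Cv i).2] else set0.
have := HC U; set S := (\sum_(0 <= i <oo) _)%E.
have -> : (S = (\sum_(0 <= i < size Cv) cover_cost s (U i))%:E)%E.
  rewrite /S (@nneseries_split _ _ 0 (size Cv)); last by move=> *; rewrite lee_fin cover_cost_ge0.
  rewrite add0n [X in (_ + X)%E]eseries0; first by rewrite adde0 sumEFin.
  move=> i si _; rewrite /U ltnNge si /= /cover_cost.
  by case: ifPn => // /asboolP.
rewrite lee_fin => H; apply: le_trans (H _ _) _.
- move=> x /CE [p pC xp]; exists (index p Cv) => //.
  by rewrite /U index_mem pC nth_index.
- move=> i; rewrite /U; case: ifPn => [iC|_]; last by rewrite diam_set0 leNye.
  have [dm _] := @cover_cost_cell s (nth p0 Cv i).1 (nth p0 Cv i).2 d0 s0.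
  apply: (le_trans dm); rewrite lee_fin; apply: le_trans dk.
  rewrite ler_wpM2l// lef_pV2 ?posrE ?exprn_gt0// ler_eXn2l ?ltr1n//.
  by apply: Ck; exact: mem_nth.
- rewrite mulr_sumr (big_nth p0).
  apply: ler_sum_nat => i /andP[_ iC]; rewrite /U iC.
  by have [] := @cover_cost_cell s (nth p0 Cv i).1 (nth p0 Cv i).2 d0 s0.
Qed.

End HausdorffContent.

(** * Flows and cuts on the tree of dyadic cubes *)

Section FrostmanTree.
Variables (R : realType) (d : nat) (E : set 'rV[R]_d) (s : R) (n : nat).
Local Notation V := 'rV[R]_d.
Local Notation cellT := {ffun 'I_d -> int}.
Hypothesis s0 : 0 <= s.

Let cap (k : nat) : R := pw2 (- (s * k%:R)).

Definition wmass (L : seq (R * V)) (P : pred V) : R := \sum_(a <- L | P a.2) a.1.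

(* Max-flow/min-cut on the dyadic tree: a measure on the points of [E] in [A]
   and a cover of these points whose cost equals the total mass. *)
Definition frost (k : nat) (A : V -> Prop) (m : R) : Prop :=
  (exists L : seq (R * V),
    [/\ forall a, a \in L -> [/\ 0 <= a.1, E a.2 & A a.2],
        wmass L xpredT = m &
        forall j xi, (k <= j <= n)%N -> wmass L (fun x => cell j x == xi) <= cap j]) /\
  (exists Cv : seq (nat * cellT),
    [/\ forall p, p \in Cv -> (k <= p.1)%N,
        forall x, E x -> A x -> exists2 p, p \in Cv & cell p.1 x = p.2 &
        \sum_(p <- Cv) cap p.1 = m]).

Lemma cap_gt0 k : 0 < cap k. Proof. exact: pw2_gt0. Qed.

Lemma frost_ext k A B m : (forall x, E x -> (A x <-> B x)) ->
  frost k A m -> frost k B m.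
Proof.
move=> AB [[L [L1 L2 L3]] [Cv [C1 C2 C3]]]; split.
  by exists L; split => // a /L1 [a1 Ea /(AB _ Ea)].
by exists Cv; split => // x Ex /(AB _ Ex); exact: C2.
Qed.

Lemma frost_empty k (A : V -> Prop) : (forall x, E x -> ~ A x) -> frost k A 0.
Proof.
move=> noA; split.
  exists [::]; split => //; first by rewrite /wmass big_nil.
  by move=> j xi _; rewrite /wmass big_nil ltW// cap_gt0.
by exists [::]; split => //; [move=> x /noA|rewrite big_nil].
Qed.

Lemma wmass_cat (L L' : seq (R * V)) P : wmass (L ++ L') P = wmass L P + wmass L' P.
Proof. by rewrite /wmass big_cat. Qed.

Lemma wmass_cell_disjoint (L : seq (R * V)) j xi :
  (forall a, a \in L -> cell j a.2 != xi) -> wmass L (fun x => cell j x == xi) = 0.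
Proof.
move=> h; rewrite /wmass big_seq_cond big1// => a /andP[aL ax].
by have := h a aL; rewrite ax.
Qed.

(** Measures and covers are both added. The capacities survive because a cell of level at least k
    lies in one cell of level k and so meets only one of the two parts. *)
Lemma frost_merge k A B m m' : frost k A m -> frost k B m' ->
  (forall x y, A x -> B y -> cell k x <> cell k y) ->
  frost k (fun x => A x \/ B x) (m + m').
Proof.
move=> [[L [L1 L2 L3]] [Cv [C1 C2 C3]]] [[L' [L1' L2' L3']] [Cv' [C1' C2' C3']]] AB.
split; last first.
  exists (Cv ++ Cv'); split; last by rewrite big_cat C3 C3'.
    by move=> p; rewrite mem_cat => /orP[/C1|/C1'].
  move=> x Ex [Ax|Bx].
    by have [p pC xp] := C2 x Ex Ax; exists p => //; rewrite mem_cat pC.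
  by have [p pC xp] := C2' x Ex Bx; exists p => //; rewrite mem_cat pC orbT.
exists (L ++ L'); split.
- by move=> a; rewrite mem_cat => /orP[/L1|/L1'] [? ? ?]; split => //; [left|right].
- by rewrite wmass_cat L2 L2'.
move=> j xi /andP[kj jn].
rewrite wmass_cat.
have [/hasP[a aL /eqP ax]|/hasPn nL] := boolP (has (fun a => cell j a.2 == xi) L).
  rewrite (@wmass_cell_disjoint L') ?addr0; first by rewrite L3// kj.
  move=> b bL; apply/eqP => bx.
  have [_ _ Aa] := L1 a aL; have [_ _ Bb] := L1' b bL.
  by apply: (AB _ _ Aa Bb); apply: (cell_coarser kj); rewrite ax bx.
by rewrite (@wmass_cell_disjoint L)// add0r L3'// kj.
Qed.

Lemma frost_seq k (S : seq cellT) : uniq S ->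
  (forall xi, exists m, frost k (fun x => cell k x = xi) m) ->
  exists m, frost k (fun x => cell k x \in S) m.
Proof.
move=> + H; elim: S => [_|xi S IH /= /andP[xiS uS]].
  by exists 0; apply: frost_empty.
have [m1 h1] := H xi; have [m2 h2] := IH uS.
exists (m1 + m2); apply: frost_ext (frost_merge h1 h2 _).
  move=> x _; rewrite inE; split; first by case=> [->|->]; rewrite ?eqxx ?orbT.
  by case/orP => [/eqP|]; [left|right].
by move=> x y xxi yS xy; move: xiS; rewrite -xxi xy yS.
Qed.

Lemma wmass_le (L : seq (R * V)) (P : pred V) :
  (forall a, a \in L -> 0 <= a.1) -> wmass L P <= wmass L xpredT.
Proof.
move=> h; rewrite /wmass big_mkcond big_seq [leRHS]big_seq; apply: ler_sum => a aL.
by case: ifP => // _; exact: h.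
Qed.

(** If the mass exceeds the capacity of the parent cell, the measure is scaled down to that capacity
    and the cover is replaced by the parent alone; mass and cost stay equal. *)
Lemma frost_cap k zeta m : frost k.+1 (fun x => cell k x = zeta) m ->
  exists m', frost k (fun x => cell k x = zeta) m'.
Proof.
move=> [[L [L1 L2 L3]] [Cv [C1 C2 C3]]].
have Lp a : a \in L -> 0 <= a.1 by case/L1.
have c0 := cap_gt0 k.
have [mc|mc] := leP m (cap k).
  exists m; split; last by exists Cv; split => // p /C1 /ltnW.
  exists L; split => // j xi /andP[kj jn].
  move: kj; rewrite leq_eqVlt => /predU1P[<-|kj]; last by rewrite L3// kj.
  by apply: le_trans mc; rewrite -L2; exact: wmass_le.
have m0 : 0 < m by exact: lt_trans mc.
have q0 : 0 <= cap k / m by rewrite divr_ge0 ?ltW.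
have q1 : cap k / m <= 1 by rewrite ler_pdivrMr// mul1r ltW.
exists (cap k); split; last first.
  exists [:: (k, zeta)]; split; last by rewrite big_seq1.
    by move=> p; rewrite inE => /eqP ->.
  by move=> x Ex xz; exists (k, zeta); rewrite ?inE.
have scale P : wmass [seq (a.1 * (cap k / m), a.2) | a <- L] P = wmass L P * (cap k / m).
  by rewrite /wmass big_map /= mulr_suml.
have tot : wmass [seq (a.1 * (cap k / m), a.2) | a <- L] xpredT = cap k.
  by rewrite scale L2 mulrC divfK// gt_eqF.
have pos a : a \in [seq (a.1 * (cap k / m), a.2) | a <- L] ->
    [/\ 0 <= a.1, E a.2 & cell k a.2 = zeta].
  by move=> /mapP[b /L1 [b1 Eb Ab] ->]; split => //=; exact: mulr_ge0.
exists [seq (a.1 * (cap k / m), a.2) | a <- L]; split => //.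
move=> j xi /andP[kj jn].
move: kj; rewrite leq_eqVlt => /predU1P[<-|kj].
  by rewrite -[leRHS]tot; apply: wmass_le => a /pos[].
rewrite scale; apply: (@le_trans _ _ (cap j * 1)); last by rewrite mulr1.
apply: ler_pM => //; last by rewrite L3// kj.
by rewrite /wmass big_seq_cond; apply: sumr_ge0 => a /andP[/Lp].
Qed.

Lemma frost_leaf xi : exists m, frost n (fun x => cell n x = xi) m.
Proof.
have [[x [Ex xxi]]|none] := pselect (exists x, E x /\ cell n x = xi).
  exists (cap n); split.
    exists [:: (cap n, x)]; split.
    - by move=> a; rewrite inE => /eqP -> /=; split => //; rewrite ltW// cap_gt0.
    - by rewrite /wmass big_seq1.
    - move=> j zeta /andP[nj jn].
      have -> : j = n by apply/eqP; rewrite eqn_leq jn nj.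
      rewrite /wmass big_cons big_nil /=; case: ifP => _; first by rewrite addr0.
      by rewrite ltW// cap_gt0.
  exists [:: (n, xi)]; split; last by rewrite big_seq1.
    by move=> p; rewrite inE => /eqP ->.
  by move=> y Ey yxi; exists (n, xi); rewrite ?inE.
exists 0; apply: frost_empty => x Ex xxi; apply: none.
by exists x.
Qed.

Definition children (zeta : cellT) : seq cellT :=
  undup [seq [ffun t => 2 * zeta t + (b t : nat)%:Z] | b : {ffun 'I_d -> bool}].

Lemma cell_children k (x : V) zeta : cell k x = zeta <-> cell k.+1 x \in children zeta.
Proof.
have key t : cell k.+1 x t = 2 * cell k x t \/ cell k.+1 x t = 2 * cell k x t + 1.
  rewrite !ffunE exprS -mulrA; set y := _ * x _ _.
  have /andP[x1 x2] := floor_itv y; set p := Num.floor y in x1 x2 *.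
  rewrite intrD in x2.
  have [h|h] := ltP y (p%:~R + 2^-1).
    by left; apply: floor_def; rewrite !intrD !intrM; apply/andP; split; lra.
  by right; apply: floor_def; rewrite !intrD !intrM; apply/andP; split; lra.
rewrite mem_undup; move: key; move: (cell k.+1 x) (cell k x) => c1 c0 key; split.
  move=> <-; apply/mapP.
  exists [ffun t => c1 t != 2 * c0 t]; first by rewrite mem_enum.
  apply/ffunP => t; rewrite !ffunE.
  case: (key t) => ->; first by rewrite eqxx addr0.
  by have -> : 2 * c0 t + 1 != 2 * c0 t by apply/eqP; lia.
move=> /mapP[b _ /ffunP E']; apply/ffunP => t.
by have := E' t; rewrite ffunE; case: (key t) => ->; case: (b t) => /=; lia.
Qed.

(** Induction from the leaves at level n upwards: merge the children, then impose the capacity of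
    the parent. *)
Lemma frost_tree k xi : (k <= n)%N -> exists m, frost k (fun x => cell k x = xi) m.
Proof.
move=> kn; rewrite -(subKn kn); elim: (n - k)%N (leq_subr k n) xi => [_|t IH tn] xi.
  by rewrite subn0; exact: frost_leaf.
have E' : (n - t = (n - t.+1).+1)%N by rewrite subnSK.
have IH' := IH (ltnW tn); rewrite E' in IH'.
have [m hm] := frost_seq (undup_uniq _ : uniq (children xi)) IH'.
apply: (@frost_cap _ _ m); apply: frost_ext hm => x _.
by have [h1 h2] := cell_children (n - t.+1) x xi; split.
Qed.

End FrostmanTree.

Lemma int_in_box (p q : int) : - q <= p -> p <= q ->
  (0 <= p + (absz q).+1%:Z) && (absz (p + (absz q).+1%:Z)%R < 2 * (absz q).+1)%N.
Proof. lia. Qed.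

(** * Frostman's lemma at a finite scale *)

Section Frostman.
Variables (R : realType) (d : nat).
Local Notation V := 'rV[R]_d.

Lemma coord_le_norm (x : V) t : `|x ord0 t| <= `|x|.
Proof.
rewrite /Num.norm /= mx_normrE.
exact: (le_bigmax _ (fun i : 'I_1 * 'I_d => `|x i.1 i.2|) (ord0, t)).
Qed.

Lemma compact_coord_bounded (E : set V) : compact E ->
  exists2 B : R, 1 <= B & forall x, E x -> forall t, `|x ord0 t| <= B.
Proof.
move=> /compact_bounded [M [_ hM]].
exists (Num.max 1 (M + 1)); first by rewrite le_max lexx.
move=> x Ex t; apply: (le_trans (coord_le_norm x t)).
by apply: hM => //; rewrite lt_max; apply/orP; right; rewrite ltrDl.
Qed.

(** The number of atoms may be any large [N], so that several sets can share one index type. *)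
Lemma frostman (E : set V) (s0 : R) : (0 < d)%N -> compact E -> 0 <= s0 ->
  (s0%:E < hausdorff_dim E)%E ->
  exists2 s, s0 < s & exists C : R, forall n, exists N0, forall N, (N0 <= N)%N ->
    exists (w : nat -> R) (x : nat -> V),
    [/\ forall i, 0 <= w i, forall i, E (x i), \sum_(i < N) w i = 1 &
      forall k xi, (k <= n)%N ->
        \sum_(i < N | cell k (x i) == xi) w i <= C * pw2 (- (s * k%:R))].
Proof.
move=> d0 cE s00 dimE.
have [s [ss0 [delta [c [delta0 c0 cov]]]]] := hausdorff_content_pos s00 dimE.
have s_ge0 : 0 <= s by lra.
have [B B1 EB] := compact_coord_bounded cE.
have [k0 hk0] : exists k0 : nat, d%:R * 2 ^- k0 <= delta.
  exists (Num.bound (d%:R / delta)).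
  rewrite ler_pdivrMr ?exprn_gt0// mulrC -ler_pdivrMr//.
  have q0 : 0 <= d%:R / delta by rewrite divr_ge0// ltW.
  apply: (le_trans (ltW (archi_boundP q0))); rewrite -natrX ler_nat.
  exact: ltnW (ltn_expl _ _).
pose c1 := c / d%:R `^ s.
have dp : 0 < (d%:R : R) `^ s by rewrite powR_gt0// ltr0n.
have c10 : 0 < c1 by rewrite divr_gt0.
(* The first summand serves the levels from k0 on, after normalising a mass of at least c1; the
   second makes the bound exceed 1 at coarser levels. *)
exists s => //; exists (c1^-1 + pw2 (s * k0%:R)) => n.
pose n' := maxn n k0.
have k0n : (k0 <= n')%N by exact: leq_maxr.
have [m hm] : exists m, frost E s n' k0 E m.
  pose A : nat := (`|Num.ceil (2 ^+ k0 * B)|).+1.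
  pose S : seq {ffun 'I_d -> int} :=
    undup [seq [ffun t => (b t : nat)%:Z - A%:Z] | b : {ffun 'I_d -> 'I_(2 * A)}].
  have [m hm] := frost_seq (undup_uniq _ : uniq S)
     (fun xi => frost_tree E s_ge0 xi k0n).
  exists m; apply: frost_ext hm => x Ex; split => // _.
  have bd t : (0 <= cell k0 x t + A%:Z) && (absz (cell k0 x t + A%:Z)%R < 2 * A)%N.
    rewrite ffunE; set y := 2 ^+ k0 * x ord0 t.
    have yB : `|y| <= 2 ^+ k0 * B.
      by rewrite normrM (ger0_norm (exprn_ge0 _ _))// ler_wpM2l ?exprn_ge0// EB.
    move: yB; rewrite ler_norml => /andP[y1 y2].
    have cc := ceil_ge (2 ^+ k0 * B).
    have f1 : Num.floor y <= Num.ceil (2 ^+ k0 * B).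
      by rewrite -(ler_int R); apply: (le_trans (floor_le y)); exact: le_trans cc.
    have f2 : - Num.ceil (2 ^+ k0 * B) <= Num.floor y.
      by rewrite floor_ge_int rmorphN; apply: le_trans y1; rewrite lerN2.
    exact: int_in_box f2 f1.
  move: (cell k0 x) bd => z bd.
  have lt t : (absz (z t + A%:Z)%R < 2 * A)%N by case/andP: (bd t).
  rewrite mem_undup; apply/mapP; exists [ffun t => Ordinal (lt t)].
    by rewrite mem_enum.
  apply/ffunP => t; rewrite !ffunE /=.
  by have /andP[z0 _] := bd t; rewrite gez0_abs// addrK.
have [[L [L1 L2 L3]] [Cv [C1 C2 C3]]] := hm.
(* The dual side: the mass equals the cost of a cover by small cells, which the positive content
   bounds from below. *)
have cm : c1 <= m.
  rewrite /c1 ler_pdivrMr// mulrC -C3.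
  by apply: (finite_cell_cover d0 s_ge0 cov hk0 C1) => x Ex; exact: C2.
have m0 : 0 < m by exact: lt_le_trans cm.
have [x0 Ex0] : E !=set0.
  case: L L1 L2 {L3} => [|a L] L1 L2.
    by move: m0; rewrite -L2 /wmass big_nil ltxx.
  by have [_ Ea _] := L1 a (mem_head _ _); exists a.2.
exists (size L) => N LN.
(* Indices past the list yield the default: weight 0 at a point of [E]. *)
exists (fun i => (nth (0, x0) L i).1 / m), (fun i => (nth (0, x0) L i).2).
have sumE (P : pred V) : \sum_(i < N | P (nth (0, x0) L i).2) (nth (0, x0) L i).1 / m = wmass L P / m.
  rewrite -mulr_suml; congr (_ / _).
  rewrite /wmass (big_nth (0, x0)) big_mkcond [RHS]big_mkcond /=.
  rewrite -(big_mkord xpredT (fun i => if P (nth (0, x0) L i).2 then (nth (0, x0) L i).1 else 0)).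
  rewrite (big_cat_nat _ LN)//= [X in _ + X]big_nat_cond [X in _ + X]big1 ?addr0//.
  by move=> i /andP[/andP[iL _] _]; rewrite nth_default//=; case: ifP.
split.
- move=> i; rewrite divr_ge0 ?(ltW m0)//.
  have [iL|iL] := ltnP i (size L); last by rewrite nth_default.
  by have [] := L1 _ (mem_nth (0, x0) iL).
- move=> i; have [iL|iL] := ltnP i (size L); last by rewrite nth_default.
  by have [] := L1 _ (mem_nth (0, x0) iL).
- by rewrite (sumE xpredT) L2 divff// gt_eqF.
move=> k xi kn; rewrite (sumE (fun y => cell k y == xi)).
have pk : 0 < pw2 (- (s * k%:R)) by exact: pw2_gt0.
have [k0k|kk0] := leqP k0 k.
  apply: (@le_trans _ _ (pw2 (- (s * k%:R)) / m)).
    rewrite ler_wpM2r ?invr_ge0 ?(ltW m0)// L3// k0k.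
    by rewrite (leq_trans kn) ?leq_maxl.
  rewrite mulrC ler_wpM2r ?(ltW pk)//.
  rewrite ler_wpDr ?pw2_ge0// lef_pV2 ?posrE//.
apply: (@le_trans _ _ 1).
  rewrite ler_pdivrMr// mul1r -L2; apply: wmass_le => a /L1[] //.
rewrite mulrDl ler_wpDl ?mulr_ge0 ?invr_ge0 ?(ltW c10) ?(ltW pk)//.
rewrite -pw2D -[leLHS]pw2_0; apply: pw2_le.
rewrite -mulrBr mulr_ge0// subr_ge0 ler_nat; exact: ltnW.
Qed.

End Frostman.

(** * Products of Frostman measures *)

Section ProductMeasure.
Variables (R : realType) (d : nat).
Local Notation V := 'rV[R]_d.

Definition frostman_weights (E : set V) (s C : R) (n N : nat) (w : nat -> R) (x : nat -> V) :=
  [/\ forall i, 0 <= w i, forall i, E (x i), \sum_(i < N) w i = 1 &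
      forall k xi, (k <= n)%N ->
        \sum_(i < N | cell k (x i) == xi) w i <= C * pw2 (- (s * k%:R))].

Lemma frostman_weights_le (E : set V) (s s' C C' : R) n N w x : s' <= s -> C <= C' ->
  0 <= C' -> frostman_weights E s C n N w x -> frostman_weights E s' C' n N w x.
Proof.
move=> ss CC C0 [h1 h2 h3 h4]; split => // k xi kn; apply: (le_trans (h4 k xi kn)).
apply: (@le_trans _ _ (C' * pw2 (- (s * k%:R)))).
  by rewrite ler_wpM2r ?pw2_ge0.
by rewrite ler_wpM2l//; apply: pw2_le; rewrite lerN2 ler_wpM2r.
Qed.

Lemma frostman_family (E : nat -> set V) (s0 : R) (m : nat) : (0 < d)%N -> 0 <= s0 ->
  (forall i, (i < m)%N -> compact (E i)) ->
  (forall i, (i < m)%N -> (s0%:E < hausdorff_dim (E i))%E) ->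
  exists s C : R, [/\ s0 < s, 1 <= C & forall n, exists N0, forall N, (N0 <= N)%N ->
    forall i, (i < m)%N -> exists (w : nat -> R) (x : nat -> V),
      frostman_weights (E i) s C n N w x].
Proof.
move=> d0 s00; elim: m => [|m IH] cE dE.
  exists (s0 + 1), 1; split; [lra|by []|by move=> n; exists 0%N].
have [s1 [C1 [s01 C11 H1]]] := IH (fun i h => cE i (ltnW h)) (fun i h => dE i (ltnW h)).
have [s2 s02 [C2 H2]] := frostman d0 (cE m (ltnSn m)) s00 (dE m (ltnSn m)).
exists (Num.min s1 s2), (Num.max C1 C2); split.
- by rewrite lt_min s01.
- by rewrite le_max C11.
move=> n; have [N1 h1] := H1 n; have [N2 h2] := H2 n.
exists (maxn N1 N2) => N; rewrite geq_max => /andP[n1 n2] i.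
have C0 : 0 <= Num.max C1 C2 by rewrite le_max (le_trans ler01 C11).
rewrite ltnS leq_eqVlt => /predU1P[->|im].
  have [w [x h]] := h2 N n2; exists w, x.
  by apply: frostman_weights_le h => //; rewrite ?ge_min ?le_max lexx orbT.
have [w [x h]] := h1 N n1 i im; exists w, x.
by apply: frostman_weights_le h => //; rewrite ?ge_min ?le_max lexx.
Qed.

Variables (l n N : nat) (E : 'I_l -> set V) (s C : R).
Variables (w : 'I_l -> nat -> R) (x : 'I_l -> nat -> V).
Hypothesis wx : forall j, frostman_weights (E j) s C n N (w j) (x j).

Definition prod_weight (f : {ffun 'I_l -> 'I_N}) : R := \prod_j w j (f j).

Lemma prod_weight_ge0 f : 0 <= prod_weight f.
Proof. by apply: prodr_ge0 => j _; have [] := wx j. Qed.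

Lemma prod_weight_sum : \sum_f prod_weight f = 1.
Proof.
rewrite -(bigA_distr_bigA (fun j (i : 'I_N) => w j i)) big1// => j _.
by have [] := wx j.
Qed.

Lemma prod_weight_cell k (xi : 'I_l -> {ffun 'I_d -> int}) : (k <= n)%N ->
  \sum_(f : {ffun 'I_l -> 'I_N} | [forall j, cell k (x j (f j)) == xi j]) prod_weight f <=
  C ^+ l * pw2 (- (s * l%:R * k%:R)).
Proof.
move=> kn; pose F j (i : 'I_N) := if cell k (x j i) == xi j then w j i else 0.
apply: (@le_trans _ _ (\sum_(f : {ffun 'I_l -> 'I_N}) \prod_j F j (f j))).
  rewrite big_mkcond; apply: ler_sum => f _; case: ifPn => [/forallP h|_].
    by rewrite /F (eq_bigr (fun j => w j (f j)))// => j _; rewrite (eqP (h j)) eqxx.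
  by apply: prodr_ge0 => j _; rewrite /F; case: ifP => // _; have [] := wx j.
rewrite -bigA_distr_bigA.
have -> : C ^+ l * pw2 (- (s * l%:R * k%:R)) = \prod_(j < l) (C * pw2 (- (s * k%:R))).
  by rewrite prodr_const card_ord exprMn -pw2Mn; congr (_ * pw2 _); ring.
apply: ler_prod => j _; apply/andP; split.
  by apply: sumr_ge0 => i _; rewrite /F; case: ifP => // _; have [] := wx j.
by rewrite -big_mkcond /=; have [_ _ _ h] := wx j; exact: h.
Qed.

End ProductMeasure.

(** * From dyadic cells to balls *)

Section CellsToBalls.
Variables (R : realType) (T I : finType) (w : I -> R) (X : I -> T -> R).
Variables (C S : R) (n : nat).
Hypothesis w0 : forall i, 0 <= w i.
Hypothesis w1 : \sum_i w i <= 1.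
Hypothesis C1 : 1 <= C.
Hypothesis S0 : 0 <= S.
Hypothesis cells : forall k (xi : T -> int), (k <= n)%N ->
  \sum_(i | [forall t, Num.floor (2 ^+ k * X i t) == xi t]) w i <=
  C * pw2 (- (S * k%:R)).

Definition ball_cst (A : R) : R := (Num.bound (4 * A + 2))%:R ^+ #|T| * C.

(** For the least k with 2^-k <= rho, a ball of radius A rho meets at most [Num.bound (4 * A + 2)]
    cells of level k in each coordinate, as rho < 2 * 2^-k. When k = 0, rho >= 1 and the total mass
    suffices. *)
Lemma cells_to_ball (A : R) (x0 : T -> R) (rho : R) : 1 <= A -> 2 ^- n <= rho ->
  \sum_(i | [forall t, `|X i t - x0 t| <= A * rho]) w i <= ball_cst A * rho `^ S.
Proof.
move=> A1 nr.
have A4 : 0 <= 4 * A + 2 by lra.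
set m := Num.bound (4 * A + 2).
have m4 : 4 * A + 2 < m%:R by exact: archi_boundP.
have m1 : (1 : R) <= m%:R by apply: ltW; apply: le_lt_trans m4; lra.
have C0 : 0 <= C by exact: le_trans ler01 C1.
have Km : C <= ball_cst A by rewrite /ball_cst ler_peMl// exprn_ege1.
have rho0 : 0 < rho by apply: lt_le_trans nr; rewrite invr_gt0 exprn_gt0.
have ex : exists k, (2 : R) ^- k <= rho by exists n.
pose k := ex_minn ex.
have [kr kmin] : (2 : R) ^- k <= rho /\ forall j, 2 ^- j <= rho -> (k <= j)%N.
  by rewrite /k; case: ex_minnP.
have kn : (k <= n)%N by exact: kmin.
have [k0|kp] := posnP k.
  have r1 : 1 <= rho by move: kr; rewrite k0 expr0 invr1.
  have p1 : 1 <= rho `^ S.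
    by rewrite -[leLHS](powRr0 rho); exact: ler_powR.
  apply: (@le_trans _ _ (1 * 1)); last first.
    by apply: ler_pM => //; apply: le_trans Km.
  rewrite mulr1; apply: le_trans w1; rewrite big_mkcond; apply: ler_sum => i _.
  by case: ifP.
have rk : rho < 2 * 2 ^- k.
  rewrite ltNge; apply/negP => h.
  have : (k <= k.-1)%N.
    apply: kmin; apply: le_trans h; rewrite -[in leRHS](prednK kp) exprS invfM.
    by rewrite mulrA divff// mul1r.
  by rewrite leqNgt ltn_predL kp.
have P0 : (0 : R) < 2 ^+ k by exact: exprn_gt0.
pose base t := Num.floor (2 ^+ k * (x0 t - A * rho)).
apply: (@le_trans _ _ (\sum_(b : {ffun T -> 'I_m})
   \sum_(i | [forall t, Num.floor (2 ^+ k * X i t) == base t + (b t : nat)%:Z]) w i)); last first.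
  apply: (@le_trans _ _ (\sum_(b : {ffun T -> 'I_m}) C * pw2 (- (S * k%:R)))).
    by apply: ler_sum => b _; exact: (cells (fun t => base t + (b t : nat)%:Z)).
  rewrite sumr_const card_ffun card_ord -[leLHS]mulr_natl natrX mulrA.
  rewrite -/(ball_cst A) ler_wpM2l ?(le_trans _ Km) ?(le_trans ler01 C1)//.
  have -> : - (S * k%:R) = - k%:R * S by ring.
  rewrite pw2M pw2N pw2_nat.
  by apply: ge0_ler_powR; rewrite ?nnegrE ?invr_ge0 ?exprn_ge0 ?(ltW rho0).
rewrite big_mkcond (eq_bigr _ (fun b _ => big_mkcond _ _)) exchange_big /=.
apply: ler_sum => i _; case: ifPn => [/forallP near|_]; last first.
  by apply: sumr_ge0 => b _; case: ifP.
have bnd t : base t <= Num.floor (2 ^+ k * X i t) /\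
    (absz (Num.floor (2 ^+ k * X i t) - base t)%R < m)%N.
  have := near t; rewrite ler_norml => /andP[n1 n2].
  have h1 : 2 ^+ k * (x0 t - A * rho) <= 2 ^+ k * X i t.
    by rewrite ler_pM2l//; lra.
  have h2 : base t <= Num.floor (2 ^+ k * X i t) by exact: le_floor.
  split => //.
  rewrite -(ltr_nat R); apply: lt_trans m4.
  have -> : (absz (Num.floor (2 ^+ k * X i t) - base t)%R)%:R =
     (Num.floor (2 ^+ k * X i t))%:~R - (base t)%:~R :> R.
    by rewrite -intrB -{2}(gez0_abs (_ : 0 <= Num.floor (2 ^+ k * X i t) - base t))// subr_ge0.
  have f1 := floor_le (2 ^+ k * X i t).
  have /andP[_] := floor_itv (2 ^+ k * (x0 t - A * rho)); rewrite -/(base t) intrD => f2.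
  have h3 : 2 ^+ k * (X i t - (x0 t - A * rho)) <= 2 ^+ k * (2 * A * rho).
    by rewrite ler_pM2l//; lra.
  have h4 : 2 ^+ k * rho < 2.
    by move: rk; rewrite -(ltr_pM2l P0) mulrCA mulfV ?mulr1// lt0r_neq0.
  have h5 : A * (2 ^+ k * rho) <= A * 2 by rewrite ler_wpM2l ?(ltW h4)//; lra.
  move: h3; rewrite mulrBr; lra.
pose b : {ffun T -> 'I_m} := [ffun t => Ordinal (bnd t).2].
rewrite (bigD1 b)//= [X in X + _](_ : _ = w i) ?lerDl.
  by apply: sumr_ge0 => b' _; case: ifP.
case: ifPn => // /negP[]; apply/forallP => t; rewrite ffunE /=.
have [h _] := bnd t; rewrite gez0_abs ?subr_ge0//.
by rewrite addrC subrK.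
Qed.

(** A nonempty ball in the Y coordinates is recentred at one of its points, which doubles the
    radius; the distance bound then places it in a ball of the X coordinates. *)
Lemma ball_of_cells (Y : I -> T -> R) (A : R) : 1 <= A ->
  (forall (i i' : I) (rho : R), (forall t, `|Y i t - Y i' t| <= rho) ->
     forall t, `|X i t - X i' t| <= A * rho) ->
  ball_cond w Y (ball_cst (2 * A)) S (2 ^- n).
Proof.
move=> A1 YX y0 rho nr.
have [/existsP[i0 /forallP hi0]|/existsPn none] := boolP [exists i, [forall t, `|Y i t - y0 t| <= rho]].
  apply: le_trans (cells_to_ball (X i0) (_ : 1 <= 2 * A) nr); last by lra.
  rewrite big_mkcond [leRHS]big_mkcond; apply: ler_sum => i _.
  case: ifPn => [/forallP hi|_]; last by case: ifP.
  case: ifPn => // /negP[]; apply/forallP => t.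
  rewrite -mulrA mulrCA; apply: YX => t'.
  have -> : Y i t' - Y i0 t' = (Y i t' - y0 t') - (Y i0 t' - y0 t') by ring.
  by apply: (le_trans (ler_normB _ _)); have := hi t'; have := hi0 t'; lra.
rewrite big1; last by move=> i hi; have := none i; rewrite hi.
by rewrite mulr_ge0 ?powR_ge0// /ball_cst mulr_ge0 ?exprn_ge0// (le_trans ler01 C1).
Qed.

End CellsToBalls.

(** * Sets of sums of bilinear forms *)

Section BilinearForms.
Variables (R : realType) (d : nat) (Q : 'rV[R]_d -> 'rV[R]_d -> R).
Hypothesis nQ : nondeg_sym_bilinear Q.
Local Notation V := 'rV[R]_d.

Definition basis_vec (b : 'I_d) : V := delta_mx ord0 b.

Lemma bilinear_suml (a : 'I_d -> R) (v : 'I_d -> V) z :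
  Q (\sum_b a b *: v b) z = \sum_b a b * Q (v b) z.
Proof.
have [lin1 _ _ _] := nQ.
have Q0 : Q 0 z = 0.
  have := lin1 1 0 0 z; rewrite scaler0 addr0 mul1r => /eqP.
  by rewrite -subr_eq subrr => /eqP.
elim/big_rec2: _ => [|b x y _ IH]; first exact: Q0.
by rewrite lin1 IH.
Qed.

Lemma bilinearC x y : Q x y = Q y x. Proof. by have [] := nQ. Qed.

Lemma bilinear_coordl x z : Q x z = \sum_a x ord0 a * Q (basis_vec a) z.
Proof. by rewrite {1}(row_sum_delta x) bilinear_suml. Qed.

Lemma bilinear_coordr x y : Q x y = \sum_b Q x (basis_vec b) * y ord0 b.
Proof.
rewrite bilinearC bilinear_coordl; apply: eq_bigr => b _.
by rewrite mulrC bilinearC.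
Qed.

Definition gram : 'M[R]_d := \matrix_(a, b) Q (basis_vec a) (basis_vec b).

Lemma gramE x b : (x *m gram) ord0 b = Q x (basis_vec b).
Proof. by rewrite mxE bilinear_coordl; apply: eq_bigr => a _; rewrite mxE. Qed.

Lemma gram_unit : gram \in unitmx.
Proof.
rewrite -row_free_unit -kermx_eq0; apply/rowV0P => u /sub_kermxP u0.
have [_ _ _ nd] := nQ; apply: nd => y; rewrite bilinear_coordr big1// => b _.
by rewrite -gramE u0 mxE mul0r.
Qed.

(** The inverse Gram matrix recovers x from the values Q(x, e_b). This is where nondegeneracy
    enters: pushing points through [Q] does not concentrate their measure. *)
Lemma bilinear_dist_inv : exists2 A : R, 0 <= A &
  forall (x y : V) rho, (forall b, `|Q x (basis_vec b) - Q y (basis_vec b)| <= rho) ->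
    forall a, `|x ord0 a - y ord0 a| <= A * rho.
Proof.
exists (\sum_a \sum_b `|invmx gram b a|).
  by apply: sumr_ge0 => a _; apply: sumr_ge0.
move=> x y rho h a.
have rho0 : 0 <= rho by apply: le_trans (h a).
have -> : x ord0 a - y ord0 a = \sum_b (Q x (basis_vec b) - Q y (basis_vec b)) * invmx gram b a.
  transitivity (((x - y) *m gram *m invmx gram) ord0 a).
    by rewrite mulmxK ?gram_unit// !mxE.
  rewrite mxE; apply: eq_bigr => b _; rewrite gramE; congr (_ * _).
  have [lin1 _ _ _] := nQ; have := lin1 (-1) y x (basis_vec b).
  by rewrite scaleN1r addrC mulN1r [RHS]addrC.
apply: (le_trans (ler_norm_sum _ _ _)).
apply: (@le_trans _ _ ((\sum_b `|invmx gram b a|) * rho)).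
  rewrite mulr_suml; apply: ler_sum => b _; rewrite normrM mulrC.
  by rewrite ler_wpM2l.
rewrite ler_wpM2r// [leRHS](bigD1 a)//= lerDl.
by apply: sumr_ge0 => a' _; apply: sumr_ge0.
Qed.

Lemma bilinear_bounded (B : R) : exists2 B' : R, 1 <= B' &
  forall x : V, (forall a, `|x ord0 a| <= B) -> forall b, `|Q x (basis_vec b)| <= B'.
Proof.
exists (1 + \sum_b \sum_a `|B| * `|Q (basis_vec a) (basis_vec b)|).
  by rewrite lerDl; apply: sumr_ge0 => b _; apply: sumr_ge0 => a _; exact: mulr_ge0.
move=> x xB b; rewrite bilinear_coordl; apply: (le_trans (ler_norm_sum _ _ _)).
apply: (@le_trans _ _ (\sum_a `|B| * `|Q (basis_vec a) (basis_vec b)|)).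
  apply: ler_sum => a _; rewrite normrM ler_wpM2r//.
  exact: le_trans (xB a) (ler_norm _).
rewrite [X in _ <= _ + X](bigD1 b)//= addrCA lerDl addr_ge0//.
by apply: sumr_ge0 => b' _; apply: sumr_ge0 => a _; exact: mulr_ge0.
Qed.

Lemma bilinear_continuous : continuous (fun p : V * V => Q p.1 p.2).
Proof.
have -> : (fun p : V * V => Q p.1 p.2) =
    (fun p => \sum_b (\sum_a p.1 ord0 a * Q (basis_vec a) (basis_vec b)) * p.2 ord0 b).
  apply: funext => p; rewrite bilinear_coordr; apply: eq_bigr => b _.
  by rewrite bilinear_coordl.
have addc : continuous (fun z : R * R => z.1 + z.2).
  by move=> z; apply: cvgD; [exact: cvg_fst|exact: cvg_snd].
move=> p; apply: cvg_big => // b _; apply: cvgM.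
  apply: cvg_big => // a _; apply: cvgM; last exact: cvg_cst.
  apply: (@continuous_comp _ _ _ fst (fun x : V => x ord0 a)).
    exact: cvg_fst.
  exact: coord_continuous.
apply: (@continuous_comp _ _ _ snd (fun x : V => x ord0 b)).
  exact: cvg_snd.
exact: coord_continuous.
Qed.

End BilinearForms.

(** * The set of sums *)

Section SumSet.
Variables (R : realType) (d : nat) (Q : nat -> 'rV[R]_d -> 'rV[R]_d -> R).
Variable E : nat -> set 'rV[R]_d.

Definition sum_set (l : nat) : set R := [set r : R | exists x : nat -> 'rV[R]_d,
      (forall i, (i < 2 * l)%N -> E i (x i)) /\
      r = \sum_(j < l) Q j (x (2 * j)%N) (x (2 * j).+1)].

Lemma sum_set_compact l :
  (forall j, (j < l)%N -> nondeg_sym_bilinear (Q j)) ->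
  (forall i, (i < 2 * l)%N -> compact (E i)) -> compact (sum_set l).
Proof.
elim: l => [|l IH] nQ cE.
  have -> : sum_set 0 = [set 0].
    apply/seteqP; split => r /=; first by case=> x [_ ->]; rewrite big_ord0.
    by move=> ->; exists (fun=> 0); rewrite big_ord0; split.
  exact: compact_set1.
have IH' : compact (sum_set l).
  apply: IH => [j jl|i il]; first by apply: nQ; exact: ltnW.
  by apply: cE; lia.
have c1 : compact (E (2 * l)%N) by apply: cE; lia.
have c2 : compact (E (2 * l).+1) by apply: cE; lia.
pose f (p : R * ('rV[R]_d * 'rV[R]_d)) : R := p.1 + Q l p.2.1 p.2.2.
have -> : sum_set l.+1 = f @` (sum_set l `*` (E (2 * l)%N `*` E (2 * l).+1)).
  apply/seteqP; split => r /=.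
    case=> x [xE ->]; rewrite big_ord_recr /=.
    exists (\sum_(j < l) Q j (x (2 * j)%N) (x (2 * j).+1), (x (2 * l)%N, x (2 * l).+1)) => //=.
    split; last by split; apply: xE; lia.
    by exists x; split => // i il; apply: xE; lia.
  case=> -[r' [y z]] [] /= [x [xE ->]] [Ey Ez] <-.
  exists (fun i => if i == (2 * l)%N then y else if i == (2 * l).+1 then z else x i).
  split.
    move=> i il; case: eqP => [->//|i1]; case: eqP => [->//|i2]; apply: xE; lia.
  rewrite big_ord_recr /= /f /= eqxx; congr (_ + _).
    apply: eq_bigr => j _; have := ltn_ord j => jl.
    have -> : (2 * j == 2 * l)%N = false by lia.
    have -> : (2 * j == (2 * l).+1)%N = false by lia.
    have -> : ((2 * j).+1 == 2 * l)%N = false by lia.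
    by have -> : ((2 * j).+1 == (2 * l).+1)%N = false by lia.
  by rewrite eqxx; have -> : ((2 * l).+1 == 2 * l)%N = false by lia.
apply: continuous_compact; last by apply: compact_setX => //; exact: compact_setX.
apply: continuous_subspaceT => p; apply: cvgD; first exact: cvg_fst.
apply: (@continuous_comp _ _ _ snd (fun q : 'rV[R]_d * 'rV[R]_d => Q l q.1 q.2)).
  exact: cvg_snd.
by apply: bilinear_continuous; apply: nQ.
Qed.

End SumSet.

Lemma dotv_nondeg (R : realType) d : nondeg_sym_bilinear (@dotv R d).
Proof.
split.
- move=> a x y z; rewrite /dotv mulr_sumr -big_split; apply: eq_bigr => k _ /=.
  by rewrite !mxE mulrDl mulrA.
- move=> a x y z; rewrite /dotv mulr_sumr -big_split; apply: eq_bigr => k _ /=.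
  by rewrite !mxE mulrDr mulrCA.
- by move=> x y; apply: eq_bigr => k _; rewrite mulrC.
- move=> x h; apply/rowP => k; rewrite mxE.
  have := h (delta_mx ord0 k); rewrite /dotv (bigD1 k)//= big1 ?addr0.
    by rewrite mxE !eqxx mulr1.
  by move=> j jk; rewrite mxE (negPf jk) andbF mulr0.
Qed.

(** Finiteness of the list is essential: the gap is a minimum over its members. *)
Lemma closed_gap (R : realType) (A : set R) (rl : seq R) (kp : R) : 0 < kp ->
  closed A -> ~ (interior A !=set0) ->
  exists2 gp, 0 < gp & forall r, r \in rl -> exists2 r', `|r' - r| <= kp &
    forall a, A a -> gp <= `|a - r'|.
Proof.
move=> kp0 cA nA; elim: rl => [|r rl [gp gp0 IH]]; first by exists 1.
have [r' [r'r nr']] : exists r', `|r' - r| <= kp /\ ~ A r'.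
  apply: contrapT => none; apply: nA; exists r.
  apply/nbhs_ballP; exists kp => // x; rewrite /ball /= => xr.
  apply: contrapT => nx; apply: none; exists x; split => //.
  by rewrite distrC ltW.
have oA : open (~` A) by exact: closed_openC.
have /nbhs_ballP[g2 g20 hg2] : nbhs r' (~` A) by exact: open_nbhs_nbhs.
exists (Num.min gp g2); first by rewrite lt_min gp0.
move=> x; rewrite inE => /predU1P[->|/IH [y yr hy]].
  exists r' => // a Aa; rewrite ge_min; apply/orP; right.
  rewrite leNgt; apply/negP => ar; apply: (hg2 a) => //.
  by rewrite /ball /= distrC.
by exists y => // a /hy; apply: le_trans; rewrite ge_min lexx.
Qed.

Lemma compact_family_bounded (R : realType) d (E : nat -> set 'rV[R]_d) m :
  (forall i, (i < m)%N -> compact (E i)) ->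
  exists2 B : R, 1 <= B & forall i, (i < m)%N -> forall x, E i x -> forall t, `|x ord0 t| <= B.
Proof.
elim: m => [|m IH] cE; first by exists 1.
have [B1 B11 h1] := IH (fun i h => cE i (ltnW h)).
have [B2 B21 h2] := compact_coord_bounded (cE m (ltnSn m)).
exists (Num.max B1 B2); first by rewrite le_max B11.
move=> i; rewrite ltnS leq_eqVlt => /predU1P[->|im] x Ex t; rewrite le_max.
  by rewrite (h2 x Ex t) orbT.
by rewrite (h1 i im x Ex t).
Qed.

(** * Restriction to a chart *)

Section LargeCoordinate.
Variables (R : realType) (T I : finType) (w : I -> R) (X : I -> T -> R) (C S eta dl : R).
Hypothesis w0 : forall i, 0 <= w i.
Hypothesis w1 : \sum_i w i = 1.
Hypothesis wX : ball_cond w X C S dl.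

(** Pigeonhole: the ball of radius eta about 0 has mass at most 1/2, and the rest is covered by the
    sets |X_c| >= eta; if each had mass below 1/(4|T|), the total would be at most 3/4. *)
Lemma large_coordinate : dl <= eta -> C * eta `^ S <= 2^-1 ->
  exists c, (4 * #|T|%:R)^-1 <= \sum_(i | eta <= `|X i c|) w i.
Proof.
move=> de Ce; apply: contrapT => none.
have low c : \sum_(i | eta <= `|X i c|) w i <= (4 * #|T|%:R)^-1.
  by rewrite leNgt; apply/negP => h; apply: none; exists c; exact: ltW.
have : 1 <= \sum_(i | [forall t, `|X i t - 0| <= eta]) w i +
    \sum_c \sum_(i | eta <= `|X i c|) w i.
  rewrite -[leLHS]w1 (eq_bigr _ (fun c _ => big_mkcond _ _)) exchange_big.
  rewrite [X in _ <= X + _]big_mkcond -big_split /=; apply: ler_sum => i _.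
  have s0 c : 0 <= (if eta <= `|X i c| then w i else 0) by case: ifP.
  case: ifPn => [_|]; first by rewrite lerDl sumr_ge0.
  rewrite negb_forall => /existsP[c]; rewrite subr0 -ltNge => hc.
  by rewrite add0r (bigD1 c)//= (ltW hc) lerDl sumr_ge0.
have := wX (fun=> 0) de.
have : \sum_c \sum_(i | eta <= `|X i c|) w i <= 4^-1.
  apply: (@le_trans _ _ (\sum_(c : T) (4 * #|T|%:R)^-1)); first exact: ler_sum.
  rewrite sumr_const -[leLHS]mulr_natl invfM mulrCA.
  have [->|T0] := eqVneq (#|T|%:R : R) 0; first by rewrite mul0r mulr0.
  by rewrite divff// mulr1.
lra.
Qed.

End LargeCoordinate.

Lemma floor_grid_dist (R : realType) n (x : R) :
  `|x - (Num.floor (2 ^+ n * x))%:~R / 2 ^+ n| <= 2 ^- n.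
Proof.
have P0 : (0 : R) < 2 ^+ n by exact: exprn_gt0.
have /andP[h1 h2] := floor_itv (2 ^+ n * x); rewrite intrD in h2.
have -> : x - (Num.floor (2 ^+ n * x))%:~R / 2 ^+ n =
    (2 ^+ n * x - (Num.floor (2 ^+ n * x))%:~R) / 2 ^+ n.
  by field; rewrite lt0r_neq0.
rewrite normrM normfV (gtr0_norm P0) ler_piMl ?invr_ge0 ?(ltW P0)//.
by rewrite ger0_norm; lra.
Qed.

Lemma floor_grid_norm (R : realType) n (x B : R) : `|x| <= B ->
  `|(Num.floor (2 ^+ n * x))%:~R / 2 ^+ n| <= B + 1.
Proof.
move=> xB; have h := floor_grid_dist n x.
have h1 : 2 ^- n <= 1 :> R by rewrite invf_le1 ?exprn_gt0// exprn_ege1// ler1n.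
have -> : (Num.floor (2 ^+ n * x))%:~R / 2 ^+ n =
    x - (x - (Num.floor (2 ^+ n * x))%:~R / 2 ^+ n) by ring.
by apply: (le_trans (ler_normB _ _)); lra.
Qed.

Lemma floor_grid_absz (R : realType) n lam (x B : R) : `|x| <= B ->
  2 * (B + 1) <= 2 ^+ lam ->
  (2 * absz (Num.floor (2 ^+ n * x)) <= 2 ^ (n + lam))%N.
Proof.
move=> xB Bl; have P0 : (0 : R) < 2 ^+ n by exact: exprn_gt0.
have := floor_grid_norm n xB.
rewrite normrM normfV (gtr0_norm P0) ler_pdivrMr// => h.
rewrite -(ler_nat R) natrM natrX exprD natr_absz intr_norm.
apply: (@le_trans _ _ (2 * ((B + 1) * 2 ^+ n))); first by rewrite ler_pM2l.
by rewrite mulrA [leRHS]mulrC ler_pM2r.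
Qed.

Section LargeChart.
Variables (R : realType) (T I J : finType) (w : I -> R) (v : J -> R).
Variables (X : I -> T -> R) (g : J -> T -> int) (B C S eta : R) (lam n : nat).
Hypothesis w0 : forall i, 0 <= w i.
Hypothesis w1 : \sum_i w i = 1.
Hypothesis v0 : forall j, 0 <= v j.
Hypothesis v1 : \sum_j v j = 1.
Hypothesis XB : forall i t, `|X i t| <= B.
Hypothesis gB : forall j t, (2 * absz (g j t) <= 2 ^ (n + lam))%N.
Hypothesis wX : ball_cond w X C S (2 ^- n).
Hypothesis vg : ball_cond v (fun j t => (g j t)%:~R / 2 ^+ n) C S (2 ^- n).

Lemma large_chart : 2 ^- n <= eta -> C * eta `^ S <= 2^-1 ->
  exists c (I' : finType) (h : I' -> I),
    chart_data B C S eta lam n c (w \o h) v (X \o h) g /\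
    (4 * #|T|%:R)^-1 <= \sum_i w (h i).
Proof.
move=> ne Ce; have [c hc] := large_coordinate w0 w1 wX ne Ce.
pose A := [set i | eta <= `|X i c|]%SET.
have sumA (P : pred I) : \sum_(i : {i in A} | P (val i)) w (val i) =
    \sum_(i | (i \in A) && P i) w i.
  by rewrite -(big_sub_cond A P w).
have sumA_le (P : pred I) : \sum_(i : {i in A} | P (val i)) w (val i) <= \sum_(i | P i) w i.
  rewrite sumA big_mkcond [leRHS]big_mkcond; apply: ler_sum => i _.
  by case: (i \in A) => //=; case: ifP.
exists c, {i in A}, val; split; last first.
  apply: (le_trans hc); rewrite (sumA predT) le_eqVlt; apply/orP; left; apply/eqP.
  by apply: eq_bigl => i; rewrite inE andbT.
split; first by split => //=; rewrite -w1; exact: (sumA_le predT).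
- by split => [i t|i|//]; [exact: XB|have := valP i; rewrite inE].
- move=> x0 rho nr; apply: le_trans (wX x0 nr).
  exact: (sumA_le (fun i => [forall t, `|X i t - x0 t| <= rho])).
exact: vg.
Qed.

End LargeChart.

Section FamilyBounds.
Variables (R : realType) (d : nat) (Q : nat -> 'rV[R]_d -> 'rV[R]_d -> R).
Local Notation V := 'rV[R]_d.

Lemma bilinear_family_dist_inv l : (forall j, (j < l)%N -> nondeg_sym_bilinear (Q j)) ->
  exists2 A : R, 1 <= A & forall j, (j < l)%N -> forall (x y : V) rho,
    (forall b, `|Q j x (basis_vec R b) - Q j y (basis_vec R b)| <= rho) ->
    forall a, `|x ord0 a - y ord0 a| <= A * rho.
Proof.
elim: l => [|l IH] nQ; first by exists 1.
have [A1 A11 h1] := IH (fun j h => nQ j (ltnW h)).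
have [A2 A20 h2] := bilinear_dist_inv (nQ l (ltnSn l)).
exists (A1 + A2); first by rewrite ler_wpDr.
move=> j; rewrite ltnS leq_eqVlt => jl x y rho h a.
have rho0 : 0 <= rho by exact: le_trans (h a).
rewrite mulrDl; case/predU1P: jl => [jl|jl].
  rewrite jl in h; apply: (le_trans (h2 x y rho h a)).
  by rewrite lerDr mulr_ge0// (le_trans ler01).
by apply: (le_trans (h1 j jl x y rho h a)); rewrite lerDl mulr_ge0.
Qed.

Lemma bilinear_family_bounded l (B : R) :
  (forall j, (j < l)%N -> nondeg_sym_bilinear (Q j)) ->
  exists2 B' : R, 1 <= B' & forall j, (j < l)%N -> forall x : V,
    (forall a, `|x ord0 a| <= B) -> forall b, `|Q j x (basis_vec R b)| <= B'.
Proof.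
elim: l => [|l IH] nQ; first by exists 1.
have [B1 B11 h1] := IH (fun j h => nQ j (ltnW h)).
have [B2 B21 h2] := bilinear_bounded (nQ l (ltnSn l)) B.
exists (Num.max B1 B2); first by rewrite le_max B11.
move=> j; rewrite ltnS leq_eqVlt => /predU1P[->|jl] x xB b; rewrite le_max.
  by rewrite h2 ?orbT.
by rewrite h1.
Qed.

Lemma sum_set_mem (E : nat -> set V) l (y : bool -> 'I_l -> V) : (0 < l)%N ->
  (forall (b : bool) (j : 'I_l), E (2 * j + b)%N (y b j)) ->
  sum_set Q E l (\sum_(j < l) Q j (y false j) (y true j)).
Proof.
move=> l0 yE; pose j0 := Ordinal l0.
exists (fun i => y (odd i) (insubd j0 i./2)); split => [i il|].
  have := yE (odd i) (insubd j0 i./2).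
  rewrite val_insubd; have -> : (i./2 < l)%N by lia.
  by have -> : (2 * i./2 + odd i = i)%N by lia.
apply: eq_bigr => j _.
have -> : (2 * j)./2 = j by lia.
have -> : (2 * j).+1./2 = j by lia.
have -> : odd (2 * j) = false by lia.
have -> : odd (2 * j).+1 by lia.
by rewrite valKd.
Qed.

End FamilyBounds.

Lemma pair_idx_lt l (j : 'I_l) (b : bool) : (2 * j + b < 2 * l)%N.
Proof. by have := ltn_ord j; case: b; lia. Qed.

(** * Assembling the argument *)

Section SumSetInterior.
Variables (R : realType) (l d : nat) (Q : nat -> 'rV[R]_d -> 'rV[R]_d -> R).
Variable E : nat -> set 'rV[R]_d.
Local Notation V := 'rV[R]_d.
Hypothesis l1 : (1 <= l)%N.
Hypothesis d1 : (1 <= d)%N.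
Hypothesis nQ : forall j, (j < l)%N -> nondeg_sym_bilinear (Q j).
Hypothesis cE : forall i, (i < 2 * l)%N -> compact (E i).
Hypothesis dE : forall i, (i < 2 * l)%N ->
     ((d%:R / 2 + 1 / (2 * l%:R))%:E < hausdorff_dim (E i))%E.

Let T : finType := ('I_l * 'I_d)%type.

Lemma sum_set_interior : interior (sum_set Q E l) !=set0.
Proof.
have lr : (0 : R) < l%:R by rewrite ltr0n.
have s00 : 0 <= d%:R / 2 + 1 / (2 * l%:R) :> R.
  by rewrite addr_ge0 ?divr_ge0// mulr_ge0.
have [s [C [ss C1 fam]]] := frostman_family d1 s00 cE dE.
have s_ge0 : 0 <= s by exact: le_trans s00 (ltW ss).
have [B0 B01 EB] := compact_family_bounded cE.
have [A A1 hA] := bilinear_family_dist_inv nQ.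
have [B1 B11 hB1] := bilinear_family_bounded B0 nQ.
pose S := s * l%:R.
have S0 : 0 <= S by rewrite mulr_ge0.
pose D : R := #|T|%:R.
have DE : D = l%:R * d%:R by rewrite /D card_prod !card_ord natrM.
have D1 : 1 <= D by rewrite DE -natrM ler1n muln_gt0 l1.
(* The dimension hypothesis, multiplied by 2l, is exactly this. *)
have DS : D + 1 < 2 * S.
  have : l%:R * (d%:R / 2 + 1 / (2 * l%:R)) < l%:R * s by rewrite ltr_pM2l.
  have -> : l%:R * (d%:R / 2 + 1 / (2 * l%:R)) = (D + 1) / 2 :> R.
    by rewrite DE; field; rewrite lt0r_neq0.
  rewrite /S; lra.
have Cl1 : 1 <= C ^+ l by rewrite exprn_ege1.
(* The first constant serves the vector X, through the inverse Gram matrices; the second serves Y,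
   whose rounding by at most 2^-n <= rho at most doubles a radius. *)
pose Cc := Num.max (ball_cst T (C ^+ l) (2 * A)) (ball_cst T (C ^+ l) 2).
have Cc1 : ball_cst T (C ^+ l) (2 * A) <= Cc by rewrite le_max lexx.
have Cc2 : ball_cst T (C ^+ l) 2 <= Cc by rewrite le_max lexx orbT.
have Cc0 : 0 <= Cc.
  by apply: le_trans Cc2; rewrite /ball_cst mulr_ge0 ?exprn_ge0// (le_trans ler01 C1).
have [e0 he0] : exists e0 : nat, Cc * (2 ^- e0) `^ S <= 2^-1 :> R.
  have a0 : 0 <= pw2 (- S) by exact: pw2_ge0.
  have a1 : pw2 (- S) < 1.
    rewrite pw2N invf_lt1 ?pw2_gt0//; apply: pw2_gt1; lra.
  have q0 : 0 < (2 * (Cc + 1))^-1 by rewrite invr_gt0 mulr_gt0// ltr_wpDl.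
  have [p hp] := exp_small a0 a1 q0.
  exists p.
  have -> : (2 ^- p) `^ S = pw2 (- S) ^+ p.
    by rewrite -pw2Mn -pw2_nat -pw2N -pw2M; congr pw2; ring.
  have h := hp p (leqnn p).
  have : Cc * pw2 (- S) ^+ p <= Cc * (2 * (Cc + 1))^-1 by rewrite ler_wpM2l.
  move=> /le_trans; apply; rewrite ler_pdivrMr ?mulr_gt0 ?ltr_wpDl//; lra.
pose eta : R := 2 ^- e0.
have eta0 : 0 < eta by rewrite invr_gt0 exprn_gt0.
pose B := Num.max B0 B1.
have B_1 : 1 <= B by rewrite le_max B01.
(* Rounding to the grid moves a coordinate by at most 1, hence B0 + 1. *)
pose R2 := 1 + D * (B * (B0 + 1)).
have R21 : 1 <= R2 by rewrite lerDl mulr_ge0 ?mulr_ge0//; lra.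
pose m0 := (4 * D)^-1.
have m00 : 0 < m0 by rewrite invr_gt0 mulr_gt0//; lra.
have [lam [lam1 lam2]] : exists lam : nat,
    32 * (R2 + 2) <= 2 ^+ lam * eta /\ 2 * (B0 + 1) <= 2 ^+ lam.
  have x0 : 0 <= 32 * (R2 + 2) / eta + 2 * (B0 + 1).
    by rewrite addr_ge0 ?divr_ge0 ?(ltW eta0)//; lra.
  exists (Num.bound (32 * (R2 + 2) / eta + 2 * (B0 + 1))).
  set b := Num.bound _.
  have h : 32 * (R2 + 2) / eta + 2 * (B0 + 1) <= 2 ^+ b.
    apply: (le_trans (ltW (archi_boundP x0))); rewrite -natrX ler_nat.
    exact: ltnW (ltn_expl _ _).
  have y0 : 0 <= 32 * (R2 + 2) / eta by rewrite divr_ge0 ?(ltW eta0)//; lra.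
  by split; [rewrite -ler_pdivrMr//; lra|lra].
have [rl [kp [kp0 core]]] := chart_core B_1 Cc0 eta0 R21 m00 DS lam1.
have clS : closed (sum_set Q E l).
  by apply: compact_closed; [exact: norm_hausdorff|exact: sum_set_compact].
apply: contrapT => nint.
have [gp gp0 gap] := closed_gap rl kp0 clS nint.
have gp2 : 0 < gp / 2 by rewrite divr_gt0.
have [n0 coren] := core _ gp2.
(* Fine enough for the core estimate at precision gp/2, for eta >= 2^-n, and for rounding Y to
   change X.Y by at most gp/2. *)
pose n := maxn (maxn n0 e0) (Num.bound (2 * (D * B) / gp)).
have nn0 : (n0 <= n)%N by rewrite /n !leq_max leqnn.
have ne0 : (e0 <= n)%N by rewrite /n !leq_max leqnn orbT.
have nerr : D * B * 2 ^- n <= gp / 2.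
  have x0 : 0 <= 2 * (D * B) / gp by rewrite divr_ge0 ?(ltW gp0)// mulr_ge0// mulr_ge0//; lra.
  have h : 2 * (D * B) / gp <= 2 ^+ n.
    apply: (le_trans (ltW (archi_boundP x0))); rewrite -natrX ler_nat.
    apply: (leq_trans (leq_maxr (maxn n0 e0) _)); exact: ltnW (ltn_expl _ _).
  rewrite ler_pdivrMr ?exprn_gt0//; move: h; rewrite ler_pdivrMr//; lra.
have [N hN] := fam n.
have [W hW] : exists W : nat -> (nat -> R) * (nat -> V), forall i, (i < 2 * l)%N ->
    frostman_weights (E i) s C n N (W i).1 (W i).2.
  have : forall i, exists p : (nat -> R) * (nat -> V), (i < 2 * l)%N ->
      frostman_weights (E i) s C n N p.1 p.2.
    move=> i; case: (ltnP i (2 * l)) => il; last by exists (fun=> 0, fun=> 0).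
    by have [w [x h]] := hN N (leqnn N) i il; exists (w, x).
  by move=> /choice [W h]; exists W.
pose Wx (b : bool) (j : 'I_l) := W (2 * j + b)%N.
have idx (b : bool) (j : 'I_l) : (2 * j + b < 2 * l)%N by exact: pair_idx_lt.
have hWx (b : bool) (j : 'I_l) : frostman_weights (E (2 * j + b)%N) s C n N (Wx b j).1 (Wx b j).2.
  exact: hW.
pose wt b : {ffun 'I_l -> 'I_N} -> R := prod_weight (fun j => (Wx b j).1).
pose pt b (f : {ffun 'I_l -> 'I_N}) (j : 'I_l) : V := (Wx b j).2 (f j).
have ptE (b : bool) f (j : 'I_l) : E (2 * j + b)%N (pt b f j) by have [_ h _ _] := hWx b j; exact: h.
have wt0 b f : 0 <= wt b f by exact: prod_weight_ge0 (hWx b) f.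
have wt1 b : \sum_f wt b f = 1 by exact: prod_weight_sum (hWx b).
pose co b f (t : T) : R := pt b f t.1 ord0 t.2.
have coB b f t : `|co b f t| <= B0 by exact: EB (idx b t.1) _ (ptE b f t.1) t.2.
have cells (b : bool) k (xi : T -> int) : (k <= n)%N ->
    \sum_(f | [forall t, Num.floor (2 ^+ k * co b f t) == xi t]) wt b f <=
    C ^+ l * pw2 (- (S * k%:R)).
  move=> kn; apply: le_trans (prod_weight_cell (hWx b) (fun j => [ffun a => xi (j, a)]) kn).
  rewrite le_eqVlt; apply/orP; left; apply/eqP; apply: eq_bigl => f.
  apply/forallP/forallP => [h j|h t].
    by apply/eqP/ffunP => a; rewrite !ffunE; exact/eqP/(h (j, a)).
  have /eqP/ffunP/(_ t.2) := h t.1; rewrite !ffunE => hh.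
  by apply/eqP; move: hh; rewrite -surjective_pairing.
(* In these coordinates the sum of the forms is the Euclidean product of X with the coordinates of
   the second points. Only the latter are rounded to the grid. *)
pose X f (t : T) : R := Q t.1 (pt false f t.1) (basis_vec R t.2).
pose g f (t : T) : int := Num.floor (2 ^+ n * co true f t).
have wt1' b : \sum_f wt b f <= 1 by rewrite wt1.
have ballX : ball_cond (wt false) X Cc S (2 ^- n).
  move=> x0 rho nr.
  apply: le_trans (ball_of_cells (wt0 false) (wt1' false) Cl1 S0 (cells false) A1 _ x0 nr) _.
    move=> f f' rh h t; rewrite /co; apply: (hA t.1 (ltn_ord _)) => b.
    exact: (h (t.1, b)).
  by rewrite ler_wpM2r ?powR_ge0.
have ballY : ball_cond (wt true) (fun f t => (g f t)%:~R / 2 ^+ n) Cc S (2 ^- n).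
  move=> y0 rho nr.
  have A2 : 1 <= 2 :> R by rewrite ler1n.
  apply: (@le_trans _ _ (ball_cst T (C ^+ l) 2 * rho `^ S)); last first.
    by rewrite ler_wpM2r ?powR_ge0.
  apply: le_trans (cells_to_ball (wt0 true) (wt1' true) Cl1 S0 (cells true) y0 A2 nr).
  rewrite big_mkcond [leRHS]big_mkcond; apply: ler_sum => f _.
  case: ifPn => [/forallP hi|_]; last by case: ifP.
  case: ifPn => // /negP[]; apply/forallP => t.
  have := hi t; rewrite /= ler_norml => /andP[h1 h2].
  have := floor_grid_dist n (co true f t); rewrite ler_norml => /andP[h3 h4].
  rewrite ler_norml; move: h1 h2 h3 h4 nr; rewrite /g; clear => *; apply/andP; split; lra.
have XB f t : `|X f t| <= B.
  by rewrite le_max (hB1 t.1 (ltn_ord _)) ?orbT// => a; exact: (coB false f (t.1, a)).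
have gB f t : (2 * absz (g f t) <= 2 ^ (n + lam))%N.
  exact: floor_grid_absz (coB true f t) lam2.
have gR f f' : `|grid_dot n X g f f'| <= R2.
  apply: (le_trans (ler_norm_sum _ _ _)).
  apply: (@le_trans _ _ (\sum_(t : T) B * (B0 + 1))).
    apply: ler_sum => t _; rewrite normrM; apply: ler_pM => //.
    exact: floor_grid_norm (coB true f' t).
  by rewrite sumr_const -[leLHS]mulr_natl /R2 lerDr.
have ne : 2 ^- n <= eta :> R.
  by rewrite lef_pV2 ?posrE ?exprn_gt0// ler_weXn2l// ler1n.
have [c [I' [h [data mw]]]] :=
  large_chart (wt0 false) (wt1 false) (wt0 true) (wt1 true) XB gB ballX ballY ne he0.
have [r rrl near] := coren n nn0 c _ _ _ _ _ _ data mw (fun i j => gR (h i) j).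
have [r' rr' far] := gap r rrl.
have [i [f' near']] := near r' rr'.
pose f := h i.
pose y b := pt b (if b then f' else f).
have /far : sum_set Q E l (\sum_(j < l) Q j (y false j) (y true j)).
  by apply: sum_set_mem => // b j; exact: ptE.
rewrite leNgt => /negP; apply.
have -> : \sum_(j < l) Q j (y false j) (y true j) = \sum_t X f t * co true f' t.
  rewrite (eq_bigr _ (fun j _ => bilinear_coordr (nQ (ltn_ord j)) _ _)).
  by rewrite pair_big.
have dist : `|\sum_t X f t * co true f' t - grid_dot n X g f f'| <= D * B * 2 ^- n.
  rewrite /grid_dot -sumrB; apply: (le_trans (ler_norm_sum _ _ _)).
  apply: (@le_trans _ _ (\sum_(t : T) B * 2 ^- n)).
    apply: ler_sum => t _; rewrite -mulrBr normrM; apply: ler_pM => //.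
    exact: floor_grid_dist.
  by rewrite sumr_const -[leLHS]mulr_natl mulrA.
have {}near' : `|grid_dot n X g f f' - r'| < gp / 2 by exact: near'.
move: dist near' nerr; move: (grid_dot _ _ _ _ _) (\sum_t _) => u z.
clear => h1 h2 h3; apply: le_lt_trans (ler_distD u z r') _; lra.
Qed.

End SumSetInterior.

Theorem theorem1p7 (R : realType) (l d : nat) (Q : nat -> 'rV[R]_d -> 'rV[R]_d -> R)
    (E : nat -> set 'rV[R]_d) :
  (1 <= l)%N -> (1 <= d)%N ->
  (forall j, (j < l)%N -> nondeg_sym_bilinear (Q j)) ->
  (forall i, (i < 2 * l)%N -> compact (E i)) ->
  (forall i, (i < 2 * l)%N ->
     ((d%:R / 2 + 1 / (2 * l%:R))%:E < hausdorff_dim (E i))%E) ->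
  (interior [set r : R | exists x : nat -> 'rV[R]_d,
      (forall i, (i < 2 * l)%N -> E i (x i)) /\
      r = \sum_(j < l) Q j (x (2 * j)%N) (x (2 * j).+1)] !=set0)
  /\
  (interior [set r : R | exists x : nat -> 'rV[R]_d,
      (forall i, (i < 2 * l)%N -> E i (x i)) /\
      r = \sum_(j < l) dotv (x (2 * j)%N) (x (2 * j).+1)] !=set0).
Proof.
move=> l1 d1 nQ cE dE; split; first exact: sum_set_interior.
apply: (@sum_set_interior R l d (fun=> @dotv R d) E) => // j _.
exact: dotv_nondeg.
Qed.
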